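(* Let $n\ge 3$ and let $a,b$ be real numbers with $a<n$, $b<n$. Let $\mathbf X$ be an i.i.d. sample of size $n$ from the bivariate normal distribution with parameters $(\mu_1,\mu_2,\sigma_1,\sigma_2,\rho)$, use the prior $\pi_{ab}$, and let $(\eta_3^* )_{1-\alpha}$ denote the posterior $1-\alpha$ quantile, given $\mathbf X$, of $\eta_3=-\dfrac{\rho}{\sigma_1\sqrt{1-\rho^2}}$. Let $\alpha\in(0,1)$. (a) For every $\boldsymbol\xi=(\mu_1,\mu_2,\sigma_1,\sigma_2)$ and $\rho\in(-1,1)$, $$P(\eta_3<(\eta_3^* )_{1-\alpha}\mid\boldsymbol\xi,\rho)=P\left(\frac{Z_3+\frac{\rho}{\sqrt{1-\rho^2}}\sqrt{\chi^2_{n-1}}}{\sqrt{\chi^2_{n-2}}}<\left(\frac{Z_3^*+\frac{\rho}{\sqrt{1-\rho^2}}\sqrt{\chi^2_{n-1}}}{\sqrt{\chi^{2*}_{n-b}}}\right)_{1-\alpha}\ \Big|\ \rho\right),$$ where the same variable $\chi^2_{n-1}$ appears on both sides of the inequality and is held fixed when computing the quantile. (b) The quantity in (a) equals $1-\alpha$ for every $\rho\in(-1,1)$ if and only if $b=2$.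
   Context: Model: $\mathbf x_k=(x_{1k},x_{2k})'$, $k=1,\dots,n$, are i.i.d. bivariate normal with mean $(\mu_1,\mu_2)'\in\mathbb R^2$ and covariance matrix $\boldsymbol\Sigma=\begin{pmatrix}\sigma_1^2&\rho\sigma_1\sigma_2\\ \rho\sigma_1\sigma_2&\sigma_2^2\end{pmatrix}$, $\sigma_1,\sigma_2>0$, $|\rho|<1$. Prior: $\pi_{ab}$ is the (improper) density, with respect to $d\mu_1\,d\mu_2\,d\sigma_1\,d\sigma_2\,d\rho$, $$\pi_{ab}(\mu_1,\mu_2,\sigma_1,\sigma_2,\rho)=\frac{1}{\sigma_1^{3-a}\sigma_2^{2-b}(1-\rho^2)^{2-b/2}},$$ and the posterior given $\mathbf X$ is the normalized product of likelihood and prior (proper when $a<n$, $b<n$). Random variables: $Z_3$ and $Z_3^*$ are standard normal; $\chi^2_m$ and $\chi^{2*}_m$ denote chi-squared random variables with $m$ (real, positive) degrees of freedom, i.e. Gamma with shape $m/2$ and rate $1/2$. All of $Z_3,\chi^2_{n-1},\chi^2_{n-2},Z_3^*,\chi^{2*}_{n-b}$ are mutually independent. Quantiles: $(W)_{\beta}$ denotes the $\beta$ quantile of $W$ with respect to the distribution of the starred variables only, all non-starred quantities being held fixed. Frequentist coverage: $P(\cdot\mid\boldsymbol\xi,\rho)$ on the left is probability under the sampling distribution of $\mathbf X$ with the parameters fixed; $(\eta_3^* )_{1-\alpha}$ is a function of $\mathbf X$. *)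

(* Defs.v *)
From HB Require Import structures.
From mathcomp Require Import all_boot all_order all_algebra.
From mathcomp Require Import all_classical all_reals all_analysis.
From mathcomp Require Import measurable_realfun.
Set Implicit Arguments.
Unset Strict Implicit.
Unset Printing Implicit Defensive.
Import Order.TTheory GRing.Theory Num.Theory.
Import numFieldNormedType.Exports.
Local Open Scope classical_set_scope.
Local Open Scope ring_scope.

Definition has_density (R : realType) d (Omega : measurableType d)
    (P : set Omega -> \bar R) d' (T : measurableType d')
    (nu : set T -> \bar R) (X : Omega -> T) (f : T -> R) : Prop :=
  forall A : set T, measurable A ->
    pushforward P X A = (\int[nu]_(x in A) (f x)%:E)%E.

Definition mutually_independent (R : realType) d (Omega : measurableType d)
    (P : set Omega -> \bar R) (I : finType) d' (T : measurableType d')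
    (X : I -> Omega -> T) : Prop :=
  forall (J : {set I}) (A : I -> set T), (forall i, measurable (A i)) ->
    P [set w | forall i, i \in J -> A i (X i w)] =
    (\prod_(i in J) P (X i @^-1` A i))%E.

Definition quantile (R : realType) (law : set R -> \bar R) (p : R) : R :=
  inf [set t : R | (p%:E <= law `]-oo, t]%classic)%E].

Definition gamma_fun (R : realType) (s : R) : R :=
  \int[lebesgue_measure]_(x in `]0, +oo[) (x `^ (s - 1) * expR (- x)).

(** Shape [k], rate [r]. *)
Definition gamma_pdf (R : realType) (k r x : R) : R :=
  if 0 < x then r `^ k / gamma_fun k * x `^ (k - 1) * expR (- (r * x)) else 0.

Definition chi2_pdf (R : realType) (m : R) : R -> R := gamma_pdf (m / 2) 2^-1.

(** A parameter is a tuple [(mu1, mu2, sigma1, sigma2, rho)]. *)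
Notation param R := (R * R * R * R * R)%type (only parsing).

Definition param_space (R : realType) : set (param R) :=
  [set th | let: (mu1, mu2, s1, s2, rho) := th in
            [/\ 0 < s1, 0 < s2 & -1 < rho < 1]].

Definition row2 (R : realType) (x : R * R) : 'rV[R]_2 :=
  \row_(j < 2) [:: x.1; x.2]`_j.

Definition covariance_mx (R : realType) (s1 s2 rho : R) : 'M[R]_2 :=
  \matrix_(i < 2, j < 2)
    (nth [::] [:: [:: s1 ^+ 2; rho * s1 * s2];
                  [:: rho * s1 * s2; s2 ^+ 2]] i)`_j.

(** Law with mean [mu] and invertible covariance matrix [S]. *)
Definition mvnormal_pdf (R : realType) (k : nat) (mu : 'rV[R]_k) (S : 'M[R]_k)
    (x : 'rV[R]_k) : R :=
  (Num.sqrt ((2 * pi) ^+ k * \det S))^-1 *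
  expR (- (((x - mu) *m invmx S *m (x - mu)^T) 0 0 / 2)).

Definition binormal_pdf (R : realType) (th : param R) (x : R * R) : R :=
  let: (mu1, mu2, s1, s2, rho) := th in
  mvnormal_pdf (row2 (mu1, mu2)) (covariance_mx s1 s2 rho) (row2 x).

Definition iid_binormal (R : realType) d (Omega : measurableType d)
    (P : set Omega -> \bar R) (n : nat) (X : 'I_n -> Omega -> R * R)
    (th : param R) : Prop :=
  mutually_independent P X /\
  forall k, has_density P (lebesgue_measure \x lebesgue_measure)%E (X k)
                        (binormal_pdf th).

Definition prior (R : realType) (a b : R) (th : param R) : R :=
  let: (mu1, mu2, s1, s2, rho) := th in
  (s1 `^ (3 - a) * s2 `^ (2 - b) * (1 - rho ^+ 2) `^ (2 - b / 2))^-1.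

Definition likelihood (R : realType) (n : nat) (x : 'I_n -> R * R)
    (th : param R) : R :=
  \prod_(k < n) binormal_pdf th (x k).

(** On [measurableTypeR R], the carrier [R] with the sigma-algebra on which
    [lebesgue_measure] is defined. *)
Definition lebesgue5 (R : realType) :
    set (measurableTypeR R * measurableTypeR R * measurableTypeR R
         * measurableTypeR R * measurableTypeR R) -> \bar R :=
  (lebesgue_measure \x lebesgue_measure \x lebesgue_measure
     \x lebesgue_measure \x lebesgue_measure)%E.

Definition posterior_mass (R : realType) (a b : R) (n : nat)
    (x : 'I_n -> R * R) (A : set (param R)) : \bar R :=
  (\int[@lebesgue5 R]_(th in @param_space R `&` A)
     (likelihood x th * prior a b th)%:E)%E.

(** Proper for almost every sample when [a, b < n]. On the remaining null set
    of samples the total mass is infinite, so its [fine] is [0] and the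
    quotient is the junk value [0]. *)
Definition posterior (R : realType) (a b : R) (n : nat) (x : 'I_n -> R * R)
    (A : set (param R)) : \bar R :=
  (fine (posterior_mass a b x A) / fine (posterior_mass a b x setT))%:E.

Definition eta3 (R : realType) (th : param R) : R :=
  let: (mu1, mu2, s1, s2, rho) := th in
  - (rho / (s1 * Num.sqrt (1 - rho ^+ 2))).

Definition eta3_posterior_quantile (R : realType) (a b : R) (n : nat)
    (x : 'I_n -> R * R) (p : R) : R :=
  quantile (pushforward (posterior a b x) (@eta3 R)) p.

Definition rho_ratio (R : realType) (rho : R) : R := rho / Num.sqrt (1 - rho ^+ 2).

Definition pivot (R : realType) (rho z c1 c2 : R) : R :=
  (z + rho_ratio rho * Num.sqrt c1) / Num.sqrt c2.

(** Only the starred variables [Zs], [Cs] are random here; [c1] is the fixed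
    value of the unstarred chi-squared variable. *)
Definition starred_quantile (R : realType) d (Omega : measurableType d)
    (Q : set Omega -> \bar R) (Zs Cs : Omega -> R) (rho c1 p : R) : R :=
  quantile (pushforward Q (fun w => pivot rho (Zs w) c1 (Cs w))) p.

(* Main.v *)
Require Import Defs.
From HB Require Import structures.
From mathcomp Require Import all_boot all_order all_algebra.
From mathcomp Require Import all_classical all_reals all_analysis.
From mathcomp Require Import measurable_realfun ring lra.
Set Implicit Arguments.
Unset Strict Implicit.
Unset Printing Implicit Defensive.
Import Order.TTheory GRing.Theory Num.Theory.
Import numFieldNormedType.Exports.
Local Open Scope classical_set_scope.
Local Open Scope ring_scope.
Local Notation mR R := (measurableTypeR R).
Local Notation mR5 R := (mR R * mR R * mR R * mR R * mR R)%type.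
Local Notation leb := (@lebesgue_measure _).
Local Notation law R := (probability (mR R) R).

(** Write [s11], [s12], [s22] for the sums of squares and products about the
    means and [V = s12 / sqrt (s11 s22 - s12^2)]. Integrating likelihood times
    prior over the means, and then in the coordinates [1 / s1],
    [1 / (s2 sqrt (1 - rho^2))], [eta3], leaves a gamma, a chi-squared and a
    Gaussian integral: given the data, [eta3] is distributed as
    [(Zs - sqrt Cs V) / sqrt s11]. Hence [eta3] is below its posterior quantile
    iff [F (s11 / s1^2) V < 1 - alpha], where [F c] is the distribution function
    of the starred pivot. By Bartlett's decomposition, [s11 / s1^2] and [V] are
    jointly distributed as [C1] and the unstarred pivot, which gives (a).

    Given [C1 = c], the pivot with [n - b] degrees of freedom is below its
    quantile [q c] with probability [1 - alpha], and the coverage is the same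
    probability for [n - 2] degrees of freedom. Two chi-squared densities cross
    exactly once, so for [b <> 2] these differ strictly, in a direction given by
    the sign of [q c]; one of [rho = 1/2], [rho = - 1/2] makes that sign
    independent of [c]. *)

(** All integrals are of nonnegative functions with values in the extended reals, so Tonelli and
    substitution apply before anything is known to be finite. Rotations, standardization and the
    passage to the coordinates of the posterior are each composed of one-dimensional substitutions.
    Gamma and Beta constants are never evaluated: a constant known only to exist is shown positive
    and finite, or equal to another one, by total mass one, and that of the posterior cancels in its
    quantile. Bartlett's decomposition is an induction on the sample size, in which a new
    observation is absorbed into the running sums by rotations. Samples with an improper posterior
    form a null set, but they still have to be treated: the covered event must be measurable on the
    whole sample space. Both sides of (a) replace [v < quantile] by [F c v < p], which is jointly
    measurable in [c] and [v]. For (b), [F c 0 = Phi (- g sqrt c)] with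
    [g = rho / sqrt (1 - rho^2)]; comparing [p] with [Phi 0] tells which sign of [rho] keeps this
    value on one side of [p] for all [c]. *)

Section measurability.
Context {d} {T : measurableType d} {R : realType}.
Implicit Types f g h : T -> R.

Lemma measurable_add f g : measurable_fun setT f -> measurable_fun setT g ->
  measurable_fun setT (fun x => f x + g x).
Proof. exact: measurable_funD. Qed.

Lemma measurable_mul f g : measurable_fun setT f -> measurable_fun setT g ->
  measurable_fun setT (fun x => f x * g x).
Proof. exact: measurable_funM. Qed.

Lemma measurable_opp f : measurable_fun setT f ->
  measurable_fun setT (fun x => - f x).
Proof. by move=> mf; exact: measurableT_comp. Qed.

Lemma measurable_exp f : measurable_fun setT f ->
  measurable_fun setT (fun x => expR (f x)).
Proof. by move=> mf; exact: measurableT_comp. Qed.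

Lemma measurable_sqrt f : measurable_fun setT f ->
  measurable_fun setT (fun x => Num.sqrt (f x)).
Proof.
have msqrt : measurable_fun setT (Num.sqrt : R -> R).
  by apply: continuous_measurable_fun; exact: sqrt_continuous.
by move=> mf; exact: (measurableT_comp msqrt).
Qed.

Lemma measurable_pow f p : measurable_fun setT f ->
  measurable_fun setT (fun x => f x `^ p).
Proof. by move=> mf; exact: (measurableT_comp (measurable_powR p)). Qed.

Lemma measurable_inv f : measurable_fun setT f ->
  measurable_fun setT (fun x => (f x)^-1).
Proof.
(* The power [-1] is a true inverse on nonnegative bases only, so [f x ^+ 2] is inverted; at zeros
   of [f] both sides are 0. *)
move=> mf; rewrite (_ : (fun x => _) = fun x => f x * (f x ^+ 2) `^ (-1)).
  by apply: measurable_mul => //; apply: measurable_pow; exact: measurable_funX.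
apply/funext => x; have [->|fx0] := eqVneq (f x) 0; first by rewrite invr0 mul0r.
by rewrite powR_inv1 ?sqr_ge0// -exprVn expr2 mulrA mulfV// mul1r.
Qed.

Lemma measurable_bigsum (I : Type) (s : seq I) (F : I -> T -> R) :
  (forall i, measurable_fun setT (F i)) ->
  measurable_fun setT (fun x => \sum_(i <- s) F i x).
Proof.
move=> mF; elim: s => [|i s ih].
  by under eq_fun do rewrite big_nil; exact: measurable_cst.
by under eq_fun do rewrite big_cons; exact: measurable_add.
Qed.

Lemma measurable_indicle f g : measurable_fun setT f -> measurable_fun setT g ->
  measurable [set x | f x <= g x].
Proof.
move=> mf mg; rewrite -[X in measurable X]setTI.
have := measurable_fun_ler mf mg measurableT (Y := [set true]).
by apply.
Qed.

Lemma measurable_set_lt f g : measurable_fun setT f -> measurable_fun setT g ->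
  measurable [set x | f x < g x].
Proof.
move=> mf mg; rewrite -[X in measurable X]setTI.
have := measurable_fun_ltr mf mg measurableT (Y := [set true]).
by apply.
Qed.

Lemma measurable_EFin f : measurable_fun setT f ->
  measurable_fun setT (fun x => (f x)%:E).
Proof. by move/measurable_EFinP. Qed.

Lemma measurable_indic_comp d' (T' : measurableType d') (B : set T') (k : T -> T') :
  measurable B -> measurable_fun setT k ->
  measurable_fun setT (fun x => \1_B (k x) : R).
Proof. by move=> mB mk; apply: measurableT_comp mk; exact: measurable_indic. Qed.

Lemma measurable_eindic d' (T' : measurableType d') (B : set T') (k : T -> T') :
  measurable B -> measurable_fun setT k ->
  measurable_fun setT (fun x => (\1_B (k x) : R)%:E).
Proof. by move=> mB mk; apply: measurable_EFin; exact: measurable_indic_comp. Qed.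

Lemma measurable_eindic1 (B : set T) :
  measurable B -> measurable_fun setT (fun x => (\1_B x : R)%:E).
Proof. by move=> mB; apply: measurable_EFin; exact: measurable_indic. Qed.

End measurability.

Section measurability_prod.
Context {d d1 d2} {T : measurableType d} {T1 : measurableType d1}
  {T2 : measurableType d2}.

Lemma measurable_proj1 (f : T -> T1 * T2) : measurable_fun setT f ->
  measurable_fun setT (fun x => (f x).1).
Proof. by move=> mf; exact: measurableT_comp. Qed.

Lemma measurable_proj2 (f : T -> T1 * T2) : measurable_fun setT f ->
  measurable_fun setT (fun x => (f x).2).
Proof. by move=> mf; exact: measurableT_comp. Qed.

Lemma measurable_tuple2 (f : T -> T1) (g : T -> T2) :
  measurable_fun setT f -> measurable_fun setT g ->
  measurable_fun setT (fun x => (f x, g x)).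
Proof. exact: measurable_fun_pair. Qed.

End measurability_prod.

(** Decomposes a function by its head symbol. The identity and constants are tried first, so closed
    subterms are discharged whole; the leaves are hypotheses. *)
Ltac mfun := repeat lazymatch goal with
  | |- measurable_fun _ (fun x => x) => exact: measurable_id
  | |- measurable_fun _ (fun _ => ?c) => exact: measurable_cst
  | |- measurable_fun _ (fun x => EFin (@?f x)) => apply: (measurable_EFin (f := f))
  | |- measurable_fun _ (fun x => (@?f x + @?g x)%R) =>
      apply: (measurable_add (f := f) (g := g))
  | |- measurable_fun _ (fun x => (- @?f x)%R) => apply: (measurable_opp (f := f))
  | |- measurable_fun _ (fun x => (@?f x)^-1%R) => apply: (measurable_inv (f := f))
  | |- measurable_fun _ (fun x => (@?f x * @?g x)%R) =>
      apply: (measurable_mul (f := f) (g := g))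
  | |- measurable_fun _ (fun x => expR (@?f x)) => apply: (measurable_exp (f := f))
  | |- measurable_fun _ (fun x => Num.sqrt (@?f x)) => apply: (measurable_sqrt (f := f))
  | |- measurable_fun _ (fun x => (@?f x `^ _)%R) => apply: (measurable_pow (f := f))
  | |- measurable_fun _ (fun x => (@?f x ^+ _)%R) => apply: (measurable_funX (f := f))
  | |- measurable_fun _ (fun x => (@?f x, @?g x)) =>
      apply: (measurable_tuple2 (f := f) (g := g))
  | |- measurable_fun _ (fun x => fst (@?f x)) => apply: (measurable_proj1 (f := f))
  | |- measurable_fun _ (fun x => snd (@?f x)) => apply: (measurable_proj2 (f := f))
  | |- measurable_fun _ _ => assumption
  end.

(** * Substitutions in Lebesgue integrals *)

Section density.
Context {d} {T : measurableType d} {R : realType}.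
Import HBNNSimple.

(** On the indicator of a set the equation is the hypothesis on [nu]; it extends to simple functions
    by linearity, and both sides commute with monotone limits. *)
Lemma ge0_integral_density (mu nu : {measure set T -> \bar R}) (f : T -> R)
    (phi : T -> \bar R) :
  measurable_fun setT f -> (forall x, 0 <= f x) ->
  (forall A, measurable A -> nu A = (\int[mu]_(x in A) (f x)%:E)%E) ->
  measurable_fun setT phi -> (forall x, (0 <= phi x)%E) ->
  (\int[nu]_x phi x = \int[mu]_x (phi x * (f x)%:E))%E.
Proof.
move=> /measurable_EFinP mf f0 nuE mphi phi0.
pose g := nnsfun_approx measurableT mphi.
have gphi x : (EFin \o g ^~ x) n @[n --> \oo] --> phi x.
  exact: cvg_nnsfun_approx.
have gnd x : {homo (fun n => g n x) : n m / (n <= m)%N >-> n <= m}.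
  by move=> n m nm; exact/lefP/nd_nnsfun_approx.
transitivity (limn (fun n => \int[nu]_x (g n x)%:E)%E).
  rewrite -monotone_convergence//.
  - by apply: eq_integral => x _; apply/esym/cvg_lim => //; exact: gphi.
  - by move=> n; exact/measurable_EFinP.
  - by move=> n x _; rewrite lee_fin.
  - by move=> x _ n m nm; rewrite lee_fin; exact: gnd.
transitivity (limn (fun n => \int[mu]_x ((g n x)%:E * (f x)%:E))%E); last first.
  rewrite -monotone_convergence//.
  - apply: eq_integral => x _; apply/cvg_lim => //.
    by apply: cvgeZr => //; exact: gphi.
  - by move=> n; apply: emeasurable_funM => //; exact/measurable_EFinP.
  - by move=> n x _; rewrite mule_ge0 ?lee_fin//.
  - by move=> x _ n m nm; rewrite lee_wpmul2r ?lee_fin//; exact: gnd.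
congr (limn _); apply/funext => n.
under eq_integral do rewrite fimfunE -fsumEFin//.
rewrite ge0_integral_fsum//; last 2 first.
- by move=> y; exact/measurable_EFinP/measurable_funM.
- by move=> y x _; rewrite nnfun_muleindic_ge0.
under [RHS]eq_integral.
  move=> x _; rewrite fimfunE -fsumEFin// ge0_mule_fsuml; last first.
    by move=> y; rewrite nnfun_muleindic_ge0.
  over.
rewrite ge0_integral_fsum//; last 2 first.
- move=> y; apply: emeasurable_funM => //.
  by exact/measurable_EFinP/measurable_funM.
- by move=> y x _; rewrite mule_ge0 ?lee_fin// -?lee_fin EFinM nnfun_muleindic_ge0.
apply: eq_fsbigr => y /set_mem [z _ <-].
have mA : measurable (g n @^-1` [set g n z]) by exact: measurable_funPTI.
rewrite integralZl_indic_nnsfun// integral_indic// setIT nuE//.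
under [RHS]eq_integral do rewrite EFinM -muleA.
rewrite ge0_integralZl//; last 3 first.
- by apply: emeasurable_funM => //; exact/measurable_EFinP.
- by move=> x _; rewrite mule_ge0 ?lee_fin//.
- by rewrite lee_fin.
congr (_ * _)%E; rewrite integral_mkcond; apply: eq_integral => x _.
by rewrite patchE indicE; case: ifPn; rewrite ?mul1e ?mul0e.
Qed.

End density.

Section density_measure.
Context {d} {T : measurableType d} {R : realType}.
Variables (mu : {measure set T -> \bar R}) (f : T -> R).
Hypotheses (mf : measurable_fun setT f) (f0 : forall x, 0 <= f x).

Definition density_measure (A : set T) : \bar R := (\int[mu]_(x in A) (f x)%:E)%E.

Let density_measure0 : density_measure set0 = 0%E.
Proof. by rewrite /density_measure integral_set0. Qed.

Let density_measure_ge0 A : (0 <= density_measure A)%E.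
Proof. by apply: integral_ge0 => x _; rewrite lee_fin. Qed.

Let density_measure_sigma_additive : semi_sigma_additive density_measure.
Proof.
move=> F mF tF mUF; rewrite /density_measure ge0_integral_bigcup//.
- apply: is_cvg_ereal_nneg_natsum_cond => n _ _.
  by apply: integral_ge0 => x _; rewrite lee_fin.
- by apply/measurable_EFinP; exact: measurable_funTS.
- by move=> x _; rewrite lee_fin.
Qed.

HB.instance Definition _ := isMeasure.Build _ _ _ density_measure
  density_measure0 density_measure_ge0 density_measure_sigma_additive.

Definition density_measure_pack : {measure set T -> \bar R} := density_measure.

End density_measure.

Section substitution.
Context {R : realType}.

(* The pushforward of [w dx] along [h] gives mass [b - a] to each interval
   [`]a, b]], hence is Lebesgue measure. *)
Lemma ge0_integral_subst_line (D : set (mR R)) (g : R -> R) (h w : mR R -> mR R)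
    (phi : mR R -> \bar R) :
  measurable D -> measurable_fun setT h -> measurable_fun setT w ->
  (forall x, D x -> 0 <= w x) ->
  (forall y, D (g y)) -> (forall y, h (g y) = y) ->
  (forall x, D x -> g (h x) = x) ->
  (forall x y, D x -> D y -> x < y -> h x < h y) ->
  (forall x y z, D x -> D y -> x <= z <= y -> D z) ->
  (forall x, D x -> derivable (h : R -> R) x 1 /\ 'D_1 (h : R -> R) x = w x) ->
  (forall x, D x -> {for x, continuous (w : R -> R)}) ->
  measurable_fun setT phi -> (forall y, (0 <= phi y)%E) ->
  (\int[leb]_(x in D) (phi (h x) * (w x)%:E) = \int[leb]_y phi y)%E.
Proof.
move=> mD mh mw w0 Dg hg gh hlt Dcvx dh cw mphi phi0.
pose f : mR R -> R := fun x => w x * \1_D x.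
have mf : measurable_fun setT f.
  by apply: measurable_mul => //; exact: measurable_indic.
have f0 x : 0 <= f x.
  rewrite /f indicE; case: (boolP (x \in D)) => [/set_mem Dx|_].
    by rewrite mulr1; exact: w0.
  by rewrite mulr0.
pose m := density_measure_pack leb mf f0.
have hE x y : D x -> D y -> (h x < h y) = (x < y).
  move=> Dx Dy; apply/idP/idP => [|]; last exact: hlt.
  by apply: contraTT; rewrite -!leNgt le_eqVlt => /predU1P[->//|/(hlt _ _ Dy Dx)/ltW].
have hleE x y : D x -> D y -> (h x <= h y) = (x <= y).
  by move=> Dx Dy; rewrite !leNgt hE.
have hd x : D x -> derivable (h : R -> R) x 1 by case/dh.
have key (A : set (mR R)) : measurable A -> leb A = pushforward m h A.
  apply: lebesgue_measure_unique => //= X [[a b] _ <-]/=.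
  rewrite /pushforward /m/= /density_measure.
  (* Within [D] the preimage of []a, b]] under [h] is []g a, g b]], and convexity of [D] puts that
     interval inside [D]. The fundamental theorem of calculus then evaluates its mass. *)
  transitivity (\int[leb]_(x in `]g a, g b]) (w x)%:E)%E; last first.
    rewrite [LHS]integral_mkcond [RHS]integral_mkcond; apply: eq_integral => x _.
    rewrite !patchE /f indicE; case: (boolP (x \in D)) => xD.
      move/set_mem : (xD) => Dx; rewrite mulr1.
      rewrite (_ : (x \in `]g a, g b]%classic) = (x \in h @^-1` `]a, b]%classic))//.
      have hx : (h x \in `]a, b]) = (x \in `]g a, g b]).
        by rewrite !in_itv/= -[a in LHS]hg -[b in LHS]hg hE// hleE.
      by apply/idP/idP => /set_mem/= xab; apply/mem_set; rewrite /= hx in xab *.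
    rewrite mulr0 if_same; case: ifPn => // /set_mem/=; rewrite in_itv/= => /andP[ax xb].
    move/negP : xD; case; apply/mem_set; apply: (Dcvx _ _ _ (Dg a) (Dg b)).
    by rewrite (ltW ax).
  rewrite lebesgue_measure_itv/= lte_fin.
  have [ab|ba] := ltP a b; last first.
    rewrite set_itv_ge ?integral_set0// bnd_simp -leNgt.
    by rewrite -hleE// !hg.
  have gab : g a < g b by rewrite -hE// !hg.
  have Dab x : x \in `[g a, g b] -> D x.
    by rewrite in_itv/=; exact: Dcvx.
  rewrite integral_itv_obnd_cbnd; last by apply/measurable_EFinP; exact: measurable_funTS.
  rewrite (continuous_FTC2 gab (F := h)) ?hg//.
  - apply: continuous_in_subspaceT => x /set_mem /= xab.
    by apply: cw; exact: Dab.
  - split.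
    + move=> x xab; have Dx := Dab _ (subset_itv_oo_cc xab).
      exact: hd.
    + have /(_ (g a)) := Dab; rewrite bound_itvE => /(_ (ltW gab)) Da.
      apply: cvg_at_right_filter.
      by apply/differentiable_continuous/derivable1_diffP; exact: hd.
    + have /(_ (g b)) := Dab; rewrite bound_itvE => /(_ (ltW gab)) Db.
      apply: cvg_at_left_filter.
      by apply/differentiable_continuous/derivable1_diffP; exact: hd.
  - move=> x xab; have Dx := Dab _ (subset_itv_oo_cc xab).
    by rewrite derive1E; have [_ ->] := dh _ Dx.
transitivity (\int[pushforward m h]_y phi y)%E; last first.
  by apply: eq_measure_integral => A mA _; exact/esym/key.
rewrite ge0_integral_pushforward//.
rewrite (ge0_integral_density (mu := leb) mf f0)//; last 2 first.
- exact: measurableT_comp.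
- by move=> x; exact: phi0.
rewrite [LHS]integral_mkcond; apply: eq_integral => x _.
rewrite patchE /f indicE; case: (boolP (x \in D)) => xD; first by rewrite mulr1.
by rewrite mulr0 mule0.
Qed.

Lemma ge0_integral_affine (a b : R) (phi : mR R -> \bar R) : a != 0 ->
  measurable_fun setT phi -> (forall y, (0 <= phi y)%E) ->
  (\int[leb]_x phi (a * x + b)%R = `|a|^-1%:E * \int[leb]_y phi y)%E.
Proof.
have pos c : 0 < c -> forall phi : mR R -> \bar R, measurable_fun setT phi ->
    (forall y, (0 <= phi y)%E) ->
    (\int[leb]_x phi (c * x + b)%R = c^-1%:E * \int[leb]_y phi y)%E.
  move=> c0 {}phi mphi phi0.
  have cn0 : c != 0 by rewrite gt_eqF.
  rewrite -(ge0_integral_subst_line (D := setT) (g := fun y => (y - b) / c)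
     (h := fun x => c * x + b) (w := cst c) (phi := phi))//.
  - rewrite /= ge0_integralZr//; last by rewrite lee_fin ltW.
      by rewrite muleC -muleA -EFinM mulfV// mule1.
    by apply: (measurableT_comp mphi); mfun.
  - by apply: measurable_add => //; mfun.
  - by move=> x _; exact: ltW.
  - by move=> y; rewrite mulrCA mulfV// mulr1 subrK.
  - by move=> y _; rewrite addrK mulrAC mulfV// mul1r.
  - by move=> x y _ _ xy; rewrite ltrD2r ltr_pM2l.
  - move=> x _.
    have : is_derive (x : R) (1 : R) (fun x : R => c * x + b) c.
      by apply: is_derive_eq; rewrite scaler1 addr0.
    by case.
  - by move=> x _; exact: cst_continuous.
move=> a0 mphi phi0; have [ap|an|a00] := ltgtP 0 a; last by rewrite -a00 eqxx in a0.
  by rewrite gtr0_norm// pos.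
rewrite ltr0_norm//.
have mN : measurable_fun setT (-%R : mR R -> mR R) by mfun.
transitivity (\int[pushforward leb (-%R : mR R -> mR R)]_x phi (a * x + b)%R)%E.
  by apply: eq_measure_integral => A mA _; exact/esym/lebesgue_measureN.
rewrite ge0_integral_pushforward//; last by apply: (measurableT_comp mphi); mfun.
rewrite -(pos (- a)) ?oppr_gt0//.
by apply: eq_integral => x _ /=; rewrite mulrN mulNr.
Qed.

Lemma ge0_integral_ln (phi : mR R -> \bar R) :
  measurable_fun setT phi -> (forall y, (0 <= phi y)%E) ->
  (\int[leb]_(x in `]0%R, +oo[) (phi (ln x) * x^-1%:E) = \int[leb]_y phi y)%E.
Proof.
move=> mphi phi0; apply: (ge0_integral_subst_line (g := expR) (h := @ln R)
  (w := fun x => x^-1)) => //.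
- by apply: measurable_inv.
- by move=> x /=; rewrite in_itv/= andbT => x0; rewrite invr_ge0 ltW.
- by move=> y /=; rewrite in_itv/= andbT expR_gt0.
- exact: expRK.
- by move=> x /=; rewrite in_itv/= andbT => x0; rewrite lnK.
- by move=> x y /=; rewrite !in_itv/= !andbT => x0 y0; rewrite ltr_ln.
- move=> x y z /=; rewrite !in_itv/= !andbT => x0 y0 /andP[xz _].
  exact: lt_le_trans xz.
- by move=> x /=; rewrite in_itv/= andbT => /is_derive1_ln[].
- by move=> x /=; rewrite in_itv/= andbT => x0; apply: inv_continuous; rewrite gt_eqF.
Qed.

(* The measure [dx / x] on the half-line is invariant under [x |-> c x ^ p] up
   to the factor [|p|]; all power substitutions below are read off from it. *)
Lemma ge0_integral_haar (c p : R) (phi : mR R -> \bar R) : 0 < c -> p != 0 ->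
  measurable_fun setT phi -> (forall y, (0 <= phi y)%E) ->
  (\int[leb]_(x in `]0%R, +oo[) (phi (c * x `^ p)%R * x^-1%:E) =
   `|p|^-1%:E * \int[leb]_(x in `]0%R, +oo[) (phi x * x^-1%:E))%E.
Proof.
move=> c0 p0 mphi phi0.
pose psi : mR R -> \bar R := fun u => phi (expR u).
have mpsi : measurable_fun setT psi by apply: (measurableT_comp mphi); mfun.
transitivity (\int[leb]_(x in `]0%R, +oo[) (psi (p * ln x + ln c)%R * x^-1%:E))%E.
  apply: eq_integral => x /set_mem/=; rewrite in_itv/= andbT => x0; rewrite /psi.
  by rewrite expRD !lnK// /powR gt_eqF// mulrC.
rewrite (ge0_integral_ln (phi := fun u => psi (p * u + ln c)))//; last 2 first.
- by apply: (measurableT_comp mpsi); mfun.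
- by move=> y; exact: phi0.
have psi0 y : (0 <= psi y)%E by exact: phi0.
rewrite (ge0_integral_affine _ p0 mpsi psi0) -(ge0_integral_ln mpsi psi0).
congr (_ * _)%E; apply: eq_integral => x /set_mem/=; rewrite in_itv/= andbT => x0.
by rewrite /psi lnK.
Qed.

(** [rho_ratio] maps the correlations increasingly onto the line, with inverse [y / sqrt (1 + y^2)]
    and derivative [(1 - rho^2)^(-3/2)]. It enters because [eta3 = - rho_ratio rho / s1]. *)
Lemma ge0_integral_rho_ratio (phi : mR R -> \bar R) :
  measurable_fun setT phi -> (forall y, (0 <= phi y)%E) ->
  (\int[leb]_(x in `](-1)%R, 1%R[) (phi (rho_ratio x) * ((Num.sqrt (1 - x ^+ 2)) ^+ 3)^-1%:E) =
   \int[leb]_y phi y)%E.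
Proof.
move=> mphi phi0.
have D1 (x : R) : -1 < x < 1 -> 0 < 1 - x ^+ 2.
  by move=> /andP[x1 x2]; rewrite (_ : 1 - x ^+ 2 = (1 - x) * (1 + x)); [nra|ring].
have E1 (y : R) : 1 - (y / Num.sqrt (1 + y ^+ 2)) ^+ 2 = (1 + y ^+ 2)^-1.
  have y1 : 0 < 1 + y ^+ 2 by rewrite ltr_pwDl// sqr_ge0.
  rewrite expr_div_n sqr_sqrtr ?ltW//.
  by field; rewrite gt_eqF.
have E2 (y : R) : 0 < Num.sqrt (1 + y ^+ 2).
  by rewrite sqrtr_gt0 ltr_pwDl// sqr_ge0.
have E3 (x : R) : -1 < x < 1 -> 1 + rho_ratio x ^+ 2 = (1 - x ^+ 2)^-1.
  move=> /D1 x1; rewrite /rho_ratio expr_div_n sqr_sqrtr ?ltW//.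
  by field; rewrite gt_eqF.
have lt_rr (x y : R) : -1 < x < 1 -> -1 < y < 1 -> x < y -> rho_ratio x < rho_ratio y.
  (* For nonnegative arguments the numerator grows while the denominator shrinks; the other cases
     follow since [rho_ratio] is odd. *)
  have sq (u v : R) : 0 <= u -> u < v -> v < 1 -> rho_ratio u < rho_ratio v.
    move=> u0 uv v1.
    have v0 := D1 v ltac:(lra). have u1 := D1 u ltac:(lra).
    rewrite /rho_ratio (@le_lt_trans _ _ (u / Num.sqrt (1 - v ^+ 2)))//.
      rewrite ler_wpM2l// lef_pV2 ?posrE ?sqrtr_gt0// ler_wsqrtr//.
      by rewrite lerD2l lerN2 ler_sqr ?nnegrE; lra.
    by rewrite ltr_pM2r// invr_gt0 sqrtr_gt0.
  have rrN (u : R) : rho_ratio (- u) = - rho_ratio u.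
    by rewrite /rho_ratio sqrrN mulNr.
  move=> /andP[x1 x2] /andP[y1 y2] xy.
  have [x0|x0] := leP 0 x; first exact: sq.
  have [y0|y0] := leP y 0.
    by rewrite -ltrN2 -!rrN; apply: sq; lra.
  apply: (@lt_trans _ _ 0).
    by rewrite /rho_ratio pmulr_llt0// invr_gt0 sqrtr_gt0; apply: D1; lra.
  by rewrite /rho_ratio divr_gt0// sqrtr_gt0; apply: D1; lra.
apply: (ge0_integral_subst_line (g := fun y => y / Num.sqrt (1 + y ^+ 2))
  (h := @rho_ratio R) (w := fun x => ((Num.sqrt (1 - x ^+ 2)) ^+ 3)^-1)) => //.
- by rewrite /rho_ratio; mfun.
- by mfun.
- move=> y /=; rewrite in_itv/=.
  have : 0 < 1 - (y / Num.sqrt (1 + y ^+ 2)) ^+ 2.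
    by rewrite E1 invr_gt0 ltr_pwDl// sqr_ge0.
  by set u := y / _ => u1; apply/andP; split; nra.
- move=> y; rewrite /rho_ratio E1 sqrtrV ?addr_ge0 ?sqr_ge0//.
  by rewrite invrK divfK// gt_eqF.
- move=> x /=; rewrite in_itv/= => x1.
  rewrite E3// sqrtrV ?ltW ?D1// /rho_ratio invrK divfK// gt_eqF// sqrtr_gt0.
  exact: D1.
- by move=> x y z /=; rewrite !in_itv/=; lra.
- move=> x /=; rewrite in_itv/= => /D1 x1.
  have s0 : 0 < Num.sqrt (1 - x ^+ 2) by rewrite sqrtr_gt0.
  have sE : Num.sqrt (1 - x ^+ 2) ^+ 2 = 1 - x ^+ 2 by rewrite sqr_sqrtr// ltW.
  have ds : is_derive x (1 : R) (Num.sqrt \o (fun x => 1 - x ^+ 2))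
      (- x / Num.sqrt (1 - x ^+ 2)).
    have d1 : is_derive x (1 : R) (fun x => 1 - x ^+ 2) (- (2 * x)).
      apply: is_derive_eq; rewrite /= /GRing.scale/=; ring.
    have d2 := is_derive1_sqrt x1.
    by apply: is_derive_eq; field; rewrite gt_eqF.
  have : is_derive x (1 : R) (@rho_ratio R) (Num.sqrt (1 - x ^+ 2) ^+ 3)^-1.
    rewrite /rho_ratio.
    have dV := is_deriveV (f := Num.sqrt \o (fun x => 1 - x ^+ 2)) (lt0r_neq0 s0) ds.
    apply: is_derive_eq; rewrite /= /GRing.scale/=.
    have -> : forall s : R, s != 0 -> x * (- s ^- 2 * (- x / s)) + s^-1 * 1 =
        (x ^+ 2 + s ^+ 2) / s ^+ 3 by move=> s sn0; field.
      by rewrite sE addrC subrK mul1r.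
    by rewrite gt_eqF.
  by case.
- move=> x /=; rewrite in_itv/= => /D1 x1.
  apply: (continuous_comp (f := fun x : R => Num.sqrt (1 - x ^+ 2) ^+ 3)
    (g := @GRing.inv R)); last first.
    by apply: inv_continuous; rewrite gt_eqF// exprn_gt0// sqrtr_gt0.
  apply: (continuous_comp (f := fun x : R => Num.sqrt (1 - x ^+ 2)) (g := fun y => y ^+ 3)); last exact: exprn_continuous.
  apply: (continuous_comp (f := fun x : R => 1 - x ^+ 2) (g := @Num.sqrt R)); last exact: sqrt_continuous.
  apply: cvgB; first exact: cvg_cst.
  exact: exprn_continuous.
Qed.

End substitution.

(** * Gaussian and chi-squared laws *)

Section image_law.
Context {d d'} {T : measurableType d} {T' : measurableType d'} {R : realType}.
Variables (P : probability T R) (f : T -> T') (mf : measurable_fun setT f).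

(** The pushforward with the measurability proof as an argument, so that a probability structure can
    be declared on it and inferred. *)
Definition image_law of measurable_fun setT f : set T' -> \bar R := pushforward P f.

Local Notation L := (image_law mf).

Let image_law0 : L set0 = 0%E. Proof. exact: measure0. Qed.
Let image_law_ge0 A : (0 <= L A)%E. Proof. exact: measure_ge0. Qed.
Let image_law_sigma_additive : semi_sigma_additive L.
Proof. exact: (@measure_semi_sigma_additive _ _ _ (pushforward P f)). Qed.

HB.instance Definition _ := isMeasure.Build _ _ _ L
  image_law0 image_law_ge0 image_law_sigma_additive.

Let image_law_setT : L setT = 1%E. Proof. exact: probability_setT. Qed.

HB.instance Definition _ := Measure_isProbability.Build _ _ _ L image_law_setT.

Definition image_prob : probability T' R := L.

Lemma ge0_integral_image_prob (phi : T' -> \bar R) :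
  measurable_fun setT phi -> (forall y, (0 <= phi y)%E) ->
  (\int[image_prob]_y phi y = \int[P]_x phi (f x))%E.
Proof.
move=> mphi phi0.
transitivity (\int[pushforward P f]_y phi y)%E; last exact: ge0_integral_pushforward.
by apply: eq_measure_integral.
Qed.

End image_law.

Section iterated.
Context {d1 d2} {T1 : measurableType d1} {T2 : measurableType d2} {R : realType}.

Lemma measurable_section1 (phi : T1 * T2 -> \bar R) x : measurable_fun setT phi ->
  measurable_fun setT (fun y => phi (x, y)).
Proof. by move=> mphi; apply: (measurableT_comp mphi); exact: measurable_tuple2. Qed.

Lemma measurable_section2 (phi : T1 * T2 -> \bar R) y : measurable_fun setT phi ->
  measurable_fun setT (fun x => phi (x, y)).
Proof. by move=> mphi; apply: (measurableT_comp mphi); exact: measurable_tuple2. Qed.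

Lemma measurable_integral2 (m2 : {sigma_finite_measure set T2 -> \bar R})
    (phi : T1 * T2 -> \bar R) : measurable_fun setT phi -> (forall x, (0 <= phi x)%E) ->
  measurable_fun setT (fun x => \int[m2]_y phi (x, y))%E.
Proof. by move=> mphi phi0; exact: measurable_fun_fubini_tonelli_F. Qed.

Lemma measurable_integral1 (m1 : {sigma_finite_measure set T1 -> \bar R})
    (phi : T1 * T2 -> \bar R) : measurable_fun setT phi -> (forall x, (0 <= phi x)%E) ->
  measurable_fun setT (fun y => \int[m1]_x phi (x, y))%E.
Proof. by move=> mphi phi0; exact: measurable_fun_fubini_tonelli_G. Qed.

Lemma tonelli (m1 : {sigma_finite_measure set T1 -> \bar R})
    (m2 : {sigma_finite_measure set T2 -> \bar R}) (phi : T1 -> T2 -> \bar R) :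
  measurable_fun setT (fun z : T1 * T2 => phi z.1 z.2) ->
  (forall x y, (0 <= phi x y)%E) ->
  (\int[m1]_x \int[m2]_y phi x y = \int[m2]_y \int[m1]_x phi x y)%E.
Proof. by move=> mphi phi0; exact: (fubini_tonelli (fun z => phi z.1 z.2)). Qed.

Lemma measurable_integral (m2 : {sigma_finite_measure set T2 -> \bar R})
    (phi : T1 -> T2 -> \bar R) :
  measurable_fun setT (fun z : T1 * T2 => phi z.1 z.2) ->
  (forall x y, (0 <= phi x y)%E) ->
  measurable_fun setT (fun x => \int[m2]_y phi x y)%E.
Proof.
by move=> mphi phi0; exact: (measurable_integral2 m2 mphi (fun z => phi0 z.1 z.2)).
Qed.

End iterated.

Section normal_rotation.
Context {R : realType}.
Local Notation N := (@normal_prob R 0 1).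

Lemma normal_pdf01 (x : R) : normal_pdf 0 1 x = normal_peak 1 * expR (- (x ^+ 2 / 2)).
Proof.
rewrite normal_pdfE ?oner_eq0// /normal_fun subr0 expr1n; congr (_ * expR _).
by rewrite mulNr.
Qed.

Lemma ge0_integral_normal (phi : mR R -> \bar R) :
  measurable_fun setT phi -> (forall y, (0 <= phi y)%E) ->
  (\int[N]_x phi x = \int[leb]_x (phi x * (normal_pdf 0 1 x)%:E))%E.
Proof.
move=> mphi phi0; apply: ge0_integral_density => //.
- exact: measurable_normal_pdf.
- by move=> x; exact: normal_pdf_ge0.
Qed.

(** With [v = - q x + p y] in the inner integral the first coordinate becomes [x / p + q v / p],
    which is affine in [x]; the Jacobians [|p|^-1] and [|p|] cancel. For [p = 0] the rotation is a
    swap of coordinates up to signs. *)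
Lemma ge0_integral_leb_rotation (p q : R) (phi : mR R * mR R -> \bar R) :
  p ^+ 2 + q ^+ 2 = 1 ->
  measurable_fun setT phi -> (forall y, (0 <= phi y)%E) ->
  (\int[leb]_x \int[leb]_y phi (p * x + q * y, - q * x + p * y)%R =
   \int[leb]_x \int[leb]_y phi (x, y))%E.
Proof.
move=> pq mphi phi0.
have mcomp (f g : mR R * mR R -> mR R) : measurable_fun setT f -> measurable_fun setT g ->
    measurable_fun setT (fun z : mR R * mR R => phi (f z, g z)).
  by move=> mf mg; apply: (measurableT_comp mphi); exact: measurable_tuple2.
have [p0|p0] := eqVneq p 0.
  have q1 : `|q| = 1.
    move: pq; rewrite p0 expr0n/= add0r => q2.
    by apply/eqP; rewrite -sqrp_eq1// real_normK ?num_real// q2.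
  have q0 : q != 0 by rewrite -normr_gt0 q1.
  transitivity (\int[leb]_x \int[leb]_y phi (q * y, - q * x)%R)%E.
    apply: eq_integral => x _; apply: eq_integral => y _.
    by rewrite p0 !mul0r add0r addr0.
  transitivity (\int[leb]_x \int[leb]_y phi (y, - q * x)%R)%E.
    apply: eq_integral => x _.
    under eq_integral do rewrite -[X in (X, _)]addr0.
    rewrite (ge0_integral_affine _ (phi := fun y => phi (y, - q * x)))//.
      by rewrite q1 invr1 mul1e.
    exact: measurable_section2.
  rewrite tonelli//; last by apply: mcomp; mfun.
  apply: eq_integral => x _.
  under eq_integral do rewrite -[X in (_, X)]addr0.
  rewrite (ge0_integral_affine _ (phi := fun y => phi (x, y))) ?oppr_eq0//.
    by rewrite normrN q1 invr1 mul1e.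
  exact: measurable_section1.
transitivity (\int[leb]_x (`|p|^-1%:E * \int[leb]_v phi (p^-1 * x + q * v / p, v)%R))%E.
  apply: eq_integral => x _.
  rewrite -(ge0_integral_affine (- q * x) p0 (phi := fun v => phi (p^-1 * x + q * v / p, v)))//.
    apply: eq_integral => y _; congr (phi (_, _)); last by rewrite addrC.
    have -> : p^-1 * x + q * (p * y + - q * x) / p = (1 - q ^+ 2) * x / p + q * y.
      by field.
    have -> : 1 - q ^+ 2 = p ^+ 2 by rewrite -pq; ring.
    by field.
  by apply: (measurableT_comp mphi); mfun.
have mphi' : measurable_fun setT
    (fun z : mR R * mR R => phi (p^-1 * z.1 + q * z.2 / p, z.2)).
  by apply: mcomp; mfun.
rewrite ge0_integralZl//; last 2 first.
- exact: (measurable_integral2 _ mphi').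
- by move=> x _; apply: integral_ge0.
rewrite tonelli// [RHS](fubini_tonelli phi)// -ge0_integralZl//; last 2 first.
- exact: (measurable_integral1 _ mphi').
- by move=> x _; apply: integral_ge0.
apply: eq_integral => v _.
rewrite (ge0_integral_affine _ _ (phi := fun u => phi (u, v))) ?invr_eq0//; last first.
  exact: measurable_section2.
by rewrite muleA -EFinM normfV invrK mulVf ?mul1e// normr_eq0.
Qed.

Lemma ge0_integral_normal2 (phi : mR R * mR R -> \bar R) :
  measurable_fun setT phi -> (forall y, (0 <= phi y)%E) ->
  (\int[N]_x \int[N]_y phi (x, y) =
   \int[leb]_x \int[leb]_y (phi (x, y) *
     (normal_peak 1 ^+ 2 * expR (- ((x ^+ 2 + y ^+ 2) / 2)))%:E))%E.
Proof.
move=> mphi phi0.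
rewrite ge0_integral_normal//; last 2 first.
- exact: measurable_integral2.
- by move=> x; exact: integral_ge0.
apply: eq_integral => x _.
rewrite ge0_integral_normal//; last exact: measurable_section1.
rewrite -ge0_integralZr//; last 3 first.
- apply: emeasurable_funM; first exact: measurable_section1.
  by apply: measurable_EFin; exact: measurable_normal_pdf.
- by move=> y _; rewrite mule_ge0// lee_fin normal_pdf_ge0.
- by rewrite lee_fin normal_pdf_ge0.
apply: eq_integral => y _; rewrite -muleA -EFinM !normal_pdf01; congr (_ * _%:E)%E.
by rewrite mulrDl opprD expRD; ring.
Qed.

(** The joint density depends only on [x^2 + y^2], which a rotation preserves. *)
Lemma ge0_integral_normal_rotation (p q : R) (phi : mR R * mR R -> \bar R) :
  p ^+ 2 + q ^+ 2 = 1 ->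
  measurable_fun setT phi -> (forall y, (0 <= phi y)%E) ->
  (\int[N]_x \int[N]_y phi (p * x + q * y, - q * x + p * y)%R =
   \int[N]_x \int[N]_y phi (x, y))%E.
Proof.
move=> pq mphi phi0.
rewrite (ge0_integral_normal2 (phi := fun z : mR R * mR R => phi (p * z.1 + q * z.2, - q * z.1 + p * z.2)))//; last first.
  by apply: (measurableT_comp mphi); mfun.
rewrite (ge0_integral_normal2 mphi phi0).
pose G (z : mR R * mR R) := (phi z *
  (normal_peak 1 ^+ 2 * expR (- ((z.1 ^+ 2 + z.2 ^+ 2) / 2)))%:E)%E.
have mG : measurable_fun setT G by apply: emeasurable_funM => //; mfun.
have G0 z : (0 <= G z)%E.
  rewrite mule_ge0// lee_fin mulr_ge0 ?expR_ge0// exprn_ge0//.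
  exact: normal_peak_ge0.
apply: etrans (ge0_integral_leb_rotation pq mG G0).
apply: eq_integral => x _; apply: eq_integral => y _; rewrite /G /=.
congr (_ * (_ * expR (- (_ / 2)))%:E)%E.
by rewrite -[x ^+ 2 + y ^+ 2]mul1r -pq; ring.
Qed.

Lemma ge0_integral_normalN (phi : mR R -> \bar R) :
  measurable_fun setT phi -> (forall y, (0 <= phi y)%E) ->
  (\int[N]_x phi (- x)%R = \int[N]_x phi x)%E.
Proof.
move=> mphi phi0.
have mf : measurable_fun setT (fun x : mR R => phi (- x)).
  by apply: (measurableT_comp mphi); mfun.
rewrite !ge0_integral_normal//.
pose G (x : mR R) := (phi x * (normal_pdf 0 1 x)%:E)%E.
have mG : measurable_fun setT G.
  by apply: emeasurable_funM => //; apply: measurable_EFin; exact: measurable_normal_pdf.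
have G0 x : (0 <= G x)%E by rewrite mule_ge0// lee_fin normal_pdf_ge0.
have N10 : -1 != 0 :> R by rewrite oppr_eq0 oner_eq0.
apply: etrans (etrans (ge0_integral_affine 0 N10 mG G0) _); last first.
  by rewrite normrN1 invr1 mul1e.
by apply: eq_integral => x _; rewrite /G addr0 mulN1r !normal_pdf01 sqrrN.
Qed.

End normal_rotation.

Section sum_of_squares.
Context {R : realType}.
Local Notation N := (@normal_prob R 0 1).

Lemma integral_indicE d (T : measurableType d) (mu : {measure set T -> \bar R})
    (D : set T) (f : T -> \bar R) :
  (\int[mu]_(x in D) f x = \int[mu]_x (f x * (\1_D x)%:E))%E.
Proof.
rewrite [LHS]integral_mkcond; apply: eq_integral => x _.
by rewrite patchE indicE; case: ifPn; rewrite ?mule1 ?mule0.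
Qed.

Lemma measure_integral_indic d (T : measurableType d) (mu : {measure set T -> \bar R})
    (A : set T) : measurable A -> mu A = (\int[mu]_x (\1_A x)%:E)%E.
Proof. by move=> mA; rewrite integral_indic// setIT. Qed.

Lemma integral_prob_cst d (T : measurableType d) (nu : probability T R) (r : \bar R) :
  (\int[nu]_x cst r x = r)%E.
Proof. by rewrite integral_cst// [X in (_ * X)%E]probability_setT mule1. Qed.

Lemma integral_prob1 d (T : measurableType d) (nu : probability T R) :
  (\int[nu]_x cst 1 x = 1)%E.
Proof. exact: integral_prob_cst. Qed.

Let addsq (z : mR R * mR R) : mR R := z.1 + z.2 ^+ 2.

Let measurable_addsq : measurable_fun setT addsq.
Proof. by rewrite /addsq; mfun. Qed.

(** The chi-squared law with [m] degrees of freedom built one squared normal at a time, the form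
    required by the induction for Bartlett's decomposition. It includes the point mass at 0 for
    [m = 0]; [sumsq_law_chi2] links it to the density. *)
Fixpoint sumsq_law (m : nat) : law R :=
  if m is m'.+1 then image_prob (sumsq_law m' \x N)%E measurable_addsq
  else \d_(0 : mR R).

Lemma ge0_integral_sumsq0 (phi : mR R -> \bar R) :
  measurable_fun setT phi ->
  (\int[sumsq_law 0]_x phi x = phi 0%R)%E.
Proof. by move=> mphi; rewrite integral_dirac// diracT mul1e. Qed.

Lemma ge0_integral_sumsqS (m : nat) (phi : mR R -> \bar R) :
  measurable_fun setT phi -> (forall y, (0 <= phi y)%E) ->
  (\int[sumsq_law m.+1]_x phi x =
   \int[sumsq_law m]_x \int[N]_z phi (x + z ^+ 2)%R)%E.
Proof.
move=> mphi phi0; rewrite ge0_integral_image_prob//.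
rewrite (fubini_tonelli1 (fun z : mR R * mR R => phi (addsq z)))//.
by apply: (measurableT_comp mphi); exact: measurable_addsq.
Qed.

Lemma integral_line_even (f : mR R -> \bar R) :
  measurable_fun setT f -> (forall x, (0 <= f x)%E) -> (forall x, f (- x)%R = f x) ->
  (\int[leb]_x f x = 2%:E * \int[leb]_(x in `]0%R, +oo[) f x)%E.
Proof.
move=> mf f0 fN.
have mfS (D : set (mR R)) : measurable_fun D f by exact: measurable_funTS.
rewrite -(setUv (`]0%R, +oo[%classic : set (mR R))) ge0_integral_setU//=; last 2 first.
- exact: measurableC.
- by rewrite disj_set2E setICr.
rewrite [X in (_ + X)%E](_ : _ = \int[leb]_(x in `]0%R, +oo[) f x)%E.
  by rewrite -[LHS]mule2n mule_natl.
transitivity (\int[leb]_(x in `]-oo, 0%R]) f x)%E; first by rewrite setCitvr.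
transitivity (\int[leb]_(x in `[0%R, +oo[) f x)%E.
  rewrite (ge0_integration_by_substitution0 mf f0).
  by apply: eq_integral => x _; rewrite fN.
by apply: esym; apply: integral_itv_obnd_cbnd; exact: mfS.
Qed.

(** Reads off from a total mass equal to one that an unevaluated constant is neither 0 nor
    infinite. *)
Lemma ereal_factor1 (c I : \bar R) : (0 <= c)%E -> (0 <= I)%E -> (c * I = 1)%E ->
  exists2 r : R, 0 < r & c = r%:E.
Proof.
case: c => [r||]; rewrite ?lee_fin//.
  move=> r0 _ rI; exists r => //; rewrite lt_neqAle r0 andbT eq_sym.
  apply/eqP => r00; move: rI; rewrite r00 mul0e => /eqP.
  by rewrite eq_sym onee_eq0.
move=> _; rewrite le_eqVlt => /predU1P[<-|I0].
  by rewrite mule0 => /eqP; rewrite eq_sym onee_eq0.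
by rewrite gt0_mulye.
Qed.

Lemma powRB1 (x p : R) : 0 < x -> x `^ (p - 1) = x `^ p / x.
Proof.
move=> x0; have -> : x^-1 = x `^ (- 1) by rewrite powR_inv1// ltW.
by rewrite powRD//; apply/implyP => _; rewrite gt_eqF.
Qed.

(** Convolution with one more squared normal raises the exponent by one half and multiplies the
    constant by an unevaluated Beta integral. Total mass one makes the new constant finite and
    positive. *)
Lemma sumsq_density_ex (m : nat) : exists2 K : R, 0 < K &
  forall phi : mR R -> \bar R, measurable_fun setT phi -> (forall y, (0 <= phi y)%E) ->
  (\int[sumsq_law m.+1]_x phi x = \int[leb]_(x in `]0%R, +oo[)
     (phi x * (K * (x `^ (m.+1%:R / 2 - 1) * expR (- (x / 2))))%:E))%E.
Proof.
elim: m => [|m [K K0 ih]].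
  exists (normal_peak 1); first by rewrite normal_peak_gt0 ?oner_eq0.
  move=> phi mphi phi0; rewrite ge0_integral_sumsqS//.
  have mphi2 (x : R) : measurable_fun setT (fun z : mR R => phi (x + z ^+ 2)).
    by apply: (measurableT_comp mphi); mfun.
  rewrite ge0_integral_sumsq0; last first.
    apply: measurable_integral => //.
    by apply: (measurableT_comp mphi); mfun.
  rewrite ge0_integral_normal//.
  rewrite integral_line_even; last 3 first.
  - apply: emeasurable_funM => //; apply: measurable_EFin; exact: measurable_normal_pdf.
  - by move=> x; rewrite mule_ge0// lee_fin normal_pdf_ge0.
  - by move=> x; rewrite !normal_pdf01 sqrrN.
  (* Substitution [x = z^2] through the invariant measure [dx / x]; the factor 2 gained from
     evenness cancels its factor [|2|^-1]. *)
  pose h (x : mR R) := (phi x * (normal_peak 1 * x `^ 2^-1 * expR (- (x / 2)))%:E)%E.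
  have mh : measurable_fun setT h by apply: emeasurable_funM => //; mfun.
  have h0 x : (0 <= h x)%E.
    by rewrite mule_ge0// lee_fin !mulr_ge0 ?normal_peak_ge0 ?powR_ge0 ?expR_ge0.
  have n20 : 2 != 0 :> R by rewrite pnatr_eq0.
  have := ge0_integral_haar ltr01 n20 mh h0.
  have -> : (\int[leb]_(x in `]0%R, +oo[) (h (1 * x `^ 2)%R * x^-1%:E) =
      \int[leb]_(x in `]0%R, +oo[) (phi (0 + x ^+ 2)%R * (normal_pdf 0 1 x)%:E))%E.
    apply: eq_integral => x /set_mem/=; rewrite in_itv/= andbT => x0.
    rewrite /h mul1r add0r -powRrM mulfV// powRr1 ?ltW// powR_mulrn ?ltW//.
    rewrite -muleA -EFinM normal_pdf01; congr (_ * _%:E)%E.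
    by field; rewrite gt_eqF.
  move=> ->; rewrite muleA -EFinM ger0_norm// mulfV// mul1e.
  apply: eq_integral => x /set_mem/=; rewrite in_itv/= andbT => x0.
  rewrite /h -muleA -EFinM; congr (_ * _%:E)%E.
  by rewrite powRB1// mul1r; field; rewrite gt_eqF.
pose s : R := m.+1%:R / 2.
pose D : set (mR R) := `]0%R, +oo[%classic.
have mD : measurable D by exact: measurable_itv.
have DE (t : R) : (t \in D) = (0 < t).
  apply/idP/idP => [/set_mem|t0]; first by rewrite /D/= in_itv/= andbT.
  by apply/mem_set; rewrite /D/= in_itv/= andbT.
pose w (t : mR R) : R := t `^ (s - 1) * \1_D t.
have mw : measurable_fun setT w.
  by apply: measurable_mul; [exact: measurable_pow|exact: measurable_indic].
have w0 t : 0 <= w t by rewrite mulr_ge0 ?powR_ge0.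
have wM y t : 0 < y -> w (y * t) = y `^ (s - 1) * w t.
  move=> y0; rewrite /w !indicE !DE pmulr_rgt0//.
  case: (ltP 0 t) => [t0|_]; last by rewrite !mulr0.
  by rewrite powRM ?ltW// mulrA.
pose C := K * normal_peak 1.
have C0 : 0 <= C by rewrite mulr_ge0 ?normal_peak_ge0// ltW.
(* Scaling [z] by [sqrt y] shows that the integral of [(y - z^2)^(s - 1)] over [z^2 < y] is
   [y^(s - 1/2) B]. The indicator in [w] encodes the range of [z]. *)
pose B := (\int[leb]_u (w (1 - u ^+ 2))%:E)%E.
have B0 : (0 <= B)%E by apply: integral_ge0 => x _; rewrite lee_fin.
have JE (y : R) : (\int[leb]_z (w (y - z ^+ 2))%:E =
    ((y `^ (m.+2%:R / 2 - 1) * \1_D y)%:E * B))%E.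
  have [y0|y0] := leP y 0.
    rewrite indicE DE ltNge y0/= mulr0 mul0e; apply: integral0_eq => z _.
    by rewrite /w indicE DE ltNge subr_le0 (le_trans y0) ?sqr_ge0// mulr0.
  rewrite indicE DE y0 mulr1.
  have sy0 : 0 < Num.sqrt y by rewrite sqrtr_gt0.
  have mwy : measurable_fun setT (fun z : mR R => (w (y - z ^+ 2))%:E).
    by apply: measurable_EFin; apply: (measurableT_comp mw); mfun.
  have := ge0_integral_affine 0 (lt0r_neq0 sy0) mwy => /(_ _)/=.
  have wy0 z : (0 <= (w (y - z ^+ 2))%:E)%E by rewrite lee_fin.
  move=> /(_ wy0) H.
  have -> : (\int[leb]_z (w (y - z ^+ 2))%:E = (Num.sqrt y)%:E *
      \int[leb]_x (w (y - (Num.sqrt y * x + 0) ^+ 2))%:E)%E.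
    by rewrite H muleA -EFinM gtr0_norm// mulfV ?mul1e// gt_eqF.
  under eq_integral.
    move=> x _; rewrite addr0 exprMn sqr_sqrtr ?ltW// -[X in w (X - _)]mulr1 -mulrBr.
    rewrite wM// EFinM; over.
  rewrite /= ge0_integralZl//; last 3 first.
  - by apply: measurable_EFin; apply: (measurableT_comp mw); mfun.
  - by move=> x _; rewrite lee_fin.
  - by rewrite lee_fin powR_ge0.
  rewrite muleA -EFinM; congr (_%:E * _)%E.
  rewrite -powR12_sqrt ?ltW// -powRD; last by apply/implyP => _; rewrite gt_eqF.
  by congr (_ `^ _); rewrite /s -[m.+2]addn1 natrD; field.
have main (phi : mR R -> \bar R) : measurable_fun setT phi -> (forall y, (0 <= phi y)%E) ->
    (\int[sumsq_law m.+2]_x phi x = C%:E * B * \int[leb]_(x in D)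
     (phi x * (x `^ (m.+2%:R / 2 - 1) * expR (- (x / 2)))%:E))%E.
  move=> mphi phi0.
  have mphi2 : measurable_fun setT (fun z : mR R * mR R => phi (z.1 + z.2 ^+ 2)).
    by apply: (measurableT_comp mphi); mfun.
  rewrite ge0_integral_sumsqS// ih; last 2 first.
  - exact: (measurable_integral2 _ mphi2).
  - by move=> x; apply: integral_ge0.
  (* The product of the two exponentials depends only on [x + z^2], so shifting [x] by [z^2]
     separates them from the Beta integral. *)
  pose H (y : mR R) := (phi y * (expR (- (y / 2)))%:E)%E.
  have mH : measurable_fun setT H by apply: emeasurable_funM => //; mfun.
  have H0 y : (0 <= H y)%E by rewrite mule_ge0// lee_fin expR_ge0.
  have mHw : measurable_fun setT
      (fun z : mR R * mR R => H z.1 * (C * w (z.1 - z.2 ^+ 2))%:E)%E.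
    apply: emeasurable_funM; first by apply: (measurableT_comp mH); mfun.
    apply: measurable_EFin; apply: measurable_mul => //.
    by apply: (measurableT_comp mw); mfun.
  have Hw0 x y : (0 <= H x * (C * w y)%:E)%E by rewrite mule_ge0// lee_fin mulr_ge0.
  transitivity (\int[leb]_x \int[leb]_z (H (x + z ^+ 2)%R * (C * w x)%:E))%E.
    rewrite integral_indicE; apply: eq_integral => x _.
    rewrite ge0_integral_normal//; last by apply: (measurableT_comp mphi); mfun.
    rewrite -muleA -EFinM -ge0_integralZr//; last 3 first.
    - apply: emeasurable_funM; first by apply: (measurableT_comp mphi); mfun.
      by apply: measurable_EFin; exact: measurable_normal_pdf.
    - by move=> y _; rewrite mule_ge0// lee_fin normal_pdf_ge0.
    - by rewrite lee_fin !mulr_ge0 ?powR_ge0 ?expR_ge0// ltW.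
    apply: eq_integral => z _; rewrite /H -!muleA -!EFinM normal_pdf01 /w /C.
    congr (_ * _%:E)%E; rewrite mulrDl opprD expRD -/s; ring.
  rewrite tonelli//; last first.
    apply: emeasurable_funM; first by apply: (measurableT_comp mH); mfun.
    apply: measurable_EFin; apply: measurable_mul => //.
    by apply: (measurableT_comp mw); mfun.
  transitivity (\int[leb]_z \int[leb]_y (H y * (C * w (y - z ^+ 2))%:E))%E.
    apply: eq_integral => z _.
    have mz : measurable_fun setT (fun y : mR R => H y * (C * w (y - z ^+ 2))%:E)%E.
      exact: (measurable_section2 z mHw).
    have := ge0_integral_affine (z ^+ 2) (oner_neq0 R) mz (fun y => Hw0 _ _).
    rewrite normr1 invr1 mul1e => <-; apply: eq_integral => x _.
    by rewrite mul1r addrK.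
  rewrite -tonelli//.
  under eq_integral.
    move=> y _; under eq_integral do rewrite EFinM muleA.
    rewrite ge0_integralZl//; last 3 first.
    - by apply: measurable_EFin; apply: (measurableT_comp mw); mfun.
    - by move=> x _; rewrite lee_fin.
    - by rewrite mule_ge0// lee_fin.
    rewrite JE muleA muleC; over.
  rewrite /= ge0_integralZl//; last 2 first.
  - apply: emeasurable_funM; last by apply: measurable_EFin; apply: measurable_mul;
      [exact: measurable_pow|exact: measurable_indic].
    by apply: emeasurable_funM.
  - move=> y _; rewrite mule_ge0//; first by rewrite mule_ge0// lee_fin.
    by rewrite lee_fin mulr_ge0 ?powR_ge0.
  rewrite [RHS]muleC [in RHS]muleA -[in RHS]ge0_integralZr//; last 2 first.
  - by apply: measurable_funTS; apply: emeasurable_funM => //; mfun.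
  - by move=> x _; rewrite mule_ge0// lee_fin mulr_ge0 ?powR_ge0 ?expR_ge0.
  rewrite muleC; congr (_ * _)%E.
  rewrite [RHS]integral_indicE; apply: eq_integral => y _.
  by rewrite /H -!muleA -!EFinM; congr (_ * _%:E)%E; ring.
have one : (C%:E * B * \int[leb]_(x in D)
     (1 * (x `^ (m.+2%:R / 2 - 1) * expR (- (x / 2)))%:E) = 1)%E.
  by rewrite -(main (cst 1%E))//; exact: integral_prob1.
have [||K' K'0 K'E] := ereal_factor1 _ _ one.
- by rewrite mule_ge0// lee_fin.
- by apply: integral_ge0 => x _; rewrite mule_ge0// lee_fin mulr_ge0 ?powR_ge0 ?expR_ge0.
exists K'; first exact: K'0.
move=> phi mphi phi0; rewrite (main _ mphi phi0) K'E.
rewrite -(@ge0_integralZl _ _ _ leb D mD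
  (fun x : mR R => phi x * (x `^ (m.+2%:R / 2 - 1) * expR (- (x / 2)))%:E)%E).
- by apply: eq_integral => x _; rewrite muleCA -EFinM.
- by apply: measurable_funTS; apply: emeasurable_funM => //; mfun.
- by move=> x _; rewrite mule_ge0// lee_fin mulr_ge0 ?powR_ge0 ?expR_ge0.
- by rewrite lee_fin ltW.
Qed.

Definition chi2_law (nu : {measure set (mR R) -> \bar R}) (k : R) :=
  forall A, measurable A -> nu A = (\int[leb]_(x in A) (chi2_pdf k x)%:E)%E.

(** The gamma function is absorbed into an unspecified constant, which is nonzero because [nu] has
    total mass one. *)
Lemma chi2_density_ex (nu : law R) (k : R) : chi2_law nu k ->
  exists2 K : R, 0 < K &
  forall phi : mR R -> \bar R, measurable_fun setT phi -> (forall y, (0 <= phi y)%E) ->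
  (\int[nu]_x phi x = \int[leb]_(x in `]0%R, +oo[)
     (phi x * (K * (x `^ (k / 2 - 1) * expR (- (x / 2))))%:E))%E.
Proof.
move=> nuE; pose K := 2^-1 `^ (k / 2) / gamma_fun (k / 2) : R.
have gam0 : 0 <= gamma_fun (k / 2).
  apply: Rintegral_ge0 => x _; by rewrite mulr_ge0 ?powR_ge0 ?expR_ge0.
have K0 : 0 <= K by rewrite divr_ge0 ?powR_ge0.
pose D : set (mR R) := `]0%R, +oo[%classic.
have mD : measurable D by exact: measurable_itv.
have pdfE x : chi2_pdf k x = K * (x `^ (k / 2 - 1) * expR (- (x / 2))) * \1_D x.
  rewrite /chi2_pdf /gamma_pdf indicE.
  have -> : (x \in D) = (0 < x).
    apply/idP/idP => [/set_mem|t0]; first by rewrite /D/= in_itv/= andbT.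
    by apply/mem_set; rewrite /D/= in_itv/= andbT.
  by case: ltP => _; rewrite ?mulr0// mulr1 -/K mulrA [2^-1 * x]mulrC.
have mpdf : measurable_fun setT (chi2_pdf k : mR R -> R).
  rewrite (_ : chi2_pdf k = fun x => K * (x `^ (k / 2 - 1) * expR (- (x / 2))) * \1_D x).
    by apply: measurable_mul; [mfun|exact: measurable_indic].
  by apply/funext => x; exact: pdfE.
have pdf0 x : 0 <= chi2_pdf k x.
  by rewrite pdfE mulr_ge0// mulr_ge0// mulr_ge0 ?powR_ge0 ?expR_ge0.
have E (phi : mR R -> \bar R) : measurable_fun setT phi -> (forall y, (0 <= phi y)%E) ->
  (\int[nu]_x phi x = \int[leb]_(x in `]0%R, +oo[)
     (phi x * (K * (x `^ (k / 2 - 1) * expR (- (x / 2))))%:E))%E.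
  move=> mphi phi0; rewrite (ge0_integral_density mpdf pdf0 nuE mphi phi0).
  rewrite [RHS]integral_indicE; apply: eq_integral => x _.
  by rewrite pdfE EFinM muleA.
exists K => //; rewrite lt_neqAle K0 andbT eq_sym; apply/eqP => K00.
have := E (cst 1%E) (measurable_cst _) (fun=> lee01).
rewrite integral_prob1 K00.
under eq_integral do rewrite mul0r mule0.
by rewrite integral0 => /eqP; rewrite onee_eq0.
Qed.

(** Both densities are multiples of the same function and both have mass one, hence the constants
    agree. *)
Lemma sumsq_law_chi2 (nu : law R) (m : nat) :
  chi2_law nu m.+1%:R ->
  forall phi : mR R -> \bar R, measurable_fun setT phi -> (forall y, (0 <= phi y)%E) ->
  (\int[sumsq_law m.+1]_x phi x = \int[nu]_x phi x)%E.
Proof.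
move=> /chi2_density_ex[K K0 KE]; have [K' K'0 K'E] := sumsq_density_ex m.
suff KK : K = K' by move=> phi mphi phi0; rewrite K'E// KE// KK.
pose D : set (mR R) := `]0%R, +oo[%classic.
have mD : measurable D by exact: measurable_itv.
pose I := (\int[leb]_(x in D) (x `^ (m.+1%:R / 2 - 1) * expR (- (x / 2)))%:E)%E.
have I0 : (0 <= I)%E.
  by apply: integral_ge0 => x _; rewrite lee_fin mulr_ge0 ?powR_ge0 ?expR_ge0.
have one (nu' : law R) c : 0 < c ->
    (forall phi : mR R -> \bar R, measurable_fun setT phi -> (forall y, (0 <= phi y)%E) ->
    (\int[nu']_x phi x = \int[leb]_(x in `]0%R, +oo[)
     (phi x * (c * (x `^ (m.+1%:R / 2 - 1) * expR (- (x / 2))))%:E))%E) ->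
    (c%:E * I = 1)%E.
  move=> c0 /(_ (cst 1%E) (measurable_cst _) (fun=> lee01)).
  rewrite integral_prob1 => H; apply: etrans (esym H).
  rewrite /I -ge0_integralZl//.
  - by apply: eq_integral => x _; rewrite mul1e.
  - by apply: measurable_funTS; mfun.
  - by move=> x _; rewrite lee_fin mulr_ge0 ?powR_ge0 ?expR_ge0.
  - by rewrite lee_fin ltW.
have I1 := one _ _ K0 KE; have I1' := one _ _ K'0 K'E.
have [J J0 JE] : exists2 r : R, 0 < r & I = r%:E.
  by apply: (@ereal_factor1 _ K%:E) => //; [rewrite lee_fin ltW|rewrite muleC].
move: I1 I1'; rewrite JE -!EFinM => -[KJ] [K'J].
by apply: (mulIf (lt0r_neq0 J0)); rewrite KJ.
Qed.

End sum_of_squares.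

(** * Bartlett's decomposition *)

(** Uniqueness of the product measure, applied to the law of [f] under the conditional probability
    given [E]. In an induction, [E] carries the independent variables not yet used. *)
Lemma product_law_on_event {R : realType} {d d1 d2} {Omega : measurableType d}
    {T1 : measurableType d1} {T2 : measurableType d2} {P : probability Omega R}
    {m1 : probability T1 R} {m2 : probability T2 R} (f : Omega -> T1 * T2) (E : set Omega) :
  measurable_fun setT f -> measurable E ->
  (forall A B, measurable A -> measurable B ->
     P (f @^-1` (A `*` B) `&` E) = m1 A * m2 B * P E)%E ->
  forall X, measurable X -> P (f @^-1` X `&` E) = ((m1 \x m2) X * P E)%E.
Proof.
move=> mf mE rect X mX; set c := P E.
have mfX : measurable (f @^-1` X) by rewrite -[X in measurable X]setTI; exact: mf.
have cfin : c \is a fin_num by exact: fin_num_measure.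
have c0 : (0 <= c)%E by exact: measure_ge0.
have [c00|cn0] := eqVneq c 0%E.
  rewrite c00 mule0; apply/eqP; rewrite eq_le measure_ge0 andbT.
  rewrite -[leRHS]c00; apply: le_measure; rewrite ?inE//.
  by apply: measurableI.
have fc : 0 < fine c by rewrite lt_neqAle eq_sym fine_eq0// cn0 fine_ge0.
have ic0 : 0 <= (fine c)^-1 by rewrite invr_ge0 ltW.
have mXE : (m1 \x m2)%E X = mscale (NngNum ic0) (pushforward (mrestr P mE) f) X.
  move=> ?; apply: product_measure_unique => // A B mA mB.
  transitivity ((fine c)^-1%:E * P (f @^-1` (A `*` B) `&` E))%E; first by [].
  rewrite rect// muleC -muleA.
  by rewrite -/c -[X in (_ * (X * _))%E](fineK cfin) -EFinM mulfV ?mule1// gt_eqF.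
have {}mXE : (m1 \x m2)%E X = ((fine c)^-1%:E * P (f @^-1` X `&` E))%E.
  exact: (mXE mf).
rewrite mXE muleAC -[X in (_ * X * _)%E](fineK cfin) -EFinM mulVf ?mul1e//.
by rewrite gt_eqF.
Qed.

Section iid_recursion.
Context {d d' d''} {Omega : measurableType d} {T : measurableType d'}
  {S : measurableType d''} {R : realType}.
Variables (P : probability Omega R) (n : nat) (Y : 'I_n -> Omega -> T)
  (nu : probability T R).
Hypotheses (mY : forall i, measurable_fun setT (Y i))
  (Yindep : mutually_independent P Y)
  (Ylaw : forall i A, measurable A -> P (Y i @^-1` A) = nu A).
Variables (F : S * T -> S) (s0 : S).
Hypothesis mF : measurable_fun setT F.

(** A statistic updated one observation at a time, so that its law is a recursion on the number of
    observations alone. *)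
Definition iid_state (s : seq 'I_n) (w : Omega) : S :=
  foldr (fun i st => F (st, Y i w)) s0 s.

Fixpoint iid_state_law (k : nat) : probability S R :=
  if k is k'.+1 then image_prob (iid_state_law k' \x nu)%E mF else \d_s0.

Let event (J : {set 'I_n}) (A : 'I_n -> set T) : set Omega :=
  [set w | forall i, i \in J -> A i (Y i w)].

Let measurable_event J A : (forall i, measurable (A i)) -> measurable (event J A).
Proof.
move=> mA; rewrite (_ : event J A = \bigcap_(i in [set` J]) (Y i @^-1` A i))//.
apply: fin_bigcap_measurable => // i _.
by rewrite -[X in measurable X]setTI; exact: mY.
Qed.

Lemma measurable_iid_state s : measurable_fun setT (iid_state s).
Proof.
elim: s => [|i s ih]; first exact: measurable_cst.
apply: (measurableT_comp (f := F) (g := fun w => (iid_state s w, Y i w))) => //.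
exact: measurable_tuple2.
Qed.

Let measurable_state_preimage s B : measurable B -> measurable (iid_state s @^-1` B).
Proof. by move=> mB; rewrite -[X in measurable X]setTI; exact: measurable_iid_state. Qed.

(** The induction must carry an arbitrary event on coordinates outside [s]: adding observation [i]
    to the state takes coordinate [i] out of that event. *)
Let iid_state_independent s : uniq s -> forall (J : {set 'I_n}) (A : 'I_n -> set T) B,
  (forall i, i \in s -> i \notin J) -> (forall i, measurable (A i)) -> measurable B ->
  P (iid_state s @^-1` B `&` event J A) =
  (iid_state_law (size s) B * \prod_(i in J) nu (A i))%E.
Proof.
elim: s => [_|i s ih /= /andP[iNs us]] J A B sJ mA mB.
  rewrite /= diracE; case: (boolP (s0 \in B)) => sB.
    rewrite mul1e (_ : _ `&` _ = event J A).
      by rewrite Yindep//; apply: eq_bigr => i _; exact: Ylaw.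
    by apply/seteqP; split => [w []//|w wE]; split => //; exact/set_mem.
  rewrite mul0e (_ : _ `&` _ = set0) ?measure0//.
  by apply/seteqP; split => // w [/= ? _]; move/negP: sB; apply; exact/mem_set.
have iJ : i \notin J by apply: sJ; rewrite inE eqxx.
pose c := (\prod_(j in J) nu (A j))%E.
have cE : P (event J A) = c.
  by rewrite Yindep//; apply: eq_bigr => j _; exact: Ylaw.
have mE := measurable_event J mA.
pose f w := (iid_state s w, Y i w).
have mf : measurable_fun setT f.
  by apply: measurable_tuple2 => //; exact: measurable_iid_state.
have -> : iid_state (i :: s) @^-1` B `&` event J A = f @^-1` (F @^-1` B) `&` event J A by [].
have mFB : measurable (F @^-1` B) by rewrite -[X in measurable X]setTI; exact: mF.
have rect A0 A1 : measurable A0 -> measurable A1 ->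
    P (f @^-1` (A0 `*` A1) `&` event J A) = (iid_state_law (size s) A0 * nu A1 * c)%E.
  move=> mA0 mA1.
  (* The induction hypothesis is applied to the index set enlarged by [i], with [A1] prescribed at
     [i]. *)
  pose A' j := if j == i then A1 else A j.
  have mA' j : measurable (A' j) by rewrite /A'; case: ifP.
  have := ih us (i |: J)%SET A' A0 _ mA' mA0.
  rewrite big_setU1//= (_ : A' i = A1); last by rewrite /A' eqxx.
  move=> H.
  rewrite -muleA (_ : c = \prod_(j in J) nu (A' j))%E; last first.
    apply: eq_bigr => j jJ; rewrite /A'; case: eqP => // ji.
    by move: iJ; rewrite -ji jJ.
  rewrite -H; last first.
    move=> j js; rewrite in_setU1 negb_or; apply/andP; split.
      by apply: contraNneq iNs => <-.
    by apply: sJ; rewrite inE js orbT.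
  congr (P _); apply/seteqP; split => [w [[/= wA0 wA1] wE]|w [/= wA0 wE]].
    split => //= j; rewrite in_setU1 /A'; case: eqP => [->//|_ /= jJ].
    exact: wE.
  split; first split => //=.
    by have := wE i; rewrite in_setU1 eqxx /A' eqxx; exact.
  move=> j jJ; have := wE j; rewrite in_setU1 jJ orbT /A'; case: eqP => [ji|_]; last exact.
  by move: iJ; rewrite -ji jJ.
rewrite -/c -cE; apply: (product_law_on_event mf mE _ mFB) => A0 A1 mA0 mA1.
by rewrite rect// cE.
Qed.

Lemma ge0_integral_iid_state s (phi : S -> \bar R) : uniq s ->
  measurable_fun setT phi -> (forall y, (0 <= phi y)%E) ->
  (\int[P]_w phi (iid_state s w) = \int[iid_state_law (size s)]_y phi y)%E.
Proof.
move=> us mphi phi0; have mst := measurable_iid_state s.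
transitivity (\int[pushforward P (iid_state s)]_y phi y)%E.
  by rewrite ge0_integral_pushforward.
apply: eq_measure_integral => B mB _.
have := iid_state_independent us (J := finset.set0) (A := fun=> setT) (B := B).
rewrite finset.big_set0 mule1 => H; apply: etrans (H _ _ mB) => //; last first.
  by move=> i _; rewrite inE.
by rewrite (_ : event _ _ = setT) ?setIT//; apply/seteqP; split => // w _ i; rewrite inE.
Qed.

Lemma ge0_integral_iid_state_lawS k (phi : S -> \bar R) :
  measurable_fun setT phi -> (forall y, (0 <= phi y)%E) ->
  (\int[iid_state_law k.+1]_y phi y =
   \int[iid_state_law k]_s \int[nu]_y phi (F (s, y)))%E.
Proof.
move=> mphi phi0; rewrite ge0_integral_image_prob//.
rewrite (fubini_tonelli1 (fun z : S * T => phi (F z)))//.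
exact: (measurableT_comp mphi mF).
Qed.

Lemma ge0_integral_iid_state_law0 (phi : S -> \bar R) :
  measurable_fun setT phi -> (\int[iid_state_law 0]_y phi y = phi s0)%E.
Proof. by move=> mphi; rewrite integral_dirac// diracT mul1e. Qed.

End iid_recursion.

Section bartlett.
Context {R : realType}.
Local Notation N := (@normal_prob R 0 1).
Local Notation M := (@sumsq_law R).

(** The law is carried by the nonnegative reals, on which [Num.sqrt c ^+ 2 = c]. *)
Lemma eq_integral_sumsq m (phi psi : mR R -> \bar R) :
  measurable_fun setT phi -> (forall y, (0 <= phi y)%E) ->
  measurable_fun setT psi -> (forall y, (0 <= psi y)%E) ->
  (forall x, 0 <= x -> phi x = psi x) ->
  (\int[M m]_x phi x = \int[M m]_x psi x)%E.
Proof.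
move=> mphi phi0 mpsi psi0 phipsi.
elim: m phi psi mphi phi0 mpsi psi0 phipsi => [|m ih] phi psi mphi phi0 mpsi psi0 phipsi.
  by rewrite !ge0_integral_sumsq0// phipsi.
have mcomp (f : mR R -> \bar R) : measurable_fun setT f ->
    measurable_fun setT (fun z : mR R * mR R => f (z.1 + z.2 ^+ 2)).
  by move=> mf; apply: (measurableT_comp mf); mfun.
rewrite !ge0_integral_sumsqS//; apply: ih.
- by apply: measurable_integral => //; exact: mcomp.
- by move=> x; apply: integral_ge0.
- by apply: measurable_integral => //; exact: mcomp.
- by move=> x; apply: integral_ge0.
move=> x x0; apply: eq_integral => z _; apply: phipsi.
by rewrite addr_ge0// sqr_ge0.
Qed.

(** The state holds the raw sums of [u], [v], [u^2], [u v] and [v^2] over the pairs [(u, v)] seen so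
    far. *)
Definition moment_step (z : mR5 R * (mR R * mR R)) : mR5 R :=
  (z.1.1.1.1.1 + z.2.1, z.1.1.1.1.2 + z.2.2, z.1.1.1.2 + z.2.1 ^+ 2,
   z.1.1.2 + z.2.1 * z.2.2, z.1.2 + z.2.2 ^+ 2).

Lemma measurable_moment_step : measurable_fun setT moment_step.
Proof. by rewrite /moment_step; mfun. Qed.

Definition moment_law (k : nat) : probability (mR5 R) R :=
  iid_state_law (N \x N)%E ((0, 0, 0, 0, 0) : mR5 R) measurable_moment_step k.

(** The raw sums of [k] standard normal pairs in independent coordinates: [a] and [b] are [sqrt k]
    times the means, [c] is the centred sum of squares of the first coordinate, [w] the normalized
    regression of the second on the first, and [e] the residual sum of squares. *)
Definition bartlett (k : nat) (a b c w e : R) : mR5 R :=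
  (Num.sqrt k%:R * a, Num.sqrt k%:R * b, c + a ^+ 2, Num.sqrt c * w + a * b,
   w ^+ 2 + e + b ^+ 2).

Ltac nonneg := intros; repeat (apply: integral_ge0; intros); done.
Ltac unfold_lets := repeat match goal with v := _ |- _ => progress unfold v end.
Ltac mcomp h := unfold_lets; apply: (measurableT_comp h); rewrite /bartlett /moment_step/=; mfun.
Ltac mint h := unfold_lets; repeat (apply: measurable_integral; last by nonneg); mcomp h.

Lemma ge0_integral_moment_lawS k (phi : mR5 R -> \bar R) :
  measurable_fun setT phi -> (forall y, (0 <= phi y)%E) ->
  (\int[moment_law k.+1]_s phi s =
   \int[N]_u \int[N]_v \int[moment_law k]_s phi (moment_step (s, (u, v))))%E.
Proof.
move=> mphi phi0; rewrite ge0_integral_iid_state_lawS//.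
transitivity (\int[moment_law k]_s \int[N]_u \int[N]_v phi (moment_step (s, (u, v))))%E.
  apply: eq_integral => s _.
  rewrite (fubini_tonelli1 (fun y : mR R * mR R => phi (moment_step (s, y))))//.
  by mcomp mphi.
rewrite tonelli//; last 2 first.
- by mint mphi.
- by nonneg.
apply: eq_integral => u _; rewrite tonelli//; mcomp mphi.
Qed.

Lemma ge0_integral_moment_law0 (phi : mR5 R -> \bar R) : measurable_fun setT phi ->
  (\int[moment_law 0]_s phi s = phi (0, 0, 0, 0, 0)%R)%E.
Proof. by move=> mphi; rewrite ge0_integral_iid_state_law0. Qed.

(* Rotating both pairs leaves the dot product [a b + u v] unchanged. *)
Lemma ge0_integral_normal_rotation2 (p q : R) (phi : mR R -> mR R -> mR R -> mR R -> \bar R) :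
  p ^+ 2 + q ^+ 2 = 1 ->
  measurable_fun setT (fun z : mR R * mR R * mR R * mR R => phi z.1.1.1 z.1.1.2 z.1.2 z.2) ->
  (forall a u b v, (0 <= phi a u b v)%E) ->
  (\int[N]_a \int[N]_u \int[N]_b \int[N]_v phi a u b v =
   \int[N]_a \int[N]_u \int[N]_b \int[N]_v
     phi (p * a + - q * u)%R (q * a + p * u)%R (p * b + - q * v)%R (q * b + p * v)%R)%E.
Proof.
move=> pq mphi phi0.
have pq' : p ^+ 2 + (- q) ^+ 2 = 1 by rewrite sqrrN.
pose psi (z : mR R * mR R) := (\int[N]_b \int[N]_v phi z.1 z.2 b v)%E.
have mpsi : measurable_fun setT psi.
  apply: measurable_integral; last by intros; apply: integral_ge0.
  exact: measurable_integral.
have psi0 z : (0 <= psi z)%E by apply: integral_ge0 => b _; apply: integral_ge0.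
transitivity (\int[N]_a \int[N]_u psi (a, u))%E; first by [].
apply: etrans (esym (ge0_integral_normal_rotation pq' mpsi psi0)) _.
apply: eq_integral => a _; apply: eq_integral => u _; rewrite opprK /psi /=.
pose chi (z : mR R * mR R) := phi (p * a + - q * u) (q * a + p * u) z.1 z.2.
transitivity (\int[N]_b \int[N]_v chi (b, v))%E; first by [].
have mchi : measurable_fun setT chi.
  apply: (measurableT_comp mphi (g := fun z : mR R * mR R =>
    (p * a + - q * u, q * a + p * u, z.1, z.2))).
  by mfun.
apply: etrans (esym (ge0_integral_normal_rotation pq' mchi _)) _; first by move=> z; exact: phi0.
by apply: eq_integral => b _; apply: eq_integral => v _; rewrite opprK.
Qed.

(** Two pairs leave one contrast per coordinate: [c] is a single square and the residual [e] has no
    degree of freedom, hence the law [M 0]. *)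
Lemma moment_law_bartlett2 (phi : mR5 R -> \bar R) :
  measurable_fun setT phi -> (forall y, (0 <= phi y)%E) ->
  (\int[moment_law 2]_s phi s =
   \int[N]_a \int[N]_b \int[M 1]_c \int[N]_w \int[M 0]_e phi (bartlett 2 a b c w e))%E.
Proof.
move=> mphi phi0.
pose f (u1 u2 v1 v2 : mR R) := phi (u1 + u2, v1 + v2, u1 ^+ 2 + u2 ^+ 2,
  u1 * v1 + u2 * v2, v1 ^+ 2 + v2 ^+ 2).
have f0 u1 u2 v1 v2 : (0 <= f u1 u2 v1 v2)%E by exact: phi0.
transitivity (\int[N]_u2 \int[N]_v2 \int[N]_u1 \int[N]_v1 f u1 u2 v1 v2)%E.
  apply: etrans (ge0_integral_moment_lawS 1 mphi phi0) _.
  apply: eq_integral => u2 _; apply: eq_integral => v2 _.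
  have mstep : measurable_fun setT (fun s => phi (moment_step (s, (u2, v2)))).
    by mcomp mphi.
  apply: etrans (ge0_integral_moment_lawS 0 mstep (fun=> phi0 _)) _.
  apply: eq_integral => u1 _; apply: eq_integral => v1 _.
  apply: etrans (ge0_integral_moment_law0 _) _; first by mcomp mphi.
  by rewrite /f /moment_step /= !add0r.
transitivity (\int[N]_u1 \int[N]_u2 \int[N]_v1 \int[N]_v2 f u1 u2 v1 v2)%E.
  transitivity (\int[N]_u2 \int[N]_u1 \int[N]_v2 \int[N]_v1 f u1 u2 v1 v2)%E.
    apply: eq_integral => u2 _; apply: tonelli; last by nonneg.
    by mint mphi.
  etransitivity; [apply: tonelli; [by mint mphi|by nonneg]|].
  apply: eq_integral => u1 _; apply: eq_integral => u2 _.
  by apply: tonelli; [mcomp mphi|nonneg].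
have s2 : Num.sqrt 2 ^+ 2 = 2 :> R by rewrite sqr_sqrtr.
have s20 : Num.sqrt 2 != 0 :> R by rewrite gt_eqF// sqrtr_gt0.
(* A rotation by 45 degrees turns two values into their sum and their difference, both over
   [sqrt 2]. *)
pose p : R := Num.sqrt 2 / 2.
have p2 : p ^+ 2 = 2^-1 by rewrite /p expr_div_n s2; field.
have pp : p ^+ 2 + p ^+ 2 = 1 by rewrite p2; field.
etransitivity; [apply: (ge0_integral_normal_rotation2 pp); [by mcomp mphi|by nonneg]|].
transitivity (\int[N]_a \int[N]_d \int[N]_b \int[N]_w
    phi (bartlett 2 a b (d ^+ 2) w 0))%E.
  apply: eq_integral => a _; apply: eq_integral => d _; apply: eq_integral => b _.
  pose g (s x : R) := phi (Num.sqrt 2 * a, Num.sqrt 2 * b, a ^+ 2 + d ^+ 2, a * b + s * x,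
    b ^+ 2 + x ^+ 2).
  have mg s : measurable_fun setT (g s : mR R -> \bar R) by mcomp mphi.
  transitivity (\int[N]_x g d x)%E.
    apply: eq_integral => x _; rewrite /f /g.
    have e1 y z : p * y + - p * z + (p * y + p * z) = Num.sqrt 2 * y.
      by rewrite /p; field.
    have e2 y y' z z' : (p * y + - p * z) * (p * y' + - p * z') +
        (p * y + p * z) * (p * y' + p * z') = y * y' + z * z'.
      transitivity (p ^+ 2 *+ 2 * (y * y' + z * z')); first ring.
      by rewrite mulr2n pp mul1r.
    by rewrite !e1 !expr2 !e2.
  (* [bartlett] contains [sqrt (d^2) = |d|]; for negative [d] the sign is absorbed by the symmetry
     of [x]. *)
  transitivity (\int[N]_x g `|d|%R x)%E.
    have [d0|d0] := leP 0 d; first by rewrite ger0_norm.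
    apply: etrans (esym (ge0_integral_normalN (mg d) _)) _; first by move=> x; exact: phi0.
    apply: eq_integral => x _; rewrite ltr0_norm// /g.
    by rewrite mulrN mulNr sqrrN.
  apply: eq_integral => x _; rewrite /g /bartlett sqrtr_sqr addr0.
  by rewrite [a ^+ 2 + _]addrC [a * b + _]addrC [b ^+ 2 + _]addrC.
apply: eq_integral => a _.
etransitivity; [apply: tonelli; [by mint mphi|by nonneg]|].
apply: eq_integral => b _.
etransitivity; [|apply: esym; apply: ge0_integral_sumsqS; [by mint mphi|by nonneg]].
etransitivity; [|apply: esym; apply: ge0_integral_sumsq0; by mint mphi].
apply: eq_integral => d _; apply: eq_integral => w _.
etransitivity; [|apply: esym; apply: ge0_integral_sumsq0; by mcomp mphi].
by rewrite add0r.
Qed.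

(** A new pair [(u, v)] is absorbed by two rotations. The first, on [(a, u)] and [(b, v)] alike,
    merges it into the means and leaves contrasts [(d, x)]. The second, on [(w, x)], aligns [w] with
    the vector [(sqrt c, d)] of length [sqrt (c + d^2)]. Then [d^2] joins [c], and the square of the
    leftover normal joins [e]. *)
Lemma moment_law_bartlett k (phi : mR5 R -> \bar R) :
  measurable_fun setT phi -> (forall y, (0 <= phi y)%E) ->
  (\int[moment_law k.+2]_s phi s =
   \int[N]_a \int[N]_b \int[M k.+1]_c \int[N]_w \int[M k]_e
     phi (bartlett k.+2 a b c w e))%E.
Proof.
elim: k phi => [|k ih] phi mphi phi0; first exact: moment_law_bartlett2.
pose K : R := k.+2%:R.
have K0 : 0 < K by rewrite ltr0n.
pose f (a u b v c w e : mR R) := phi (Num.sqrt K * a + u, Num.sqrt K * b + v,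
  c + (a ^+ 2 + u ^+ 2), Num.sqrt c * w + (a * b + u * v),
  w ^+ 2 + e + (b ^+ 2 + v ^+ 2)).
have f0 a u b v c w e : (0 <= f a u b v c w e)%E by exact: phi0.
transitivity (\int[N]_u \int[N]_v \int[N]_a \int[N]_b \int[M k.+1]_c \int[N]_w \int[M k]_e
    f a u b v c w e)%E.
  apply: etrans (ge0_integral_moment_lawS k.+2 mphi phi0) _.
  apply: eq_integral => u _; apply: eq_integral => v _.
  have mstep : measurable_fun setT (fun s => phi (moment_step (s, (u, v)))).
    by mcomp mphi.
  apply: etrans (ih _ mstep (fun=> phi0 _)) _.
  apply: eq_integral => a _; apply: eq_integral => b _; apply: eq_integral => c _.
  apply: eq_integral => w _; apply: eq_integral => e _.
  by rewrite /f /moment_step /bartlett /= !addrA.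
transitivity (\int[N]_a \int[N]_u \int[N]_b \int[N]_v \int[M k.+1]_c \int[N]_w \int[M k]_e
    f a u b v c w e)%E.
  transitivity (\int[N]_u \int[N]_a \int[N]_v \int[N]_b \int[M k.+1]_c \int[N]_w \int[M k]_e
    f a u b v c w e)%E.
    apply: eq_integral => u _; apply: tonelli; last by nonneg.
    by mint mphi.
  etransitivity; [apply: tonelli; [by mint mphi|by nonneg]|].
  apply: eq_integral => a _; apply: eq_integral => u _; apply: tonelli; last by nonneg.
  by mint mphi.
have sK : Num.sqrt (K + 1) ^+ 2 = K + 1 by rewrite sqr_sqrtr// addr_ge0// ltW.
have sK' : Num.sqrt K ^+ 2 = K by rewrite sqr_sqrtr// ltW.
have sK0 : Num.sqrt (K + 1) != 0 by rewrite gt_eqF// sqrtr_gt0 addr_gt0.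
(* The direction [(sqrt K, 1)] normalized: along it, [sqrt K a + u] is [sqrt (K + 1)] times a single
   normal variable. *)
pose p := Num.sqrt K / Num.sqrt (K + 1); pose q := (Num.sqrt (K + 1))^-1.
have pq : p ^+ 2 + q ^+ 2 = 1.
  rewrite /p /q expr_div_n exprVn sK sK'; field.
  by rewrite gt_eqF// addr_gt0.
etransitivity; [apply: (ge0_integral_normal_rotation2 pq); [by mint mphi|by nonneg]|].
pose g (a d b x c w e : mR R) := phi (Num.sqrt (K + 1) * a, Num.sqrt (K + 1) * b,
  c + d ^+ 2 + a ^+ 2, Num.sqrt c * w + d * x + a * b, w ^+ 2 + x ^+ 2 + e + b ^+ 2).
have g0 a d b x c w e : (0 <= g a d b x c w e)%E by exact: phi0.
transitivity (\int[N]_a \int[N]_d \int[N]_b \int[N]_x \int[M k.+1]_c \int[N]_w \int[M k]_e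
    g a d b x c w e)%E.
  apply: eq_integral => a _; apply: eq_integral => d _; apply: eq_integral => b _.
  apply: eq_integral => x _; apply: eq_integral => c _; apply: eq_integral => w _.
  apply: eq_integral => e _; rewrite /f /g.
  have e1 y z : Num.sqrt K * (p * y + - q * z) + (q * y + p * z) = Num.sqrt (K + 1) * y.
    transitivity ((Num.sqrt K ^+ 2 + 1) / Num.sqrt (K + 1) * y).
      by rewrite /p /q; field.
    by rewrite sK' -{1}sK; field.
  have e2 y y' z z' : (p * y + - q * z) * (p * y' + - q * z') +
      (q * y + p * z) * (q * y' + p * z') = y * y' + z * z'.
    transitivity ((p ^+ 2 + q ^+ 2) * (y * y' + z * z')); first ring.
    by rewrite pq mul1r.
  rewrite !e1 !expr2 !e2; congr (phi (_, _, _, _, _)); ring.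
apply: eq_integral => a _.
transitivity (\int[N]_b \int[N]_d \int[M k.+1]_c \int[N]_x \int[N]_w \int[M k]_e
    g a d b x c w e)%E.
  etransitivity; [apply: tonelli; [by mint mphi|by nonneg]|].
  apply: eq_integral => b _; apply: eq_integral => d _; apply: tonelli; last by nonneg.
  by mint mphi.
apply: eq_integral => b _.
pose h (c w e : mR R) := phi (bartlett k.+3 a b c w e).
have h0 c w e : (0 <= h c w e)%E by exact: phi0.
have KE : k.+3%:R = K + 1 :> R by rewrite /K -natr1.
transitivity (\int[N]_d \int[M k.+1]_c \int[N]_x \int[N]_w \int[M k]_e
    h (c + d ^+ 2)%R w (e + x ^+ 2)%R)%E.
  apply: eq_integral => d _; apply: eq_integral_sumsq.
  - by mint mphi.
  - by nonneg.
  - by mint mphi.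
  - by nonneg.
  move=> c c0.
  (* The unit vector along [(sqrt c, d)]. When both entries vanish every rotation works, and the
     identity is taken. *)
  have [P [Q [PQ Pc Qd]]] : exists P Q : R, [/\ P ^+ 2 + Q ^+ 2 = 1,
      Num.sqrt c = Num.sqrt (c + d ^+ 2) * P & d = Num.sqrt (c + d ^+ 2) * Q].
    have [cd0|cd0] := eqVneq (c + d ^+ 2) 0.
      exists 1, 0; rewrite expr1n expr0n/= addr0 cd0 sqrtr0 !mul0r.
      have c00 : c = 0 by have := sqr_ge0 d; lra.
      split => //; first by rewrite c00 sqrtr0.
      by apply/eqP; rewrite -sqrf_eq0; apply/eqP; lra.
    have cdp : 0 < c + d ^+ 2 by rewrite lt_neqAle eq_sym cd0 addr_ge0// sqr_ge0.
    have scd : Num.sqrt (c + d ^+ 2) != 0 by rewrite gt_eqF// sqrtr_gt0.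
    exists (Num.sqrt c / Num.sqrt (c + d ^+ 2)), (d / Num.sqrt (c + d ^+ 2)).
    split; [|by field|by field].
    by rewrite !expr_div_n !sqr_sqrtr//; [field|exact: ltW].
  pose G (z : mR R * mR R) := (\int[M k]_e h (c + d ^+ 2)%R z.1 (e + z.2 ^+ 2)%R)%E.
  have mG : measurable_fun setT G by mint mphi.
  have G0 z : (0 <= G z)%E by nonneg.
  etransitivity; [apply: tonelli; [by mint mphi|by nonneg]|].
  etransitivity; [|apply: esym; apply: tonelli; [by mint mphi|by nonneg]].
  apply: etrans (ge0_integral_normal_rotation PQ mG G0).
  apply: eq_integral => w _; apply: eq_integral => x _; apply: eq_integral => e _.
  rewrite /g /h /bartlett KE /=; congr (phi (_, _, _, _, _)).
    by rewrite Pc {2}Qd; ring.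
  transitivity ((P ^+ 2 + Q ^+ 2) * (w ^+ 2 + x ^+ 2) + e + b ^+ 2); last ring.
  by rewrite PQ mul1r.
etransitivity; [apply: tonelli; [by mint mphi|by nonneg]|].
etransitivity; [|apply: esym; apply: ge0_integral_sumsqS; [by mint mphi|by nonneg]].
apply: eq_integral => c _; apply: eq_integral => d _.
etransitivity; [apply: tonelli; [by mint mphi|by nonneg]|].
apply: eq_integral => w _.
etransitivity; [|apply: esym; apply: ge0_integral_sumsqS; [by mcomp mphi|by nonneg]].
by apply: tonelli; [mcomp mphi|nonneg].
Qed.

End bartlett.

(** * The posterior law of eta3 *)

Section standardization.
Context {R : realType}.
Local Notation N := (@normal_prob R 0 1).

(** Inverse of the Cholesky map [x1 = mu1 + s1 u1], [x2 = mu2 + s2 (rho u1 + sqrt (1 - rho^2)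
    u2)]. *)
Definition stdize (th : param R) (x : R * R) : R * R :=
  let: (mu1, mu2, s1, s2, rho) := th in
  ((x.1 - mu1) / s1,
   ((x.2 - mu2) / s2 - rho * ((x.1 - mu1) / s1)) / Num.sqrt (1 - rho ^+ 2)).

Lemma onem_sqr_gt0 (rho : R) : -1 < rho < 1 -> 0 < 1 - rho ^+ 2.
Proof. by move=> /andP[r1 r2]; rewrite (_ : _ - _ = (1 - rho) * (1 + rho)); [nra|ring]. Qed.

Lemma det_mx22 (A : 'M[R]_2) : \det A = A 0 0 * A 1 1 - A 0 1 * A 1 0.
Proof.
rewrite (expand_det_row _ 0) !big_ord_recl big_ord0 addr0 /cofactor !det_mx11 !mxE.
rewrite /= !expr0 !expr1 mul1r mulN1r mulrN; congr (A _ _ * A _ _ - A _ _ * A _ _);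
  exact/val_inj.
Qed.

Lemma binormal_pdfE (mu1 mu2 s1 s2 rho : R) (x : R * R) :
  0 < s1 -> 0 < s2 -> -1 < rho < 1 ->
  let y := stdize (mu1, mu2, s1, s2, rho) x in
  binormal_pdf (mu1, mu2, s1, s2, rho) x =
  (s1 * s2 * Num.sqrt (1 - rho ^+ 2))^-1 * (normal_pdf 0 1 y.1 * normal_pdf 0 1 y.2).
Proof.
move=> s10 s20 /onem_sqr_gt0 r0 y.
have r1 : 0 < Num.sqrt (1 - rho ^+ 2) by rewrite sqrtr_gt0.
have sr : Num.sqrt (1 - rho ^+ 2) ^+ 2 = 1 - rho ^+ 2 by rewrite sqr_sqrtr// ltW.
set r := Num.sqrt _ in r1 sr *.
pose S := covariance_mx s1 s2 rho.
have detS : \det S = (s1 * s2 * r) ^+ 2.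
  rewrite det_mx22 !mxE/= !exprMn sr; ring.
(* The inverse of the covariance matrix, with [r^2] in place of [1 - rho^2]. *)
pose W : 'M[R]_2 := \matrix_(i < 2, j < 2)
    (nth [::] [:: [:: (s1 * r) ^- 2; - rho / (s1 * s2 * r ^+ 2)];
                  [:: - rho / (s1 * s2 * r ^+ 2); (s2 * r) ^- 2]] i)`_j.
have rr : rho ^+ 2 = 1 - r ^+ 2 by rewrite sr; ring.
have n1 : s1 != 0 by rewrite gt_eqF.
have n2 : s2 != 0 by rewrite gt_eqF.
have n3 : r != 0 by rewrite gt_eqF.
have SW : S *m W = 1%:M.
  apply/matrixP => i j; rewrite !mxE !big_ord_recl big_ord0 !mxE/=.
  case: i => [[|[|//]] ?]; case: j => [[|[|//]] ?] /=; rewrite ?addr0.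
  - transitivity ((1 - rho ^+ 2) / r ^+ 2); first by field; rewrite n1 n2 n3.
    by rewrite -sr mulfV// expf_neq0.
  - by field; rewrite n1 n2 n3.
  - by field; rewrite n1 n2 n3.
  - transitivity ((1 - rho ^+ 2) / r ^+ 2); first by field; rewrite n1 n2 n3.
    by rewrite -sr mulfV// expf_neq0.
have Su : S \in unitmx.
  by rewrite unitmxE detS unitfE expf_neq0// !mulf_neq0.
have invS : invmx S = W by rewrite -[invmx S]mulmx1 -SW mulmxA mulVmx// mul1mx.
rewrite /binormal_pdf /mvnormal_pdf -/S invS detS !normal_pdf01.
have -> : ((row2 x - row2 (mu1, mu2)) *m W *m (row2 x - row2 (mu1, mu2))^T) 0 0 =
    y.1 ^+ 2 + y.2 ^+ 2.
  rewrite !mxE !big_ord_recl big_ord0 !mxE !big_ord_recl !big_ord0 !mxE/= /y /stdize -/r /=.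
  set d1 := x.1 - mu1; set d2 := x.2 - mu2.
  transitivity ((d1 / s1) ^+ 2 * (r ^+ 2 + rho ^+ 2) / r ^+ 2 - 2 * rho * (d1 / s1) * (d2 / s2) / r ^+ 2
     + (d2 / s2) ^+ 2 / r ^+ 2); last by field; rewrite n1 n2 n3.
  have -> : r ^+ 2 + rho ^+ 2 = 1 by rewrite rr; ring.
  by field; rewrite n1 n2 n3.
rewrite [_ / 2 in LHS]mulrDl opprD expRD /normal_peak expr1n mul1r.
have -> : Num.sqrt ((2 * pi) ^+ 2 * (s1 * s2 * r) ^+ 2) = 2 * pi * (s1 * s2 * r).
  by rewrite -exprMn sqrtr_sqr ger0_norm// !mulr_ge0 ?pi_ge0// ltW.
have -> : 2 * pi = Num.sqrt (pi *+ 2) ^+ 2 :> R.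
  rewrite sqr_sqrtr; first by rewrite mulr_natl.
  by rewrite mulrn_wge0// pi_ge0.
have n4 : Num.sqrt (pi *+ 2) != 0 :> R by rewrite gt_eqF// sqrtr_gt0 mulrn_wgt0// pi_gt0.
by field; rewrite n1 n2 n3 n4.
Qed.

Lemma measurable_stdize th : measurable_fun setT (stdize th : mR R * mR R -> mR R * mR R).
Proof. by case: th => [[[[mu1 mu2] s1] s2] rho]; rewrite /stdize; mfun. Qed.

(** [stdize] is affine and triangular, so two one-dimensional substitutions suffice; their factors
    cancel the prefactor [J] of the density. *)
Lemma stdize_normal d (Omega : measurableType d) (P : probability Omega R)
    (X : Omega -> R * R) (th : param R) (A : set (mR R * mR R)) : param_space th ->
  has_density P (lebesgue_measure \x lebesgue_measure)%E X (binormal_pdf th) ->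
  measurable A -> P ((stdize th \o X) @^-1` A) = (N \x N)%E A.
Proof.
case: th => [[[[mu1 mu2] s1] s2] rho] [s10 s20 rho1] HX mA.
set th := (mu1, mu2, s1, s2, rho).
have r0 : 0 < Num.sqrt (1 - rho ^+ 2) by rewrite sqrtr_gt0 onem_sqr_gt0.
have mst := measurable_stdize th.
have mTA : measurable (stdize th @^-1` A : set (mR R * mR R)).
  by rewrite -[X in measurable X]setTI; exact: mst.
pose f (z : mR R * mR R) := (\1_A z * (normal_pdf 0 1 z.1 * normal_pdf 0 1 z.2))%:E : \bar R.
have mf : measurable_fun setT f.
  apply: measurable_EFin; apply: measurable_mul; first exact: measurable_indic.
  by apply: measurable_mul; apply: (measurableT_comp (measurable_normal_pdf _ _)); mfun.
have f0 z : (0 <= f z)%E by rewrite lee_fin !mulr_ge0 ?normal_pdf_ge0.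
pose J := (s1 * s2 * Num.sqrt (1 - rho ^+ 2))^-1.
have J0 : 0 < J by rewrite invr_gt0 !mulr_gt0.
transitivity (\int[leb]_u \int[leb]_v f (u, v))%E; last first.
  apply: etrans _ (esym (measure_integral_indic (N \x N)%E mA)).
  rewrite (fubini_tonelli1 (fun z : mR R * mR R => (\1_A z)%:E))//; last first.
    exact: measurable_eindic1.
  apply: etrans (esym (ge0_integral_normal2 (phi := fun z : mR R * mR R => (\1_A z)%:E) _ _)).
  - apply: eq_integral => u _; apply: eq_integral => v _.
    rewrite /f -EFinM !normal_pdf01; congr (_ * _)%:E.
    by rewrite mulrDl opprD expRD; ring.
  - by exact: measurable_eindic1.
  - by move=> z; rewrite lee_fin.
transitivity (\int[leb \x leb]_z (J%:E * f (stdize th z)))%E.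
  transitivity (\int[leb \x leb]_(z in stdize th @^-1` A) (binormal_pdf th z)%:E)%E.
    exact: HX.
  rewrite integral_indicE; apply: eq_integral => z _.
  rewrite -!EFinM binormal_pdfE// -/J; congr (_%:E).
  rewrite (_ : \1_(stdize th @^-1` A) z = \1_A (stdize th z))//; ring.
rewrite ge0_integralZl//; last 2 first.
- exact: (measurableT_comp mf mst).
- by rewrite lee_fin ltW.
rewrite (fubini_tonelli1 (fun z : mR R * mR R => f (stdize th z)))//; last first.
  exact: (measurableT_comp mf mst).
pose c2 := (s2 * Num.sqrt (1 - rho ^+ 2))^-1.
have c20 : 0 < c2 by rewrite invr_gt0 mulr_gt0.
have c10 : 0 < s1^-1 by rewrite invr_gt0.
transitivity (J%:E * \int[leb]_x (c2^-1%:E * \int[leb]_v f ((s1^-1 * x + - mu1 / s1)%R, v)))%E.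
  congr (_ * _)%E; apply: eq_integral => x _.
  have ms : measurable_fun setT (fun v => f (s1^-1 * x + - mu1 / s1, v)).
    exact: measurable_section1.
  have := ge0_integral_affine (- (mu2 / s2 + rho * ((x - mu1) / s1)) / Num.sqrt (1 - rho ^+ 2))
     (lt0r_neq0 c20) ms (fun=> f0 _).
  rewrite (gtr0_norm c20) => <-; apply: eq_integral => y _; rewrite /th /stdize/=.
  congr (f (_, _)); first by ring.
  by rewrite /c2; field; rewrite !gt_eqF.
have mi : measurable_fun setT (fun u => \int[leb]_v f (u, v))%E by exact: measurable_integral2.
have i0 u : (0 <= \int[leb]_v f (u, v))%E by exact: integral_ge0.
have H := ge0_integral_affine (- mu1 / s1) (lt0r_neq0 c10) mi i0.
transitivity (J%:E * (c2^-1%:E * \int[leb]_x \int[leb]_v f ((s1^-1 * x + - mu1 / s1)%R, v)))%E.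
  congr (_ * _)%E; apply: ge0_integralZl; first exact: measurableT.
  - by apply: (measurableT_comp mi); mfun.
  - by move=> x _; exact: i0.
  - by rewrite lee_fin invr_ge0 ltW.
rewrite H (gtr0_norm c10) !muleA -!EFinM invrK /J /c2.
rewrite [X in X%:E](_ : _ = 1) ?mul1e//.
by field; rewrite !gt_eqF.
Qed.

End standardization.

(** * Iterated integrals over subdomains, and gamma and Gaussian integrals *)

Section domain_iterated.
Context {d1 d2} {T1 : measurableType d1} {T2 : measurableType d2} {R : realType}.
Variables (D1 : set T1) (D2 : set T2).
Hypotheses (mD1 : measurable D1) (mD2 : measurable D2).

Lemma measurable_integral_dom (m2 : {sigma_finite_measure set T2 -> \bar R})
    (phi : T1 -> T2 -> \bar R) :
  measurable_fun setT (fun z : T1 * T2 => phi z.1 z.2) ->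
  (forall x y, (0 <= phi x y)%E) ->
  measurable_fun setT (fun x => \int[m2]_(y in D2) phi x y)%E.
Proof.
move=> mphi phi0; under eq_fun do rewrite integral_indicE.
apply: measurable_integral; last by move=> x y; rewrite mule_ge0// lee_fin.
apply: emeasurable_funM => //; apply: measurable_EFin.
by apply: measurable_indic_comp => //; mfun.
Qed.

Lemma tonelli_dom (m1 : {sigma_finite_measure set T1 -> \bar R})
    (m2 : {sigma_finite_measure set T2 -> \bar R}) (phi : T1 -> T2 -> \bar R) :
  measurable_fun setT (fun z : T1 * T2 => phi z.1 z.2) ->
  (forall x y, (0 <= phi x y)%E) ->
  (\int[m1]_(x in D1) \int[m2]_(y in D2) phi x y =
   \int[m2]_(y in D2) \int[m1]_(x in D1) phi x y)%E.
Proof.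
move=> mphi phi0.
pose psi x y := (phi x y * (\1_D1 x)%:E * (\1_D2 y)%:E)%E.
have m1x x : measurable_fun setT (phi x) by exact: (measurable_section1 x mphi).
have m2y y : measurable_fun setT (phi ^~ y) by exact: (measurable_section2 y mphi).
have i1 : measurable_fun setT (fun y => (\1_D2 y)%:E : \bar R).
  exact: measurable_eindic1.
have i2 : measurable_fun setT (fun x => (\1_D1 x)%:E : \bar R).
  exact: measurable_eindic1.
transitivity (\int[m1]_x \int[m2]_y psi x y)%E.
  rewrite integral_indicE; apply: eq_integral => x _.
  rewrite integral_indicE -ge0_integralZr//; last 2 first.
  - by apply: emeasurable_funM.
  - by move=> y _; rewrite mule_ge0// lee_fin.
  by apply: eq_integral => y _; rewrite /psi muleAC.
transitivity (\int[m2]_y \int[m1]_x psi x y)%E.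
  apply: tonelli; last by move=> x y; rewrite !mule_ge0// lee_fin.
  apply: emeasurable_funM; first apply: emeasurable_funM => //.
    by apply: measurable_eindic => //; mfun.
  by apply: measurable_eindic => //; mfun.
rewrite [RHS]integral_indicE; apply: eq_integral => y _.
rewrite [in RHS]integral_indicE -ge0_integralZr//; last by move=> x _; rewrite mule_ge0// lee_fin.
by apply: emeasurable_funM.
Qed.

End domain_iterated.

Lemma integral_gt0 d (T : measurableType d) (R : realType) (mu : {measure set T -> \bar R})
    (D : set T) (f : T -> \bar R) : measurable D -> measurable_fun D f ->
  (forall x, D x -> 0 < f x)%E -> mu D != 0%E -> (0 < \int[mu]_(x in D) f x)%E.
Proof.
move=> mD mf f0 muD; rewrite lt_neqAle integral_ge0 ?andbT; last by move=> x /f0/ltW.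
apply: contraNneq muD => if0.
have : (\int[mu]_(x in D) `|f x| = 0)%E.
  by rewrite [RHS]if0; apply: eq_integral => x /set_mem/f0/ltW/gee0_abs.
move/(ae_eq_integral_abs mu mD mf) => [N [mN N0 DN]].
apply/eqP; apply: (subset_measure0 mD mN) => // x Dx; apply: DN => /= /(_ Dx) fx.
by have := f0 _ Dx; rewrite fx ltxx.
Qed.

Section half_line.
Context {R : realType}.
Local Notation N := (@normal_prob R 0 1).
Local Notation pos := (`]0%R, +oo[%classic : set (mR R)).

Let mpos : measurable pos. Proof. exact: measurable_itv. Qed.

Lemma ge0_integral_inv (c : R) (f : mR R -> \bar R) : 0 < c ->
  measurable_fun setT f -> (forall y, (0 <= f y)%E) ->
  (\int[leb]_(s in pos) f (c * s^-1)%R = \int[leb]_(y in pos) (f y * (c * y ^- 2)%:E))%E.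
Proof.
move=> c0 mf f0.
(* The absolute value keeps the weight nonnegative on the whole line, as the substitution
   requires. *)
pose phi (y : mR R) := (f y * (c * `|y|^-1)%:E)%E.
have mphi : measurable_fun setT phi.
  apply: emeasurable_funM => //; apply: measurable_EFin; apply: measurable_mul; first by mfun.
  by apply: measurable_inv; exact: normr_measurable.
have phi0 y : (0 <= phi y)%E by rewrite mule_ge0// lee_fin mulr_ge0 ?invr_ge0// ltW.
have N10 : -1 != 0 :> R by rewrite oppr_eq0 oner_eq0.
have := ge0_integral_haar c0 N10 mphi phi0; rewrite normrN1 invr1 mul1e => H.
transitivity (\int[leb]_(x in pos) (phi (c * x `^ (-1))%R * (x^-1)%:E))%E.
  apply: eq_integral => s /set_mem/=; rewrite in_itv/= andbT => s0.
  rewrite powR_inv1 ?ltW// /phi gtr0_norm ?mulr_gt0 ?invr_gt0// -muleA -EFinM.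
  rewrite [X in X%:E](_ : _ = 1) ?mule1//.
  by field; rewrite !gt_eqF.
rewrite H; apply: eq_integral => s /set_mem/=; rewrite in_itv/= andbT => s0.
rewrite /phi gtr0_norm// -muleA -EFinM; congr (_ * _%:E)%E.
by field; rewrite gt_eqF.
Qed.

(** The integrand is at most [x^(p - 1)] on [(0, 1)]. Beyond 1 it is at most an unnormalized
    chi-squared density with an integer number [m.+1 >= 2 p] of degrees of freedom, integrable by
    [sumsq_density_ex]. *)
Lemma gamma_integral_finite (p : R) : 0 < p ->
  exists2 g : R, 0 < g &
  (\int[leb]_(x in pos) (x `^ p * expR (- (x / 2)) * x^-1)%:E = g%:E)%E.
Proof.
move=> p0; set I := (\int[leb]_(x in pos) _)%E.
have mf : measurable_fun setT (fun x : mR R => (x `^ p * expR (- (x / 2)) * x^-1)%:E).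
  by mfun.
have I0 : (0 < I)%E.
  apply: integral_gt0 => //.
  - exact: measurable_funTS.
  - move=> x /=; rewrite in_itv/= andbT => x0.
    by rewrite lte_fin mulr_gt0 ?invr_gt0// mulr_gt0 ?powR_gt0 ?expR_gt0.
  - by rewrite -[X in X != _]/(leb pos) lebesgue_measure_itv/= ltry.
suff Ifin : (I < +oo)%E.
  exists (fine I); first by apply: fine_gt0; rewrite I0 Ifin.
  by rewrite fineK// ge0_fin_numE// ltW.
pose m := Num.bound (2 * p).
have mp : p <= m.+1%:R / 2.
  rewrite ler_pdivlMr// mulrC ltW// (lt_le_trans (archi_boundP _))//.
  - by rewrite mulr_ge0// ltW.
  - by rewrite ler_nat.
(* The restriction to [x < 1] is written as a condition on [x^p], so that [f1] is a function of
   [x^p] times [1 / x] and the power substitution applies. *)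
pose f1 (x : mR R) : \bar R := ((x `^ p * \1_(`]0%R, 1%R[%classic : set (mR R)) (x `^ p)) * x^-1)%:E.
pose f2 (x : mR R) : \bar R := (x `^ (m.+1%:R / 2 - 1) * expR (- (x / 2)))%:E.
have m01 : measurable (`]0%R, 1%R[%classic : set (mR R)) by exact: measurable_itv.
have mf1 : measurable_fun setT f1.
  by rewrite /f1; mfun; apply: measurable_indic_comp => //; mfun.
have mf2 : measurable_fun setT f2 by rewrite /f2; mfun.
have f10 x : pos x -> (0 <= f1 x)%E.
  rewrite /= in_itv/= andbT => x0.
  by rewrite lee_fin !mulr_ge0 ?powR_ge0 ?invr_ge0// ltW.
have f20 x : pos x -> (0 <= f2 x)%E.
  by move=> _; rewrite lee_fin mulr_ge0 ?powR_ge0 ?expR_ge0.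
apply: (@le_lt_trans _ _ (\int[leb]_(x in pos) (f1 x + f2 x))%E).
  apply: ge0_le_integral => //.
  - move=> x /=; rewrite in_itv/= andbT => x0.
    by rewrite lee_fin !mulr_ge0 ?powR_ge0 ?expR_ge0 ?invr_ge0// ltW.
  - exact: measurable_funTS.
  - by apply: measurable_funTS; exact: emeasurable_funD.
  move=> x /=; rewrite in_itv/= andbT => x0.
  rewrite /f1 /f2 -EFinD lee_fin indicE.
  have [x1|x1] := ltP x 1.
    rewrite mem_set/=; last first.
      rewrite in_itv/= powR_gt0//=; have := gt0_ltr_powR p0 _ _ x1.
      by rewrite powR1; apply; rewrite nnegrE// ltW.
    rewrite mulr1 -[leLHS]addr0 lerD//; last by rewrite mulr_ge0 ?powR_ge0 ?expR_ge0.
    rewrite mulrAC ler_piMr ?mulr_ge0 ?powR_ge0 ?invr_ge0 ?(ltW x0)//.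
    by rewrite -[leRHS]expR0 ler_expR oppr_le0 divr_ge0// ltW.
  rewrite -[leLHS]add0r lerD//.
    by rewrite !mulr_ge0 ?powR_ge0 ?invr_ge0// ltW.
  rewrite mulrAC ler_wpM2r ?expR_ge0// powRB1// ler_wpM2r ?invr_ge0 ?(ltW x0)//.
  by rewrite ler_powR.
rewrite ge0_integralD//; last 2 first.
- exact: measurable_funTS.
- exact: measurable_funTS.
rewrite lte_add_pinfty//.
  pose phi (y : mR R) : \bar R := (`|y| * \1_(`]0%R, 1%R[%classic : set (mR R)) y)%:E.
  have mphi : measurable_fun setT phi.
    apply: measurable_EFin; apply: measurable_mul; last exact: measurable_indic.
    exact: normr_measurable.
  have phi0 y : (0 <= phi y)%E by rewrite lee_fin mulr_ge0.
  have H := ge0_integral_haar ltr01 (lt0r_neq0 p0) mphi phi0.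
  rewrite [X in (X < _)%E](_ : _ = (p^-1)%:E)%E ?ltry//.
  transitivity (\int[leb]_(x in pos) (phi (1 * x `^ p)%R * (x^-1)%:E))%E.
    by apply: eq_integral => x _; rewrite /phi mul1r ger0_norm ?powR_ge0// -EFinM.
  rewrite H gtr0_norm// -[RHS]mule1; congr (_ * _)%E.
  transitivity (\int[leb]_(x in (`]0%R, 1%R[%classic : set (mR R))) cst (1 : \bar R) x)%E.
    rewrite [LHS]integral_indicE [RHS]integral_indicE; apply: eq_integral => x _.
    rewrite /phi /cst mul1e -!EFinM !indicE; congr (_%:E).
    case: (boolP (x \in `]0%R, 1%R[%classic)) => [/set_mem/=|_]; last by rewrite !mulr0 !mul0r.
    rewrite in_itv/= => /andP[x0 x1]; rewrite mem_set/= ?in_itv/= ?x0// gtr0_norm//.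
    by rewrite !mulr1 mulfV// gt_eqF.
  rewrite integral_cst// mul1e -[LHS]/(leb `]0%R, 1%R[%classic) lebesgue_measure_itv/=.
  by rewrite lte_fin ltr01 oppr0 adde0.
have [K K0 KE] := @sumsq_density_ex R m.
have := KE (cst 1%E) (measurable_cst _) (fun=> lee01).
rewrite integral_prob1.
have -> : (\int[leb]_(x in pos) (cst 1%E x * (K * (x `^ (m.+1%:R / 2 - 1) * expR (- (x / 2))))%:E) =
    K%:E * \int[leb]_(x in pos) f2 x)%E.
  rewrite -ge0_integralZl//.
  - by apply: eq_integral => x _; rewrite mul1e -EFinM.
  - exact: measurable_funTS.
  - by rewrite lee_fin ltW.
case: (\int[leb]_(x in pos) f2 x)%E => [r|//|]; rewrite ?ltry//.
by rewrite gt0_muley.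
Qed.

Lemma gauss_integral_affine (t al be : R) : 0 < t -> al != 0 ->
  (\int[leb]_y (expR (- (t * (al * y + be) ^+ 2 / 2)))%:E =
   ((Num.sqrt t * normal_peak 1 * `|al|)^-1)%:E)%E.
Proof.
move=> t0 al0.
have st : 0 < Num.sqrt t by rewrite sqrtr_gt0.
have P0 : 0 < normal_peak 1 :> R by rewrite normal_peak_gt0 ?oner_eq0.
have sal : Num.sqrt t * al != 0 by rewrite mulf_neq0// gt_eqF.
have mN : measurable_fun setT (fun y : mR R => (normal_pdf 0 1 y)%:E).
  by apply: measurable_EFin; exact: measurable_normal_pdf.
have N0 y : (0 <= (normal_pdf 0 1 y : R)%:E)%E by rewrite lee_fin normal_pdf_ge0.
have := ge0_integral_affine (Num.sqrt t * be) sal mN N0.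
rewrite integral_normal_pdf mule1 => H.
transitivity (\int[leb]_y (((normal_peak 1)^-1)%:E *
   (normal_pdf 0 1 (Num.sqrt t * al * y + Num.sqrt t * be)%R)%:E))%E.
  apply: eq_integral => y _; rewrite normal_pdf01 -EFinM mulKf ?gt_eqF//.
  congr (expR (- _))%:E; rewrite -[t in LHS](sqr_sqrtr (ltW t0)); ring.
rewrite ge0_integralZl//; last 2 first.
- by apply: (measurableT_comp mN); mfun.
- by rewrite lee_fin invr_ge0 ltW.
rewrite H -EFinM normrM (gtr0_norm st); congr (_%:E).
by field; rewrite !gt_eqF// normr_gt0.
Qed.

End half_line.

Section posterior_coordinates.
Context {R : realType}.
Local Notation N := (@normal_prob R 0 1).
Local Notation pos := (`]0%R, +oo[%classic : set (mR R)).
Local Notation unit_itv := (`](-1)%R, 1%R[%classic : set (mR R)).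

(* Coordinates [y1 = 1 / s1], [y2 = 1 / (s2 sqrt (1 - rho^2))], [y3 = eta3] make
   the normal likelihood a Gaussian in [(mu1, mu2, y3)]. *)
Lemma posterior_change_of_variables (Phi : mR R -> mR R -> mR R -> \bar R) :
  measurable_fun setT (fun z : mR R * mR R * mR R => Phi z.1.1 z.1.2 z.2) ->
  (forall x y z, (0 <= Phi x y z)%E) ->
  (\int[leb]_(rho in unit_itv) \int[leb]_(s2 in pos) \int[leb]_(s1 in pos)
     (Phi s1^-1%R (s2 * Num.sqrt (1 - rho ^+ 2))^-1%R
        (- (rho / (s1 * Num.sqrt (1 - rho ^+ 2))))%R *
      (Num.sqrt (1 - rho ^+ 2) ^- 2)%:E) =
   \int[leb]_(y1 in pos) \int[leb]_(y2 in pos)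
     ((y1 ^- 3 * y2 ^- 2)%:E * \int[leb]_y3 Phi y1 y2 y3))%E.
Proof.
move=> mPhi Phi0.
have mcomp d (T : measurableType d) (f g h : T -> mR R) : measurable_fun setT f ->
    measurable_fun setT g -> measurable_fun setT h ->
    measurable_fun setT (fun t => Phi (f t) (g t) (h t)).
  move=> mf mg mh; apply: (measurableT_comp mPhi (g := fun t => (f t, g t, h t))).
  by apply: measurable_tuple2 => //; exact: measurable_tuple2.
have mpos : measurable pos by exact: measurable_itv.
have munit : measurable unit_itv by exact: measurable_itv.
pose r (rho : mR R) : mR R := Num.sqrt (1 - rho ^+ 2).
have mr : measurable_fun setT r by rewrite /r; mfun.
have mrr : measurable_fun setT (@rho_ratio R : mR R -> mR R) by rewrite /rho_ratio; mfun.
(* Once [s1] and [s2] are replaced, [eta3] is [- y1 * rho_ratio rho]. The factor [r rho ^- 3], from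
   the given [r^-2] and the substitution [s2 = 1 / (r y2)], is exactly the Jacobian of
   [rho_ratio]. *)
pose Psi (rho y1 y2 : mR R) := (Phi y1 y2 (- y1 * rho_ratio rho)%R *
   (r rho ^- 3 * (y1 ^- 2 * y2 ^- 2))%:E)%E.
have yge (y : R) : 0 <= y ^- 2 by rewrite invr_ge0 sqr_ge0.
have rge rho k : 0 <= r rho ^- k by rewrite invr_ge0 exprn_ge0// sqrtr_ge0.
have Psi0 x y z : (0 <= Psi x y z)%E by rewrite mule_ge0// lee_fin mulr_ge0// mulr_ge0.
have mPsi d (T : measurableType d) (f g h : T -> mR R) : measurable_fun setT f ->
    measurable_fun setT g -> measurable_fun setT h ->
    measurable_fun setT (fun t => Psi (f t) (g t) (h t)).
  move=> mf mg mh; apply: emeasurable_funM.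
    apply: mcomp => //; apply: measurable_mul; first by mfun.
    exact: (measurableT_comp mrr).
  apply: measurable_EFin; apply: measurable_mul; last by mfun.
  by apply: measurable_inv; apply: measurable_funX; exact: (measurableT_comp mr).
transitivity (\int[leb]_(rho in unit_itv) \int[leb]_(y2 in pos) \int[leb]_(y1 in pos)
    Psi rho y1 y2)%E.
  apply: eq_integral => rho /set_mem /=; rewrite in_itv/= => /onem_sqr_gt0 rho1.
  have r0 : 0 < r rho by rewrite sqrtr_gt0.
  pose G (y2 : mR R) := (\int[leb]_(y1 in pos)
    (Phi y1 y2 (- y1 * rho_ratio rho)%R * (r rho ^- 2 * y1 ^- 2)%:E))%E.
  have mG0 : measurable_fun setT (fun z : mR R * mR R =>
      (Phi z.2 z.1 (- z.2 * rho_ratio rho)%R * (r rho ^- 2 * z.2 ^- 2)%:E)%E).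
    by apply: emeasurable_funM; [apply: mcomp; mfun|mfun].
  have G00 y1 y2 : (0 <= Phi y1 y2 (- y1 * rho_ratio rho)%R * (r rho ^- 2 * y1 ^- 2)%:E)%E.
    by rewrite mule_ge0// lee_fin mulr_ge0.
  have mG : measurable_fun setT G.
    exact: (measurable_integral_dom mpos leb mG0).
  have G0 y : (0 <= G y)%E by exact: integral_ge0.
  transitivity (\int[leb]_(s2 in pos) G ((r rho)^-1 * s2^-1)%R)%E.
    apply: eq_integral => s2 _.
    pose g (y1 : mR R) := (Phi y1 ((r rho)^-1 * s2^-1)%R (- y1 * rho_ratio rho)%R *
      (r rho ^- 2)%:E)%E.
    have mg : measurable_fun setT g by apply: emeasurable_funM; [apply: mcomp; mfun|mfun].
    have g0 y : (0 <= g y)%E by rewrite mule_ge0// lee_fin.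
    transitivity (\int[leb]_(s1 in pos) g (1 * s1^-1)%R)%E.
      apply: eq_integral => s1 _; rewrite /g mul1r -/(r rho); congr (Phi _ _ _ * _)%E.
        by rewrite invfM mulrC.
      by rewrite /rho_ratio -/(r rho) invfM; ring.
    rewrite (ge0_integral_inv ltr01 mg g0); apply: eq_integral => y1 _.
    by rewrite /g -muleA -EFinM mul1r.
  have ri0 : 0 < (r rho)^-1 by rewrite invr_gt0.
  rewrite (ge0_integral_inv ri0 mG G0); apply: eq_integral => y2 _.
  rewrite /G -ge0_integralZr//; last 2 first.
  - by apply: measurable_funTS; apply: (measurable_section1 y2 mG0).
  - by rewrite lee_fin mulr_ge0// ltW.
  apply: eq_integral => y1 _; rewrite /Psi -muleA -EFinM; congr (_ * _%:E)%E.
  have -> : r rho ^- 3 = (r rho)^-1 * r rho ^- 2 by rewrite [_ ^+ 3]exprS invfM.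
  by rewrite mulrACA [r rho ^- 2 * _]mulrC mulrA.
transitivity (\int[leb]_(y1 in pos) \int[leb]_(y2 in pos) \int[leb]_(rho in unit_itv)
    Psi rho y1 y2)%E.
  transitivity (\int[leb]_(rho in unit_itv) \int[leb]_(y1 in pos) \int[leb]_(y2 in pos)
    Psi rho y1 y2)%E.
    apply: eq_integral => rho _; apply: tonelli_dom => //.
    by apply: mPsi; mfun.
  etransitivity.
    apply: tonelli_dom => //.
      apply: measurable_integral_dom => //.
      by apply: mPsi; mfun.
    by move=> x y; apply: integral_ge0.
  apply: eq_integral => y1 _; apply: tonelli_dom => //.
  by apply: mPsi; mfun.
apply: eq_integral => y1 /set_mem /=; rewrite in_itv/= andbT => y10.
apply: eq_integral => y2 _.
pose g (x : mR R) := (Phi y1 y2 (- y1 * x)%R * (y1 ^- 2 * y2 ^- 2)%:E)%E.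
have mg : measurable_fun setT g by apply: emeasurable_funM; [apply: mcomp; mfun|mfun].
have g0 y : (0 <= g y)%E by rewrite mule_ge0// lee_fin mulr_ge0.
transitivity (\int[leb]_(rho in unit_itv) (g (rho_ratio rho) *
   ((Num.sqrt (1 - rho ^+ 2)) ^+ 3)^-1%:E))%E.
  apply: eq_integral => rho _; rewrite /Psi /g -muleA -EFinM; congr (_ * _%:E)%E.
  by rewrite mulrC.
rewrite (ge0_integral_rho_ratio mg g0).
have mP : measurable_fun setT (Phi y1 y2) by apply: (mcomp _ _ (cst y1) (cst y2) id).
have Ny1 : - y1 != 0 by rewrite oppr_eq0 gt_eqF.
have := ge0_integral_affine 0 Ny1 mP (Phi0 _ _); rewrite normrN gtr0_norm// => H.
transitivity ((y1 ^- 2 * y2 ^- 2)%:E * \int[leb]_x Phi y1 y2 (- y1 * x + 0)%R)%E.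
  rewrite -ge0_integralZl//; last 2 first.
  - by apply: mcomp; mfun.
  - by rewrite lee_fin mulr_ge0.
  by apply: eq_integral => x _; rewrite /g addr0 muleC.
rewrite H muleA -EFinM; congr (_%:E * _)%E.
have -> : y1 ^- 3 = y1^-1 * y1 ^- 2 by rewrite [_ ^+ 3]exprS invfM.
by rewrite mulrC mulrA.
Qed.

End posterior_coordinates.

(** * Sample moments and the likelihood *)

Section sample_moments.
Context {R : realType}.
Variables (n : nat) (x : 'I_n -> R * R).

Definition mean1 : R := (\sum_k (x k).1) / n%:R.
Definition mean2 : R := (\sum_k (x k).2) / n%:R.
Definition ss11 : R := \sum_k ((x k).1 - mean1) ^+ 2.
Definition ss12 : R := \sum_k ((x k).1 - mean1) * ((x k).2 - mean2).
Definition ss22 : R := \sum_k ((x k).2 - mean2) ^+ 2.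

(** Expansion about the means; the cross terms vanish because deviations sum to zero. *)
Lemma sum_sqr_shift (a b c : R) : (0 < n)%N ->
  \sum_k (a * (x k).1 + b * (x k).2 - c) ^+ 2 =
  a ^+ 2 * ss11 + 2 * a * b * ss12 + b ^+ 2 * ss22 +
  n%:R * (a * mean1 + b * mean2 - c) ^+ 2.
Proof.
move=> n0; have n0' : n%:R != 0 :> R by rewrite pnatr_eq0 -lt0n.
have s1 : \sum_k ((x k).1 - mean1) = 0.
  by rewrite big_split/= sumr_const card_ord mulNrn -[_ *+ n]mulr_natr divfK// subrr.
have s2 : \sum_k ((x k).2 - mean2) = 0.
  by rewrite big_split/= sumr_const card_ord mulNrn -[_ *+ n]mulr_natr divfK// subrr.
set t := a * mean1 + b * mean2 - c.
transitivity (\sum_k (a ^+ 2 * ((x k).1 - mean1) ^+ 2 +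
  (2 * a * b * (((x k).1 - mean1) * ((x k).2 - mean2)) +
  (b ^+ 2 * ((x k).2 - mean2) ^+ 2 +
  (2 * t * a * ((x k).1 - mean1) + (2 * t * b * ((x k).2 - mean2) + t ^+ 2)))))).
  by apply: eq_bigr => k _; rewrite /t; ring.
rewrite !big_split/= -!mulr_sumr s1 s2 !mulr0 sumr_const card_ord -mulr_natl.
by rewrite -/ss11 -/ss12 -/ss22; ring.
Qed.

Lemma likelihoodE (mu1 mu2 s1 s2 rho : R) : (0 < n)%N ->
  0 < s1 -> 0 < s2 -> -1 < rho < 1 ->
  let y1 := s1^-1 in let y2 := (s2 * Num.sqrt (1 - rho ^+ 2))^-1 in
  let y3 := - (rho / (s1 * Num.sqrt (1 - rho ^+ 2))) in
  likelihood x (mu1, mu2, s1, s2, rho) = (y1 * y2 * normal_peak 1 ^+ 2) ^+ n *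
    (expR (- ((y1 ^+ 2 * ss11 + (y3 ^+ 2 * ss11 + 2 * y3 * y2 * ss12 + y2 ^+ 2 * ss22)) / 2)) *
     expR (- (n%:R * (- y1 * mu1 + y1 * mean1) ^+ 2 / 2)) *
     expR (- (n%:R * (- y2 * mu2 + (y3 * (mean1 - mu1) + y2 * mean2)) ^+ 2 / 2))).
Proof.
move=> n0 s10 s20 rho1 y1 y2 y3; rewrite /likelihood.
have r0 : 0 < Num.sqrt (1 - rho ^+ 2) by rewrite sqrtr_gt0 onem_sqr_gt0.
(* Both standardized coordinates are affine in the observation, with coefficients [(y1, 0)] and
   [(y3, y2)], so [sum_sqr_shift] will apply to each. *)
transitivity (\prod_(k < n) (y1 * y2 * normal_peak 1 ^+ 2 *
  expR (- ((y1 * (x k).1 + 0 * (x k).2 - y1 * mu1) ^+ 2 / 2 +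
     (y3 * (x k).1 + y2 * (x k).2 - (y3 * mu1 + y2 * mu2)) ^+ 2 / 2)))).
  apply: eq_bigr => k _; rewrite binormal_pdfE// !normal_pdf01/=.
  set e1 := expR _; set e2 := expR _.
  transitivity (y1 * y2 * normal_peak 1 ^+ 2 * (e1 * e2)).
    by rewrite /y1 /y2 -mulrA invfM; ring.
  have E1 : y1 * (x k).1 + 0 * (x k).2 - y1 * mu1 = (stdize (mu1, mu2, s1, s2, rho) (x k)).1.
    by rewrite /y1 /=; ring.
  have E2 : y3 * (x k).1 + y2 * (x k).2 - (y3 * mu1 + y2 * mu2) =
      (stdize (mu1, mu2, s1, s2, rho) (x k)).2.
    by rewrite /y2 /y3 /=; field; rewrite !gt_eqF.
  by rewrite E1 E2 /e1 /e2 -expRD -opprD.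
rewrite big_split/= prodr_const card_ord; congr (_ * _).
rewrite -expR_sum sumrN big_split/= -!mulr_suml !sum_sqr_shift// -!expRD.
by congr expR; rewrite expr0n/=; field.
Qed.

End sample_moments.

Section product_sigma_finite.
Context {R : realType} d1 d2 (T1 : measurableType d1) (T2 : measurableType d2)
  (m1 : {sigma_finite_measure set T1 -> \bar R})
  (m2 : {sigma_finite_measure set T2 -> \bar R}).

(* An alias of [m1 \x m2]: the library infers a sigma-finite structure on the
   latter only when [m1] and [m2] are probabilities. *)
Definition sigma_finite_product : set (T1 * T2) -> \bar R := (m1 \x m2)%E.

HB.instance Definition _ := Measure.copy sigma_finite_product (m1 \x m2)%E.

Lemma sigma_finite_productP : sigma_finite setT sigma_finite_product.
Proof.
have [F UF mF] := sigma_finiteT m1; have [G UG mG] := sigma_finiteT m2.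
exists (fun k => if unpickle k is Some ij then F ij.1 `*` G ij.2 else set0).
  apply/esym/seteqP; split=> // -[x y] _.
  have [i _ Fx] : (\bigcup_i F i) x by rewrite -UF.
  have [j _ Gy] : (\bigcup_i G i) y by rewrite -UG.
  by exists (pickle (i, j)) => //; rewrite pickleK.
move=> k; case: unpickle => [[i j]|]; last by rewrite measure0.
have [? ?] := mF i; have [? ?] := mG j; split; first exact: measurableX.
by rewrite [X in (X < _)%E]product_measure1E// lte_mul_pinfty// ge0_fin_numE.
Qed.

HB.instance Definition _ := Measure_isSigmaFinite.Build _ _ _ sigma_finite_product
  sigma_finite_productP.

Lemma integral_sigma_finite_product (phi : T1 * T2 -> \bar R) :
  measurable_fun setT phi -> (forall z, (0 <= phi z)%E) ->
  (\int[sigma_finite_product]_z phi z = \int[m2]_y \int[m1]_x phi (x, y))%E.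
Proof. by move=> mphi phi0; exact: fubini_tonelli2. Qed.

End product_sigma_finite.

Section fubini5.
Context {R : realType} d1 d2 d3 d4 d5 (T1 : measurableType d1) (T2 : measurableType d2)
  (T3 : measurableType d3) (T4 : measurableType d4) (T5 : measurableType d5)
  (m1 : {sigma_finite_measure set T1 -> \bar R})
  (m2 : {sigma_finite_measure set T2 -> \bar R})
  (m3 : {sigma_finite_measure set T3 -> \bar R})
  (m4 : {sigma_finite_measure set T4 -> \bar R})
  (m5 : {sigma_finite_measure set T5 -> \bar R}).

Lemma integral_prod5 (H : T1 * T2 * T3 * T4 * T5 -> \bar R) :
  measurable_fun setT H -> (forall th, (0 <= H th)%E) ->
  (\int[m1 \x m2 \x m3 \x m4 \x m5]_th H th =
   \int[m5]_x5 \int[m4]_x4 \int[m3]_x3 \int[m1]_x1 \int[m2]_x2 H (x1, x2, x3, x4, x5))%E.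
Proof.
move=> mH H0.
pose m12 := sigma_finite_product m1 m2; pose m123 := sigma_finite_product m12 m3.
pose m1234 := sigma_finite_product m123 m4.
apply: etrans (integral_sigma_finite_product m1234 m5 mH H0) _.
apply: eq_integral => x5 _.
have mH5 : measurable_fun setT (fun z => H (z, x5)) by exact: measurable_section2.
apply: etrans (integral_sigma_finite_product m123 m4 mH5 (fun=> H0 _)) _.
apply: eq_integral => x4 _.
have mH4 : measurable_fun setT (fun z => H (z, x4, x5)).
  exact: (measurable_section2 x4 mH5).
apply: etrans (integral_sigma_finite_product m12 m3 mH4 (fun=> H0 _)) _.
apply: eq_integral => x3 _.
have mH3 : measurable_fun setT (fun z => H (z, x3, x4, x5)).
  exact: (measurable_section2 x3 mH4).
exact: (fubini_tonelli1 _ mH3 (fun=> H0 _)).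
Qed.

End fubini5.

Lemma lebesgue5_tonelli {R : realType} (h : param R -> R) :
  measurable_fun setT (h : mR5 R -> R) ->
  (forall th, 0 <= h th) ->
  (\int[@lebesgue5 R]_th (h th)%:E = \int[leb]_rho \int[leb]_s2 \int[leb]_s1
     \int[leb]_mu1 \int[leb]_mu2 (h (mu1, mu2, s1, s2, rho))%:E)%E.
Proof.
move=> mh h0.
pose H (th : mR5 R) : \bar R := (h th)%:E.
have mH : measurable_fun setT H by exact: measurable_EFin.
have H0 th : (0 <= H th)%E by rewrite lee_fin.
exact: (integral_prod5 leb leb leb leb leb mH H0).
Qed.

(** * The radial and Gaussian integrals of the posterior *)

Section gamma_polar.
Context {R : realType}.
Local Notation pos := (`]0%R, +oo[%classic : set (mR R)).

Lemma ge0_integral_gamma_sqr (q m : R) (psi : mR R -> \bar R) : 0 < q ->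
  measurable_fun setT psi -> (forall x, (0 <= psi x)%E) ->
  (\int[leb]_(y in pos) (psi (q * y ^+ 2)%R *
     (y `^ m * expR (- (q * y ^+ 2 / 2)) * y^-1)%:E) =
   (q `^ (m / 2) * 2)^-1%:E * \int[leb]_(x in pos)
     (psi x * (x `^ (m / 2) * expR (- (x / 2)) * x^-1)%:E))%E.
Proof.
move=> q0 mpsi psi0.
pose phi (x : mR R) := (psi x * (x `^ (m / 2) * expR (- (x / 2)))%:E)%E.
have mphi : measurable_fun setT phi by apply: emeasurable_funM => //; mfun.
have phi0 x : (0 <= phi x)%E by rewrite mule_ge0// lee_fin mulr_ge0 ?powR_ge0 ?expR_ge0.
have two0 : (2 : R) != 0 by [].
have H := ge0_integral_haar q0 two0 mphi phi0.
have qm0 : 0 < q `^ (m / 2) by rewrite powR_gt0.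
transitivity ((q `^ (m / 2))^-1%:E *
    \int[leb]_(x in pos) (phi (q * x `^ 2)%R * x^-1%:E))%E.
  rewrite -ge0_integralZl//; last 3 first.
  - apply: measurable_funTS; apply: emeasurable_funM; last by mfun.
    by apply: (measurableT_comp mphi); mfun.
  - by move=> x /=; rewrite in_itv/= andbT => x0; rewrite mule_ge0// lee_fin invr_ge0 ltW.
  - by rewrite lee_fin invr_ge0 ltW.
  apply: eq_integral => y /set_mem /=; rewrite in_itv/= andbT => y0.
  have y22 : y `^ 2 = y ^+ 2 by rewrite powR_mulrn// ltW.
  rewrite /phi y22 [RHS]muleC -!muleA -!EFinM; congr (_ * _%:E)%E.
  rewrite powRM ?sqr_ge0 ?ltW// -y22 -powRrM [2 * _]mulrC divfK// y22.
  by field; rewrite !gt_eqF.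
rewrite H muleA; congr (_ * _)%E.
  by rewrite -EFinM gtr0_norm// invfM.
by apply: eq_integral => x _; rewrite /phi -muleA -EFinM.
Qed.

Lemma gamma_sqr_finite (s p : R) : 0 < s -> 0 < p ->
  exists2 g : R, 0 < g &
  (\int[leb]_(y in pos) (y `^ p * expR (- (s * y ^+ 2 / 2)) * y^-1)%:E = g%:E)%E.
Proof.
move=> s0 p0; have p20 : 0 < p / 2 by rewrite divr_gt0.
have [g g0 gE] := gamma_integral_finite p20.
exists ((s `^ (p / 2) * 2)^-1 * g); first by rewrite mulr_gt0// invr_gt0 mulr_gt0// powR_gt0.
have H := @ge0_integral_gamma_sqr s p (cst 1%E) s0 (measurable_cst _) (fun=> lee01).
transitivity ((s `^ (p / 2) * 2)^-1%:E * g%:E)%E; last by [].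
rewrite -gE; under [in RHS]eq_integral do rewrite -[_%:E]mul1e.
by rewrite -H; apply: eq_integral => y _; rewrite mul1e.
Qed.

(** If [y] has density proportional to [y^(m - 1) exp (- q y^2 / 2)], then [q y^2] is chi-squared
    with [m] degrees of freedom; this is how [y2] occurs in the posterior. *)
Lemma chi2_integral_sqr (nu : law R) (q m : R) : 0 < q ->
  chi2_law nu m -> exists2 K : R, 0 < K &
  forall psi : mR R -> \bar R, measurable_fun setT psi -> (forall x, (0 <= psi x)%E) ->
  (\int[leb]_(y in pos) (psi (q * y ^+ 2)%R *
     (y `^ m * expR (- (q * y ^+ 2 / 2)) * y^-1)%:E) = K%:E * \int[nu]_x psi x)%E.
Proof.
move=> q0 /chi2_density_ex[k k0 nuE].
have c0 : 0 < (q `^ (m / 2) * 2)^-1 by rewrite invr_gt0 mulr_gt0// powR_gt0.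
exists ((q `^ (m / 2) * 2)^-1 * k^-1) => [|psi mpsi psi0].
  by rewrite mulr_gt0// invr_gt0.
rewrite ge0_integral_gamma_sqr// (nuE psi mpsi psi0) EFinM -muleA; congr (_ * _)%E.
rewrite -ge0_integralZl//; last 3 first.
- by apply: measurable_funTS; apply: emeasurable_funM => //; mfun.
- by move=> x _; rewrite mule_ge0// lee_fin mulr_ge0 ?mulr_ge0 ?powR_ge0 ?expR_ge0// ltW.
- by rewrite lee_fin invr_ge0 ltW.
apply: eq_integral => x /set_mem /=; rewrite in_itv/= andbT => x0.
rewrite muleCA -EFinM; congr (_ * _%:E)%E.
rewrite powRB1//.
by field; rewrite !gt_eqF.
Qed.

End gamma_polar.

Section gauss_section.
Context {R : realType}.
Local Notation N := (@normal_prob R 0 1).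
Variables (s t u : R).
Hypotheses (s0 : 0 < s) (D0 : 0 < s * u - t ^+ 2).
Let V := t / Num.sqrt (s * u - t ^+ 2).

(** Completing the square: [s x^2 + 2 x y t + u y^2 = (sqrt s x + y t / sqrt s)^2 + (s u - t^2) / s
    * y^2]. With [c = (s u - t^2) / s * y^2], the shift [y t / sqrt s] equals [sqrt c V]. *)
Lemma gauss_section_integral (B : set (mR R)) (y : R) : measurable B -> 0 < y ->
  (\int[leb]_x (\1_B x * expR (- ((x ^+ 2 * s + 2 * x * y * t + y ^+ 2 * u) / 2)))%:E =
   ((Num.sqrt s * normal_peak 1)^-1 *
     expR (- ((s * u - t ^+ 2) / s * y ^+ 2 / 2)))%:E *
   \int[N]_z (\1_B ((z - Num.sqrt ((s * u - t ^+ 2) / s * y ^+ 2) * V) / Num.sqrt s))%:E)%E.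
Proof.
move=> mB y0.
have sq0 : 0 < Num.sqrt s by rewrite sqrtr_gt0.
have sqs : Num.sqrt s ^+ 2 = s by rewrite sqr_sqrtr// ltW.
have Dq0 : 0 < Num.sqrt (s * u - t ^+ 2) by rewrite sqrtr_gt0.
have P0 : 0 < normal_peak 1 :> R by rewrite normal_peak_gt0 ?oner_eq0.
pose be := y * t / Num.sqrt s.
have -> : Num.sqrt ((s * u - t ^+ 2) / s * y ^+ 2) * V = be.
  rewrite sqrtrM ?divr_ge0 ?ltW// sqrtr_sqr gtr0_norm// sqrtrM ?ltW// sqrtrV ?ltW//.
  by rewrite /V /be; field; rewrite !gt_eqF.
have mB' : measurable_fun setT (fun z : mR R => (\1_B ((z - be) / Num.sqrt s))%:E : \bar R).
  by apply: measurable_eindic => //; mfun.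
rewrite (ge0_integral_normal mB') => [|z]; last by rewrite lee_fin.
pose phi (z : mR R) : \bar R :=
  ((\1_B ((z - be) / Num.sqrt s))%:E * (normal_pdf 0 1 z)%:E)%E.
have mphi : measurable_fun setT phi.
  apply: emeasurable_funM => //; apply: measurable_EFin; exact: measurable_normal_pdf.
have phi0 z : (0 <= phi z)%E by rewrite mule_ge0// lee_fin normal_pdf_ge0.
have H := ge0_integral_affine be (lt0r_neq0 sq0) mphi phi0.
rewrite gtr0_norm// in H.
transitivity (((Num.sqrt s * normal_peak 1)^-1 *
     expR (- ((s * u - t ^+ 2) / s * y ^+ 2 / 2)))%:E * (Num.sqrt s)%:E *
     \int[leb]_x phi (Num.sqrt s * x + be)%R)%E; last first.
  by rewrite H -muleA [((Num.sqrt s)%:E * _)%E]muleA -EFinM divff ?gt_eqF// mul1e.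
rewrite -EFinM -ge0_integralZl//; last 2 first.
- by apply: (measurableT_comp mphi); mfun.
- by rewrite lee_fin !mulr_ge0 ?invr_ge0 ?mulr_ge0 ?expR_ge0 ?ltW.
apply: eq_integral => x _; rewrite /phi addrK [Num.sqrt s * x]mulrC mulfK ?gt_eqF//.
rewrite -!EFinM; congr _%:E.
rewrite mulrCA; congr (_ * _).
rewrite normal_pdf01.
transitivity (expR (- ((s * u - t ^+ 2) / s * y ^+ 2 / 2)) *
   expR (- ((x * Num.sqrt s + be) ^+ 2 / 2))); last first.
  by field; rewrite !gt_eqF.
rewrite -expRD -opprD; congr (expR (- _)).
rewrite sqrrD exprMn sqs /be exprMn exprVn sqs.
by field; rewrite !gt_eqF.
Qed.

End gauss_section.

Lemma eta3E {R : realType} : @eta3 R = fun th : mR5 R =>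
    - (th.2 / (th.1.1.2 * Num.sqrt (1 - th.2 ^+ 2))).
Proof. by apply/funext => -[[[[? ?] ?] ?] ?]. Qed.

Lemma measurable_eta3 {R : realType} :
  measurable_fun setT (@eta3 R : mR5 R -> R).
Proof. by rewrite eta3E; mfun. Qed.

(** Two normal peaks per observation, divided by the constants of the two Gaussian integrals over
    the means. *)
Definition polar_const (R : realType) (n : nat) : R :=
  normal_peak 1 ^+ 2 ^+ n * (n%:R * normal_peak 1 ^+ 2)^-1.

(* What remains of likelihood times prior after integrating out the means, in
   the coordinates of [posterior_change_of_variables]. *)
Definition polar_density (R : realType) (n : nat) (a b s t u : R) (B : set (mR R))
    (y1 y2 y3 : mR R) : \bar R :=
  (\1_B y3 * (polar_const R n * y1 `^ (n%:R + 2 - a) * y2 `^ (n%:R + 1 - b) *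
   (expR (- (s * y1 ^+ 2 / 2)) *
    expR (- ((y3 ^+ 2 * s + 2 * y3 * y2 * t + y2 ^+ 2 * u) / 2)))))%:E.

(** * The posterior mass of events on eta3 *)

Section posterior_mass.
Context {R : realType}.
Local Notation N := (@normal_prob R 0 1).
Local Notation pos := (`]0%R, +oo[%classic : set (mR R)).
Local Notation unit_itv := (`](-1)%R, 1%R[%classic : set (mR R)).
Variables (n : nat) (a b : R) (x : 'I_n -> R * R).
Hypothesis n0 : (0 < n)%N.

Local Notation s := (ss11 x).
Local Notation t := (ss12 x).
Local Notation u := (ss22 x).
Local Notation C0 := (polar_const R n).
Local Notation Phi := (polar_density n a b s t u).

(** The closed form of [likelihoodE] taken for all parameter tuples: it is visibly measurable and
    agrees with [likelihood] on the parameter space. *)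
Definition gaussian_likelihood (th : param R) : R :=
  let: (mu1, mu2, s1, s2, rho) := th in
  let y1 := s1^-1 in let y2 := (s2 * Num.sqrt (1 - rho ^+ 2))^-1 in
  let y3 := - (rho / (s1 * Num.sqrt (1 - rho ^+ 2))) in
  (y1 * y2 * normal_peak 1 ^+ 2) ^+ n *
    (expR (- ((y1 ^+ 2 * s + (y3 ^+ 2 * s + 2 * y3 * y2 * t + y2 ^+ 2 * u)) / 2)) *
     expR (- (n%:R * (- y1 * mu1 + y1 * mean1 x) ^+ 2 / 2)) *
     expR (- (n%:R * (- y2 * mu2 + (y3 * (mean1 x - mu1) + y2 * mean2 x)) ^+ 2 / 2))).

Definition posterior_density (B : set (mR R)) (th : param R) : R :=
  gaussian_likelihood th * prior a b th *
  (\1_pos th.1.1.2 * \1_pos th.1.2 * \1_unit_itv th.2) * \1_B (eta3 th).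

Lemma natr_bool3_eq0 (p q r : bool) : ~~ (p && q && r) ->
  p%:R * q%:R * r%:R = 0 :> R.
Proof. by case: p; case: q; case: r => //= _; rewrite !(mul0r, mulr0). Qed.

Lemma powR_addn (y p : R) (k : nat) : 0 < y -> y `^ (p + k%:R) = y `^ p * y ^+ k.
Proof.
move=> y0; rewrite powRD; last by apply/implyP => _; rewrite gt_eqF.
by rewrite powR_mulrn// ltW.
Qed.

Lemma measurable_posterior_density B : measurable B ->
  measurable_fun setT (posterior_density B : mR5 R -> R).
Proof.
move=> mB; rewrite /posterior_density; apply: measurable_mul; last first.
  by apply: measurable_indic_comp => //; exact: measurable_eta3.
apply: measurable_mul; last first.
  apply: measurable_mul; first apply: measurable_mul;
    by apply: measurable_indic_comp; [exact: measurable_itv|mfun].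
rewrite (_ : (fun th => _) = fun th : mR5 R =>
  gaussian_likelihood (th.1.1.1.1, th.1.1.1.2, th.1.1.2, th.1.2, th.2) *
  prior a b (th.1.1.1.1, th.1.1.1.2, th.1.1.2, th.1.2, th.2)); last first.
  by apply/funext => -[[[[? ?] ?] ?] ?].
by rewrite /gaussian_likelihood /prior; mfun.
Qed.

Lemma posterior_density_ge0 B th : 0 <= posterior_density B th.
Proof.
rewrite /posterior_density; have [in1|] := boolP ((0 < th.1.1.2) && (0 < th.1.2) && (-1 < th.2 < 1)).
  apply: mulr_ge0 => //; apply: mulr_ge0; last by rewrite !mulr_ge0.
  move: th in1 => [[[[m1 m2] s1] s2] rho]/= /andP[/andP[s10 s20] rho1].
  apply: mulr_ge0; last by rewrite invr_ge0 !mulr_ge0 ?powR_ge0.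
  rewrite !mulr_ge0 ?expR_ge0//.
  by rewrite exprn_ge0// !mulr_ge0 ?sqr_ge0// invr_ge0 ?mulr_ge0 ?sqrtr_ge0// ltW.
move=> th1; rewrite (_ : _ * _ * \1_unit_itv th.2 = 0) ?mulr0 ?mul0r//.
by rewrite !indicE !mem_setE !in_itv/= !andbT; exact: natr_bool3_eq0.
Qed.

Lemma posterior_mass_density B :
  posterior_mass a b x (@eta3 R @^-1` B) =
  (\int[@lebesgue5 R]_th (posterior_density B th)%:E)%E.
Proof.
rewrite /posterior_mass integral_indicE; apply: eq_integral => -[[[[mu1 mu2] s1] s2] rho] _.
rewrite -EFinM; congr _%:E; rewrite /posterior_density/= !indicE !mem_setE !in_itv/= !andbT.
have [in1|Nin] := boolP ((0 < s1) && (0 < s2) && (-1 < rho < 1)).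
  move: (in1) => /andP[/andP[s10 s20] rho1]; rewrite s10 s20 rho1 !mulr1.
  rewrite likelihoodE//; congr (_ * _%:R).
  by rewrite in_setI mem_set ?andTb//.
rewrite (_ : (_ \in _) = false); last first.
  apply/negbTE; apply: contraNN Nin => /set_mem [[-> -> ->] _]//.
rewrite mulr0 -[LHS](mul0r (((eta3 (mu1, mu2, s1, s2, rho)) \in B)%:R)); congr (_ * _).
by rewrite (natr_bool3_eq0 Nin) mulr0.
Qed.

Lemma integral_mu (B : set (mR R)) (s1 s2 rho : R) :
  0 < s1 -> 0 < s2 -> -1 < rho < 1 ->
  (\int[leb]_mu1 \int[leb]_mu2 (posterior_density B (mu1, mu2, s1, s2, rho))%:E =
   Phi B s1^-1%R (s2 * Num.sqrt (1 - rho ^+ 2))^-1%R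
     (- (rho / (s1 * Num.sqrt (1 - rho ^+ 2))))%R *
   (Num.sqrt (1 - rho ^+ 2) ^- 2)%:E)%E.
Proof.
move=> s10 s20 rho1; set y1 := s1^-1; set r := Num.sqrt _.
have r0 : 0 < r by rewrite sqrtr_gt0 onem_sqr_gt0.
set y2 := (s2 * r)^-1; set y3 := - _.
have y10 : 0 < y1 by rewrite invr_gt0.
have y20 : 0 < y2 by rewrite invr_gt0 mulr_gt0.
have P0 : 0 < normal_peak 1 :> R by rewrite normal_peak_gt0 ?oner_eq0.
have nR0 : 0 < n%:R :> R by rewrite ltr0n.
have sn0 : 0 < Num.sqrt n%:R :> R by rewrite sqrtr_gt0.
pose A := (y1 * y2 * normal_peak 1 ^+ 2) ^+ n *
  expR (- ((y1 ^+ 2 * s + (y3 ^+ 2 * s + 2 * y3 * y2 * t + y2 ^+ 2 * u)) / 2)) *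
  prior a b (0, 0, s1, s2, rho) * \1_B y3.
have A0 : 0 <= A.
  rewrite !mulr_ge0// ?expR_ge0//; first by rewrite exprn_ge0// !mulr_ge0 ?sqr_ge0// ltW.
  by rewrite invr_ge0 !mulr_ge0 ?powR_ge0.
pose e1 (mu1 : mR R) := expR (- (n%:R * (- y1 * mu1 + y1 * mean1 x) ^+ 2 / 2)).
pose e2 (mu1 mu2 : mR R) := expR (- (n%:R *
  (- y2 * mu2 + (y3 * (mean1 x - mu1) + y2 * mean2 x)) ^+ 2 / 2)).
pose G2 := (Num.sqrt n%:R * normal_peak 1 * y2)^-1.
pose G1 := (Num.sqrt n%:R * normal_peak 1 * y1)^-1.
have G20 : 0 <= G2 by rewrite invr_ge0 !mulr_ge0 ?ltW.
have G10 : 0 <= G1 by rewrite invr_ge0 !mulr_ge0 ?ltW.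
transitivity (\int[leb]_mu1 ((A * G2)%:E * (e1 mu1)%:E))%E.
  apply: eq_integral => mu1 _.
  transitivity (\int[leb]_mu2 ((A * e1 mu1)%:E * (e2 mu1 mu2)%:E))%E.
    apply: eq_integral => mu2 _; rewrite -EFinM; congr _%:E.
    rewrite /posterior_density/= !indicE !mem_setE !in_itv/= !andbT s10 s20 rho1 !mulr1.
    rewrite /A /e1 /e2 /prior indicE -/r -/y1 -/y2 -/y3; ring.
  rewrite ge0_integralZl//; last 3 first.
  - by apply: measurable_EFin; rewrite /e2; mfun.
  - by move=> mu2 _; rewrite lee_fin expR_ge0.
  - by rewrite lee_fin mulr_ge0 ?expR_ge0.
  have Ny2 : - y2 != 0 by rewrite oppr_eq0 gt_eqF.
  have := gauss_integral_affine (y3 * (mean1 x - mu1) + y2 * mean2 x) nR0 Ny2.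
  rewrite normrN gtr0_norm// => ->; rewrite -!EFinM; congr _%:E.
  by rewrite -/G2 mulrAC.
rewrite ge0_integralZl//; last 3 first.
- by apply: measurable_EFin; rewrite /e1; mfun.
- by move=> mu1 _; rewrite lee_fin expR_ge0.
- by rewrite lee_fin mulr_ge0.
have Ny1 : - y1 != 0 by rewrite oppr_eq0 gt_eqF.
have := gauss_integral_affine (y1 * mean1 x) nR0 Ny1.
rewrite normrN gtr0_norm// => ->; rewrite /polar_density -!EFinM; congr _%:E; rewrite -/G1.
have rr : 1 - rho ^+ 2 = r ^+ 2 by rewrite /r sqr_sqrtr// ltW// onem_sqr_gt0.
(* Since [(1 - rho^2)^(2 - b/2) = r^(2 - b) r^2], the factor [s2^(2 - b)] combines into
   [(s2 r)^(2 - b) = y2^(b - 2)], and what is left of [r] does not depend on [b]. *)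
have priorE : prior a b (0, 0, s1, s2, rho) = y1 `^ (3 - a) * y2 `^ (2 - b) * r ^- 2.
  have powRV (z p : R) : 0 < z -> z^-1 `^ p = (z `^ p)^-1.
    by move=> z0; rewrite -powR_inv1 ?ltW// -powRrM mulN1r powRN.
  rewrite /prior rr /y1 /y2 !powRV ?mulr_gt0// powRM ?(ltW s20) ?(ltW r0)//.
  have -> : (r ^+ 2) `^ (2 - b / 2) = r `^ (2 - b) * r ^+ 2.
    rewrite -!powR_mulrn ?(ltW r0)// -powRrM -powRD; last by apply/implyP => _; rewrite gt_eqF.
    by congr (_ `^ _); field.
  by rewrite !invfM !mulrA.
have nE : n = n.-1.+1 by rewrite prednK.
have nP : (n%:R : R) = Num.sqrt n%:R ^+ 2 by rewrite sqr_sqrtr ?ler0n.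
have EE : expR (- ((y1 ^+ 2 * s + (y3 ^+ 2 * s + 2 * y3 * y2 * t + y2 ^+ 2 * u)) / 2)) =
  expR (- (s * y1 ^+ 2 / 2)) *
  expR (- ((y3 ^+ 2 * s + 2 * y3 * y2 * t + y2 ^+ 2 * u) / 2)).
  by rewrite -expRD; congr expR; field.
(* Each exponent is [n] from the likelihood, minus 1 from the integral over one mean, plus [3 - a]
   or [2 - b] from the prior. *)
have y1E : y1 `^ (n%:R + 2 - a) = y1 `^ (3 - a) * y1 ^+ n.-1.
  by rewrite -powR_addn//; congr (_ `^ _); rewrite {1}nE -addn1 natrD; ring.
have y2E : y2 `^ (n%:R + 1 - b) = y2 `^ (2 - b) * y2 ^+ n.-1.
  by rewrite -powR_addn//; congr (_ `^ _); rewrite {1}nE -addn1 natrD; ring.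
rewrite y1E y2E /A priorE EE /polar_const [in n%:R * _]nP /G1 /G2 !exprMn {1 2}nE !exprS.
set E1 := expR _; set E2 := expR _.
by field; rewrite !gt_eqF.
Qed.

Lemma measurable_polar_density B : measurable B ->
  measurable_fun setT (fun z : mR R * mR R * mR R => Phi B z.1.1 z.1.2 z.2).
Proof.
move=> mB; apply: measurable_EFin; apply: measurable_mul; last by mfun.
by apply: measurable_indic_comp => //; mfun.
Qed.

Lemma posterior_mass_coordinates B : measurable B ->
  posterior_mass a b x (@eta3 R @^-1` B) =
  (\int[leb]_(rho in unit_itv) \int[leb]_(s2 in pos) \int[leb]_(s1 in pos)
     (Phi B s1^-1%R (s2 * Num.sqrt (1 - rho ^+ 2))^-1%R
        (- (rho / (s1 * Num.sqrt (1 - rho ^+ 2))))%R *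
      (Num.sqrt (1 - rho ^+ 2) ^- 2)%:E))%E.
Proof.
move=> mB; rewrite posterior_mass_density.
rewrite (lebesgue5_tonelli (measurable_posterior_density mB) (posterior_density_ge0 B)).
rewrite [RHS]integral_mkcond; apply: eq_integral => rho _; rewrite patchE.
case: ifPn => [/set_mem/= |rhoN]; last first.
  have i0 : \1_unit_itv rho = 0 :> R by rewrite indicE (negbTE rhoN).
  apply: integral0_eq => s2 _; apply: integral0_eq => s1 _.
  apply: integral0_eq => mu1 _; apply: integral0_eq => mu2 _; rewrite /posterior_density/=.
  by rewrite i0 !(mulr0, mul0r).
rewrite in_itv/= => rho1.
rewrite [RHS]integral_mkcond; apply: eq_integral => s2 _; rewrite patchE.
case: ifPn => [/set_mem/= |s2N]; last first.
  have i0 : \1_pos s2 = 0 :> R by rewrite indicE (negbTE s2N).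
  apply: integral0_eq => s1 _.
  apply: integral0_eq => mu1 _; apply: integral0_eq => mu2 _; rewrite /posterior_density/=.
  by rewrite i0 !(mulr0, mul0r).
rewrite in_itv/= andbT => s20.
rewrite [RHS]integral_mkcond; apply: eq_integral => s1 _; rewrite patchE.
case: ifPn => [/set_mem/= |s1N]; last first.
  have i0 : \1_pos s1 = 0 :> R by rewrite indicE (negbTE s1N).
  apply: integral0_eq => mu1 _; apply: integral0_eq => mu2 _; rewrite /posterior_density/=.
  by rewrite i0 !(mulr0, mul0r).
rewrite in_itv/= andbT => s10.
exact: integral_mu.
Qed.

(** The integral over [y1] does not involve [B], so [a] affects only the constant [K]. The integral
    over [y2] is the chi-squared one, that over [y3] the Gaussian one. *)
Lemma posterior_massE (nu : law R) :
  0 < s -> 0 < s * u - t ^+ 2 -> a < n%:R -> chi2_law nu (n%:R - b) ->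
  exists2 K : R, 0 < K & forall B : set (mR R), measurable B ->
  posterior_mass a b x (@eta3 R @^-1` B) = (K%:E * \int[nu]_c \int[N]_z
    (\1_B ((z - Num.sqrt c * (t / Num.sqrt (s * u - t ^+ 2))) / Num.sqrt s))%:E)%E.
Proof.
move=> s0 D0 an nuE; set V := t / _.
have q0 : 0 < (s * u - t ^+ 2) / s by rewrite divr_gt0.
have P0 : 0 < normal_peak 1 :> R by rewrite normal_peak_gt0 ?oner_eq0.
have nR0 : 0 < n%:R :> R by rewrite ltr0n.
have C00 : 0 < C0 by rewrite /polar_const mulr_gt0 ?invr_gt0 ?mulr_gt0 ?exprn_gt0.
have na0 : 0 < n%:R - a by rewrite subr_gt0.
have [K K0 KE] := chi2_integral_sqr q0 nuE.
have [g g0 gE] := gamma_sqr_finite s0 na0.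
have ss0 : 0 < (Num.sqrt s * normal_peak 1)^-1 by rewrite invr_gt0 mulr_gt0// sqrtr_gt0.
exists (g * (C0 * (Num.sqrt s * normal_peak 1)^-1 * K)) => [|B mB].
  exact: mulr_gt0 g0 (mulr_gt0 (mulr_gt0 C00 ss0) K0).
have Phi0 y1 y2 y3 : (0 <= Phi B y1 y2 y3)%E.
  rewrite lee_fin; apply: mulr_ge0 => //; apply: mulr_ge0.
    by apply: mulr_ge0; [apply: mulr_ge0; [exact: ltW|]|]; exact: powR_ge0.
  by rewrite mulr_ge0 ?expR_ge0.
pose psi (c : mR R) : \bar R :=
  (\int[N]_z (\1_B ((z - Num.sqrt c * V) / Num.sqrt s))%:E)%E.
have psi0 c : (0 <= psi c)%E by apply: integral_ge0 => z _; rewrite lee_fin.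
have mpsi : measurable_fun setT psi.
  apply: measurable_integral; last by move=> c z; rewrite lee_fin.
  by apply: measurable_eindic => //; mfun.
rewrite posterior_mass_coordinates//.
rewrite (posterior_change_of_variables (measurable_polar_density mB) Phi0).
(* The Jacobian [y1^-3 y2^-2] lowers the exponents to [n - a - 1] and [n - b - 1]: a gamma integral
   that is finite because [a < n], and [n - b] degrees of freedom. *)
pose G1 (y1 : mR R) : R := y1 `^ (n%:R - a) * expR (- (s * y1 ^+ 2 / 2)) * y1^-1.
pose G2 (y2 : mR R) : R := y2 `^ (n%:R - b) *
  expR (- ((s * u - t ^+ 2) / s * y2 ^+ 2 / 2)) * y2^-1.
pose k : R := C0 * (Num.sqrt s * normal_peak 1)^-1.
have k0 : 0 < k by exact: mulr_gt0.
transitivity (\int[leb]_(y1 in pos) (\int[leb]_(y2 in pos)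
    (psi ((s * u - t ^+ 2) / s * y2 ^+ 2)%R * (G2 y2)%:E) * (k * G1 y1)%:E))%E.
  apply: eq_integral => y1 /set_mem /=; rewrite in_itv/= andbT => y10.
  rewrite -ge0_integralZr//; last 3 first.
  - apply: measurable_funTS; apply: emeasurable_funM; last by rewrite /G2; mfun.
    by apply: (measurableT_comp mpsi); mfun.
  - move=> y2 /=; rewrite in_itv/= andbT => y20.
    by rewrite mule_ge0// lee_fin !mulr_ge0 ?powR_ge0 ?expR_ge0 ?invr_ge0 ?ltW.
  - rewrite lee_fin; apply: mulr_ge0; first exact: ltW.
    by rewrite /G1 !mulr_ge0 ?powR_ge0 ?expR_ge0 ?invr_ge0 ?ltW.
  apply: eq_integral => y2 /set_mem /=; rewrite in_itv/= andbT => y20.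
  pose c1 : R := C0 * y1 `^ (n%:R + 2 - a) * y2 `^ (n%:R + 1 - b) * expR (- (s * y1 ^+ 2 / 2)).
  have c10 : 0 <= c1.
    apply: mulr_ge0; last exact: expR_ge0.
    by apply: mulr_ge0; [apply: mulr_ge0; [exact: ltW|]|]; exact: powR_ge0.
  transitivity ((y1 ^- 3 * y2 ^- 2)%:E * \int[leb]_y3 (c1%:E *
    (\1_B y3 * expR (- ((y3 ^+ 2 * s + 2 * y3 * y2 * t + y2 ^+ 2 * u) / 2)))%:E))%E.
    congr (_ * _)%E; apply: eq_integral => y3 _; rewrite -EFinM /polar_density; congr _%:E.
    by rewrite [RHS]mulrCA; congr (_ * _); rewrite /c1 [LHS]mulrA.
  have mI : measurable_fun setT (fun y3 : mR R =>
      (\1_B y3 * expR (- ((y3 ^+ 2 * s + 2 * y3 * y2 * t + y2 ^+ 2 * u) / 2)))%:E).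
    by apply: measurable_EFin; apply: measurable_mul; [exact: measurable_indic_comp|mfun].
  have I0 y3 : (0 <=
      (\1_B y3 * expR (- ((y3 ^+ 2 * s + 2 * y3 * y2 * t + y2 ^+ 2 * u) / 2)))%:E)%E.
    by rewrite lee_fin mulr_ge0 ?expR_ge0.
  rewrite (ge0_integralZl leb measurableT mI)//.
  rewrite gauss_section_integral// -/V -/(psi _) !muleA -!EFinM muleC -muleA -EFinM.
  congr (_ * _%:E)%E; rewrite /c1 /k /G1 /G2.
  have -> : n%:R + 2 - a = n%:R - a + 2%:R by ring.
  have -> : n%:R + 1 - b = n%:R - b + 1%:R by ring.
  rewrite !powR_addn//; set e1 := expR _; set e2 := expR _.
  set w1 := y1 `^ _; set w2 := y2 `^ _.
  by field; rewrite !gt_eqF// sqrtr_gt0.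
rewrite KE//.
transitivity (\int[leb]_(y1 in pos) ((K%:E * \int[nu]_x0 psi x0 * k%:E) * (G1 y1)%:E))%E.
  by apply: eq_integral => y1 _; rewrite EFinM muleA.
have I0 : (0 <= \int[nu]_x0 psi x0)%E by exact: integral_ge0.
rewrite ge0_integralZl//; last 3 first.
- by apply: measurable_funTS; rewrite /G1; mfun.
- move=> y1 /=; rewrite in_itv/= andbT => y10.
  by rewrite lee_fin !mulr_ge0 ?powR_ge0 ?expR_ge0 ?invr_ge0 ?ltW.
- by apply: mule_ge0; [apply: mule_ge0 => //; rewrite lee_fin ltW|rewrite lee_fin ltW].
rewrite gE -/k [(K%:E * _)%E]muleC -!muleA -!EFinM muleC; congr (_%:E * _)%E.
by rewrite [LHS]mulrC [LHS]mulrAC [LHS]mulrC.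
Qed.

End posterior_mass.

(** * Quantiles and distribution functions *)

Section quantile_facts.
Context {R : realType} d (T : measurableType d) (P : probability T R).

(** The limits 0 and 1 of the distribution function make the set under the infimum bounded below and
    nonempty; right continuity gives strictness. [F] has to match [P] on half-lines only, so it also
    covers [posterior], a bare set function. *)
Lemma lt_quantile (f : T -> R) (F : set R -> \bar R) (p t0 : R) :
  measurable_fun setT f ->
  (forall t, F `]-oo, t]%classic = P [set w | f w <= t]) -> 0 < p < 1 ->
  (t0 < quantile F p) = (P [set w | (f w <= t0)%R] < p%:E)%E.
Proof.
move=> mf; pose Y : {RV P >-> R} := HB.pack f (isMeasurableFun.Build _ _ _ _ f mf).
have cdfE t : P [set w | f w <= t] = cdf Y t.
  transitivity (P (f @^-1` `]-oo, t]%classic)); last by [].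
  by congr (P _); apply/seteqP; split => w /=; rewrite in_itv.
move=> lawE /andP[p0 p1]; rewrite cdfE.
have -> : quantile F p = inf [set t | (p%:E <= cdf Y t)%E].
  by rewrite /quantile; congr inf; apply/seteqP; split=> t /=; rewrite lawE cdfE.
set S := [set t | _].
have nblt (y : \bar R) : (y < p%:E)%E -> nbhs y [set z | (z < p%:E)%E].
  by move=> yp; apply: open_nbhs_nbhs; split => //; exact: open_ereal_lt_ereal.
have nbgt (y : \bar R) : (p%:E < y)%E -> nbhs y [set z | (p%:E < z)%E].
  by move=> yp; apply: open_nbhs_nbhs; split => //; exact: open_ereal_gt_ereal.
have nbNy : \forall m \near -oo%R, (cdf Y m < p%:E)%E.
  have p0' : (0 < p%:E)%E by rewrite lte_fin.
  exact: (@cvg_cdfNy0 _ _ _ P Y _ (nblt _ p0')).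
have nby : \forall m \near +oo%R, (p%:E < cdf Y m)%E.
  have p1' : (p%:E < 1)%E by rewrite lte_fin.
  exact: (@cvg_cdfy1 _ _ _ P Y _ (nbgt _ p1')).
have SN : has_lbound S.
  near (@ninfty_nbhs R) => m; exists m => t /=; apply: contraTT.
  rewrite -ltNge -ltNge => /ltW tm; apply: le_lt_trans (cdf_nondecreasing Y tm) _.
  by near: m.
have S0 : S !=set0.
  near (@pinfty_nbhs R) => m; exists m => /=; apply: ltW.
  by near: m.
apply/idP/idP => [t0S|t0p].
  rewrite ltNge; apply/negP => St0.
  by move: t0S; rewrite ltNge (@ge_inf _ S).
have nbr : \forall t \near t0^'+, (cdf Y t < p%:E)%E.
  exact: (@cdf_right_continuous _ _ _ P Y t0 _ (nblt _ t0p)).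
near (t0^'+) => t1.
have tt1 : t0 < t1 by near: t1; exact: nbhs_right_gt.
apply: (lt_le_trans tt1); apply: lb_le_inf => // t St.
rewrite leNgt; apply/negP => /ltW tt; move: St => /=; apply/negP; rewrite -ltNge.
apply: le_lt_trans (cdf_nondecreasing Y tt) _.
by near: t1.
Unshelve. all: by end_near.
Qed.

End quantile_facts.

Section posterior_quantile.
Context {R : realType}.
Variables (n : nat) (a b : R) (x : 'I_n -> R * R) (p : R).
Hypotheses (n0 : (0 < n)%N) (p01 : 0 < p < 1).
Local Notation lower t := (@eta3 R @^-1` `]-oo, t]%classic).
Local Notation mass := (posterior_mass a b x).

(* The posterior is then identically [0] and its quantile is [inf set0]. *)
Lemma eta3_posterior_quantile0 : mass setT = 0%E \/ mass setT = +oo%E ->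
  eta3_posterior_quantile a b x p = 0.
Proof.
move=> massT; rewrite /eta3_posterior_quantile /quantile.
rewrite (_ : [set t | _] = set0) ?inf0//.
apply/seteqP; split=> // t /=; rewrite /pushforward /posterior.
have -> : fine (mass setT) = 0 by case: massT => ->.
by rewrite invr0 mulr0 lee_fin leNgt; case/andP: p01 => ->.
Qed.

Lemma lt_eta3_posterior_quantile (t0 : R) : mass setT != 0%E -> mass setT != +oo%E ->
  (t0 < eta3_posterior_quantile a b x p) = (mass (lower t0) < p%:E * mass setT)%E.
Proof.
move=> T0 Too.
pose f := posterior_density a b x setT.
have mf : measurable_fun setT (f : mR5 R -> R).
  exact: measurable_posterior_density.
have f0 : forall th, 0 <= f th by exact: posterior_density_ge0.
pose m := density_measure_pack (leb \x leb \x leb \x leb \x leb)%E mf f0.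
have massE B : measurable B -> mass (@eta3 R @^-1` B) = m (@eta3 R @^-1` B).
  move=> mB; apply: etrans (posterior_mass_density a b x n0 B) _.
  transitivity (\int[leb \x leb \x leb \x leb \x leb]_th
      ((f th)%:E * (\1_(@eta3 R @^-1` B) th)%:E))%E; last first.
    exact: (esym (integral_indicE _ _ _)).
  apply: eq_integral => th _; rewrite -EFinM /f /posterior_density; congr _%:E.
  have -> : \1_setT (eta3 th) = 1 :> R by rewrite indicE mem_set.
  by rewrite mulr1.
have mT : mass setT = m setT by exact: (massE setT).
(* The Dirac mass is the default of [mnormalize] for total mass 0 or infinity, both excluded
   here. *)
pose P := mnormalize m (\d_((0, 0, 0, 0, 0) : mR5 R)).
have PE A : P A = (m A * (fine (m setT))^-1%:E)%E.
  by rewrite /P /mnormalize/= -mT (negbTE T0) (negbTE Too).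
have mTfin : m setT \is a fin_num.
  by rewrite ge0_fin_numE// -mT ltey.
have mT0 : 0 < fine (m setT).
  by rewrite fine_gt0// -mT lt0e T0/= mT measure_ge0/= -mT ltey.
have mfin A : measurable A -> m A \is a fin_num.
  move=> mA; rewrite ge0_fin_numE//; apply: (@le_lt_trans _ _ (m setT)).
    by apply: le_measure; rewrite ?inE.
  by rewrite -ge0_fin_numE.
have mlow t : measurable (lower t).
  by rewrite -[X in measurable X]setTI; apply: measurable_eta3 => //; exact: measurable_itv.
pose c := fine (m setT).
have cE : m setT = c%:E by rewrite fineK.
have lowE t : [set th | (eta3 th <= t)%R] = lower t.
  by apply/seteqP; split => th /=; rewrite in_itv.
have lawE t : pushforward (posterior a b x) (@eta3 R) `]-oo, t]%classic =
    P [set th | (eta3 th <= t)%R].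
  rewrite lowE; apply: etrans _ (esym (PE (lower t))).
  rewrite /pushforward /posterior (massE _ (measurable_itv _)) mT EFinM.
  by congr (_ * _)%E; rewrite fineK//; exact: mfin (mlow t).
transitivity (P (lower t0) < p%:E)%E.
  by rewrite -lowE; exact: (lt_quantile _ measurable_eta3 lawE).
by rewrite PE -/c mT cE (massE _ (measurable_itv _)) lte_pdivrMr// muleC.
Qed.

End posterior_quantile.

(** * The pivot and its coverage *)

Section chi2_support.
Context {R : realType}.

(** Identities between pivots need checking only at [y > 0]; elsewhere [Num.sqrt y] is 0 and so is
    the quotient by it. *)
Lemma eq_integral_chi2 (nu : law R) (k : R) (phi psi : mR R -> \bar R) :
  chi2_law nu k ->
  measurable_fun setT phi -> (forall y, (0 <= phi y)%E) ->
  measurable_fun setT psi -> (forall y, (0 <= psi y)%E) ->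
  (forall y, 0 < y -> phi y = psi y) -> (\int[nu]_y phi y = \int[nu]_y psi y)%E.
Proof.
move=> /chi2_density_ex[K K0 KE] mphi phi0 mpsi psi0 phipsi.
rewrite (KE phi mphi phi0) (KE psi mpsi psi0); apply: eq_integral => y.
by move=> /set_mem/=; rewrite in_itv/= andbT => /phipsi ->.
Qed.

End chi2_support.

Section pivot_cdf.
Context {R : realType}.
Local Notation N := (@normal_prob R 0 1).
Local Notation neg := (`]-oo, 0%R]%classic : set (mR R)).
Implicit Types nu : law R.

(* Distribution function at [v] of the pivot with [chi2_(n-1) = c] held fixed,
   [nu] being the law of the squared denominator. *)
Definition pivot_cdf nu (g : R) (c v : mR R) : \bar R :=
  (\int[nu]_y \int[N]_z (\1_neg ((z + g * Num.sqrt c) / Num.sqrt y - v))%:E)%E.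

Lemma measurable_pivot_cdf nu g :
  measurable_fun setT (fun z : mR R * mR R => pivot_cdf nu g z.1 z.2).
Proof.
rewrite /pivot_cdf; apply: measurable_integral; last first.
  by move=> x y; apply: integral_ge0 => z _; rewrite lee_fin.
apply: measurable_integral; last by move=> x y; rewrite lee_fin.
apply: measurable_eindic; first exact: measurable_itv.
by mfun.
Qed.

(** The pairs [(c, v)] with [v] below the [p] quantile of the starred pivot at [c], expressed by the
    distribution function to be measurable in both variables. *)
Definition covered nu (g p : R) : set (mR R * mR R) :=
  [set z | pivot_cdf nu g z.1 z.2 < p%:E]%E.

Lemma measurable_covered nu g p : measurable (covered nu g p).
Proof.
rewrite /covered -[X in measurable X]setTI.
exact: (measurable_fun_lte (measurable_pivot_cdf nu g) (measurable_cst _)).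
Qed.

(** The common value of the two sides of (a): [c], [z], [e] stand for [C1], [Z], [C2]. *)
Definition coverage nu (nu1 nu2 : law R) (g p : R) : \bar R :=
  (\int[nu1]_c \int[N]_z \int[nu2]_e
    (\1_(covered nu g p) (c, ((z + g * Num.sqrt c) / Num.sqrt e)%R))%:E)%E.

(** As [sqrt s11 = s1 sqrt c], the event [(z - sqrt y V) / sqrt s11 <= eta3] reads
    [z - sqrt y V <= - rho_ratio rho * sqrt c], that is, the starred pivot is at most [V]. The
    posterior constant [K] cancels against the total mass. *)
Lemma lt_eta3_posterior_quantile_pivot (n : nat) (a b : R) (x : 'I_n -> R * R)
    nu (mu1 mu2 s1 s2 rho c p : R) :
  (0 < n)%N -> a < n%:R -> chi2_law nu (n%:R - b) -> 0 < p < 1 ->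
  0 < s1 -> -1 < rho < 1 -> 0 < c -> ss11 x = s1 ^+ 2 * c ->
  0 < ss11 x * ss22 x - ss12 x ^+ 2 ->
  (eta3 (mu1, mu2, s1, s2, rho) < eta3_posterior_quantile a b x p) =
  (pivot_cdf nu (rho_ratio rho) c
     (ss12 x / Num.sqrt (ss11 x * ss22 x - ss12 x ^+ 2))%R < p%:E)%E.
Proof.
move=> n0 an nuE p01 s10 rho1 c0 sE D0; set V := ss12 x / _.
have s0 : 0 < ss11 x by rewrite sE mulr_gt0// exprn_gt0.
have [K K0 KE] := posterior_massE n0 s0 D0 an nuE.
have massT : posterior_mass a b x setT = K%:E.
  apply: etrans (KE setT measurableT) _.
  rewrite -[RHS]mule1 -(integral_prob1 nu); congr (_ * _)%E.
  apply: eq_integral => y _; apply: etrans (integral_prob1 N).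
  by apply: eq_integral => z _; rewrite indicE mem_set.
have r0 : 0 < Num.sqrt (1 - rho ^+ 2) by rewrite sqrtr_gt0 onem_sqr_gt0.
set t0 := eta3 _; have t0E : t0 = - (rho / (s1 * Num.sqrt (1 - rho ^+ 2))) by [].
pose B : set (mR R) := `]-oo, t0]%classic.
have mB : measurable B by exact: measurable_itv.
have massE : posterior_mass a b x (@eta3 R @^-1` B) =
    (K%:E * pivot_cdf nu (rho_ratio rho) c V)%E; last first.
  rewrite lt_eta3_posterior_quantile ?massT//; last by rewrite gt_eqF// lte_fin.
  by rewrite [X in (X < _)%E]massE [(p%:E * _)%E]muleC lte_pmul2l.
apply: etrans (KE B mB) _; rewrite /pivot_cdf.
set I1 := (\int[nu]_y _)%E; set I2 := (\int[nu]_y _)%E; suff -> : I1 = I2 by [].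
apply: (eq_integral_chi2 nuE).
- apply: measurable_integral; last by move=> y z; rewrite lee_fin.
  by apply: measurable_eindic; [exact: measurable_itv|mfun].
- by move=> y; apply: integral_ge0 => z _; rewrite lee_fin.
- apply: measurable_integral; last by move=> y z; rewrite lee_fin.
  by apply: measurable_eindic; [exact: measurable_itv|mfun].
- by move=> y; apply: integral_ge0 => z _; rewrite lee_fin.
move=> y y0; apply: eq_integral => z _; congr (_%:E).
rewrite !indicE !mem_setE !in_itv/= subr_le0 t0E; congr ((nat_of_bool _)%:R).
have sy : 0 < Num.sqrt y by rewrite sqrtr_gt0.
have sc : 0 < Num.sqrt c by rewrite sqrtr_gt0.
have -> : Num.sqrt (ss11 x) = s1 * Num.sqrt c.
  by rewrite sE sqrtrM ?sqr_ge0// sqrtr_sqr gtr0_norm.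
rewrite ler_pdivrMr ?mulr_gt0// ler_pdivrMr//.
have -> : - (rho / (s1 * Num.sqrt (1 - rho ^+ 2))) * (s1 * Num.sqrt c) =
    - (rho_ratio rho * Num.sqrt c).
  by rewrite /rho_ratio; field; rewrite !gt_eqF.
by rewrite -/V [V * _]mulrC lerBlDr [X in _ <= X]addrC lerBrDr.
Qed.

Lemma lt_starred_quantile d (Omega : measurableType d) (Q : probability Omega R)
    (Zs Cs : Omega -> R) nu (rho c p t0 : R) :
  measurable_fun setT (Zs : Omega -> mR R) -> measurable_fun setT (Cs : Omega -> mR R) ->
  0 < p < 1 ->
  (forall phi : mR R * mR R -> \bar R, measurable_fun setT phi ->
     (forall y, (0 <= phi y)%E) ->
     (\int[Q]_w phi (Zs w, Cs w) = \int[nu]_y \int[N]_z phi (z, y))%E) ->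
  (t0 < starred_quantile Q Zs Cs rho c p) =
  (pivot_cdf nu (rho_ratio rho) c t0 < p%:E)%E.
Proof.
move=> mZ mC p01 lawE.
have mpiv : measurable_fun setT (fun w => pivot rho (Zs w) c (Cs w)).
  by rewrite /pivot; mfun.
have cdfE t : Q [set w | (pivot rho (Zs w) c (Cs w) <= t)%R] =
    pivot_cdf nu (rho_ratio rho) c t.
  pose phi (z : mR R * mR R) : \bar R :=
    (\1_neg ((z.1 + rho_ratio rho * Num.sqrt c) / Num.sqrt z.2 - t))%:E.
  have mphi : measurable_fun setT phi.
    apply: measurable_eindic; first exact: measurable_itv.
    by mfun.
  rewrite /pivot_cdf -(lawE phi mphi) => [|z]; last by rewrite lee_fin.
  have mE : measurable [set w | (pivot rho (Zs w) c (Cs w) <= t)%R].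
    by apply: measurable_indicle => //; exact: measurable_cst.
  rewrite -[LHS]mul1e -integral_cst// integral_indicE; apply: eq_integral => w _.
  rewrite mul1e /phi/= !indicE; congr ((nat_of_bool _)%:R)%:E.
  apply/idP/idP => /set_mem/=; rewrite ?in_itv/= ?subr_le0 => H; apply/mem_set => //=.
  by rewrite in_itv/= subr_le0.
by rewrite -cdfE; apply: (lt_quantile _ mpiv).
Qed.

End pivot_cdf.

(** * Joint laws of the auxiliary variables *)

Section independent_laws.
Context {R : realType} d (Omega : measurableType d) (Q : probability Omega R).
Variables (I : finType) (X : I -> Omega -> mR R).
Hypotheses (mX : forall i, measurable_fun setT (X i)) (indep : mutually_independent Q X).
Variables (L : I -> law R).
Hypothesis LE : forall i A, measurable A -> Q (X i @^-1` A) = L i A.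

Let independent_pair i j (A B : set (mR R)) : i != j -> measurable A -> measurable B ->
  Q (X i @^-1` A `&` X j @^-1` B) = (L i A * L j B)%E.
Proof.
move=> ij mA mB; pose F k := if k == i then A else B.
have mF k : measurable (F k) by rewrite /F; case: ifP.
have := indep [set i; j]%SET mF.
rewrite big_setU1 ?inE//= big_set1 /F eqxx eq_sym (negbTE ij) !LE// => <-.
congr (Q _); apply/seteqP; split => [w [wA wB] k|w wAB].
  by rewrite !inE => /orP[/eqP->|/eqP->]; rewrite ?eqxx// eq_sym (negbTE ij).
split; first by have := wAB i; rewrite !inE eqxx; exact.
by have := wAB j; rewrite !inE eqxx orbT eq_sym (negbTE ij); exact.
Qed.

Let independent_triple i j k (A B C : set (mR R)) :
  i != j -> i != k -> j != k -> measurable A -> measurable B -> measurable C ->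
  Q (X i @^-1` A `&` X j @^-1` B `&` X k @^-1` C) = (L i A * L j B * L k C)%E.
Proof.
move=> ij ik jk mA mB mC; pose F l := if l == i then A else if l == j then B else C.
have mF l : measurable (F l) by rewrite /F; case: ifP => // _; case: ifP.
have [ji [ki kj]] : j != i /\ k != i /\ k != j by rewrite ![_ == i]eq_sym [k == j]eq_sym.
have := indep [set i; j; k]%SET mF.
have -> : [set i; j; k]%SET = (i |: (j |: [set k]))%SET by rewrite finset.setUA.
rewrite big_setU1 ?inE ?negb_or ?ij//= big_setU1 ?inE//= big_set1 /F eqxx.
rewrite (negbTE ji) eqxx (negbTE ki) (negbTE kj) !LE// muleA => <-.
congr (Q _); apply/seteqP; split => [w [[wA wB] wC] l|w wABC].
  rewrite !inE => /or3P[/eqP->|/eqP->|/eqP->]; rewrite ?eqxx// ?(negbTE ji) ?eqxx//.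
  by rewrite (negbTE ki) (negbTE kj).
split; first split.
- by have := wABC i; rewrite !inE eqxx; exact.
- by have := wABC j; rewrite !inE eqxx orbT (negbTE ji); exact.
- by have := wABC k; rewrite !inE eqxx !orbT (negbTE ki) (negbTE kj); exact.
Qed.

Lemma ge0_integral_independent2 i j (phi : mR R * mR R -> \bar R) : i != j ->
  measurable_fun setT phi -> (forall y, (0 <= phi y)%E) ->
  (\int[Q]_w phi (X i w, X j w) = \int[L j]_y \int[L i]_x phi (x, y))%E.
Proof.
move=> ij mphi phi0.
pose f w := (X i w, X j w).
have mf : measurable_fun setT f by exact: measurable_tuple2.
rewrite -(fubini_tonelli2 phi)//.
transitivity (\int[image_prob Q mf]_z phi z)%E; first by rewrite ge0_integral_image_prob.
apply: eq_measure_integral => A mA _.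
transitivity (Q (f @^-1` A `&` setT)); first by rewrite setIT.
rewrite (product_law_on_event (m1 := L i) (m2 := L j) mf measurableT _ mA).
  by rewrite [Q setT]probability_setT mule1.
move=> B C mB mC; rewrite setIT [Q setT]probability_setT mule1 -independent_pair//.
Qed.

Lemma ge0_integral_independent3 i j k (phi : mR R * mR R * mR R -> \bar R) :
  i != j -> i != k -> j != k ->
  measurable_fun setT phi -> (forall y, (0 <= phi y)%E) ->
  (\int[Q]_w phi (X i w, X j w, X k w) =
   \int[L j]_y \int[L i]_x \int[L k]_z phi (x, y, z))%E.
Proof.
move=> ij ik jk mphi phi0.
pose f w := (X i w, X j w).
have mf : measurable_fun setT f by exact: measurable_tuple2.
pose g w := (f w, X k w).
have mg : measurable_fun setT g by exact: measurable_tuple2.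
pose m12 : probability (mR R * mR R)%type R := (L i \x L j)%E.
have rect A B : measurable A -> measurable B ->
    Q (f @^-1` A `&` X k @^-1` B) = (m12 A * L k B)%E.
  move=> mA mB; rewrite -LE//.
  have mXB : measurable (X k @^-1` B) by rewrite -[X in measurable X]setTI; exact: mX.
  apply: (product_law_on_event mf mXB _ mA) => B1 B2 mB1 mB2.
  by rewrite LE// -independent_triple.
transitivity (\int[image_prob Q mg]_z phi z)%E; first by rewrite ge0_integral_image_prob.
transitivity (\int[m12 \x L k]_z phi z)%E.
  apply: eq_measure_integral => A mA _.
  transitivity (Q (g @^-1` A `&` setT)); first by rewrite setIT.
  rewrite (product_law_on_event (m1 := m12) (m2 := L k) mg measurableT _ mA).
    by rewrite [Q setT]probability_setT mule1.
  by move=> B C mB mC; rewrite setIT [Q setT]probability_setT mule1 -rect.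
pose G z := (\int[L k]_y phi (z, y))%E.
have mG : measurable_fun setT G by exact: (measurable_integral2 _ mphi).
have G0 z : (0 <= G z)%E by exact: integral_ge0.
transitivity (\int[m12]_z G z)%E; first exact: (fubini_tonelli1 (m1 := m12) (m2 := L k) phi mphi phi0).
exact: (fubini_tonelli2 G mG G0).
Qed.

End independent_laws.

(** * Sums of squares and products of standardized data *)

Section standardized_moments.
Context {R : realType}.
Variables (n : nat) (x : 'I_n -> R * R) (mu1 mu2 s1 s2 rho : R).
Hypotheses (n0 : (0 < n)%N) (s10 : 0 < s1) (s20 : 0 < s2) (rho1 : -1 < rho < 1).
Let r := Num.sqrt (1 - rho ^+ 2).
Let u k := stdize (mu1, mu2, s1, s2, rho) (x k).

Let r0 : 0 < r. Proof. by rewrite /r sqrtr_gt0 onem_sqr_gt0. Qed.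
Let nR : n%:R != 0 :> R. Proof. by rewrite pnatr_eq0 -lt0n. Qed.

Let x1E k : (x k).1 = mu1 + s1 * (u k).1.
Proof. by rewrite /u /stdize/=; field; rewrite gt_eqF. Qed.

Let x2E k : (x k).2 = mu2 + s2 * (rho * (u k).1 + r * (u k).2).
Proof. by rewrite /u /stdize/= -/r; field; rewrite !gt_eqF. Qed.

Let dev1 k : (x k).1 - mean1 x = s1 * ((u k).1 - mean1 u).
Proof.
have -> : mean1 x = mu1 + s1 * mean1 u.
  rewrite /mean1; under eq_bigr do rewrite x1E.
  rewrite big_split/= sumr_const card_ord -mulr_sumr -[mu1 *+ n]mulr_natr.
  by field.
by rewrite x1E; ring.
Qed.

Let dev2 k : (x k).2 - mean2 x = s2 * (rho * ((u k).1 - mean1 u) + r * ((u k).2 - mean2 u)).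
Proof.
have -> : mean2 x = mu2 + s2 * (rho * mean1 u + r * mean2 u).
  rewrite /mean2 /mean1; under eq_bigr do rewrite x2E mulrDr.
  rewrite !big_split/= sumr_const card_ord -!mulr_sumr -[mu2 *+ n]mulr_natr.
  by field.
by rewrite x2E; ring.
Qed.

Lemma ss11_stdize : ss11 x = s1 ^+ 2 * ss11 u.
Proof. by rewrite /ss11 mulr_sumr; apply: eq_bigr => k _; rewrite dev1 exprMn. Qed.

Let sum_lin3 (p q t : R) (f g h : 'I_n -> R) :
  \sum_k (p * f k + q * g k + t * h k) =
  p * \sum_k f k + q * \sum_k g k + t * \sum_k h k.
Proof. by rewrite !big_split/= -!mulr_sumr. Qed.

Lemma ss12_stdize : ss12 x = s1 * s2 * (rho * ss11 u + r * ss12 u).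
Proof.
pose f k := ((u k).1 - mean1 u) ^+ 2.
pose g k := ((u k).1 - mean1 u) * ((u k).2 - mean2 u).
transitivity (\sum_k (s1 * s2 * rho * f k + s1 * s2 * r * g k + 0 * 0)).
  by apply: eq_bigr => k _; rewrite dev1 dev2 /f /g; ring.
by rewrite sum_lin3 -/(ss11 u) -/(ss12 u); ring.
Qed.

Lemma ss22_stdize :
  ss22 x = s2 ^+ 2 * (rho ^+ 2 * ss11 u + 2 * rho * r * ss12 u + r ^+ 2 * ss22 u).
Proof.
pose f k := ((u k).1 - mean1 u) ^+ 2.
pose g k := ((u k).1 - mean1 u) * ((u k).2 - mean2 u).
pose h k := ((u k).2 - mean2 u) ^+ 2.
transitivity (\sum_k (s2 ^+ 2 * rho ^+ 2 * f k + s2 ^+ 2 * (2 * rho * r) * g k +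
    s2 ^+ 2 * r ^+ 2 * h k)).
  by apply: eq_bigr => k _; rewrite dev2 /f /g /h; ring.
by rewrite sum_lin3 -/(ss11 u) -/(ss12 u) -/(ss22 u); ring.
Qed.

Lemma ss_det_stdize : ss11 x * ss22 x - ss12 x ^+ 2 =
  (s1 * s2 * r) ^+ 2 * (ss11 u * ss22 u - ss12 u ^+ 2).
Proof. by rewrite ss11_stdize ss12_stdize ss22_stdize; ring. Qed.

End standardized_moments.

Section raw_moments.
Context {R : realType}.
Variables (n : nat) (u : 'I_n -> R * R).
Hypothesis n0 : (0 < n)%N.
Let nR : n%:R != 0 :> R. Proof. by rewrite pnatr_eq0 -lt0n. Qed.

Definition centred11 (st : mR5 R) : R := st.1.1.2 - st.1.1.1.1 ^+ 2 / n%:R.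
Definition centred12 (st : mR5 R) : R := st.1.2 - st.1.1.1.1 * st.1.1.1.2 / n%:R.
Definition centred22 (st : mR5 R) : R := st.2 - st.1.1.1.2 ^+ 2 / n%:R.

Let st : mR5 R := (\sum_k (u k).1, \sum_k (u k).2, \sum_k (u k).1 ^+ 2,
  \sum_k (u k).1 * (u k).2, \sum_k (u k).2 ^+ 2).

Let sum_centred (f g : 'I_n -> R) : \sum_k (f k - (\sum_i f i) / n%:R) * (g k - (\sum_i g i) / n%:R) =
  \sum_k f k * g k - (\sum_k f k) * (\sum_k g k) / n%:R.
Proof.
set F := \sum_i f i; set G := \sum_i g i.
transitivity (\sum_k (f k * g k + (- (G / n%:R) * f k + (- (F / n%:R) * g k + F * G / n%:R ^+ 2)))).
  by apply: eq_bigr => k _; field.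
rewrite !big_split/= -!mulr_sumr -/F -/G sumr_const card_ord -[_ *+ n]mulr_natr.
by field.
Qed.

Lemma ss11_raw : ss11 u = centred11 st.
Proof.
transitivity (\sum_k ((u k).1 - mean1 u) * ((u k).1 - mean1 u)).
  by apply: eq_bigr => k _; rewrite expr2.
by rewrite /mean1 sum_centred.
Qed.

Lemma ss12_raw : ss12 u = centred12 st.
Proof. by rewrite /ss12 /mean1 /mean2 sum_centred. Qed.

Lemma ss22_raw : ss22 u = centred22 st.
Proof.
transitivity (\sum_k ((u k).2 - mean2 u) * ((u k).2 - mean2 u)).
  by apply: eq_bigr => k _; rewrite expr2.
by rewrite /mean2 sum_centred.
Qed.

(** Centring removes the mean coordinates [a] and [b]. *)
Lemma centred_bartlett (a b c w e : R) : 0 <= c ->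
  let z := bartlett n a b c w e in
  [/\ centred11 z = c, centred12 z = Num.sqrt c * w & centred22 z = w ^+ 2 + e].
Proof.
move=> c0 z; have sn : Num.sqrt n%:R ^+ 2 = n%:R :> R by rewrite sqr_sqrtr ?ler0n.
split; rewrite /z /bartlett ?/centred11 ?/centred12 ?/centred22/=.
- by rewrite exprMn sn [_ * a ^+ 2]mulrC mulfK// addrK.
- by rewrite mulrACA -expr2 sn [_ * (a * b)]mulrC mulfK// addrK.
- by rewrite exprMn sn [_ * b ^+ 2]mulrC mulfK// addrK.
Qed.

End raw_moments.

Lemma iid_state_moments {R : realType} d (T : measurableType d) (n : nat) (Y : 'I_n -> T -> mR R * mR R) w :
  iid_state Y (@moment_step R) (0, 0, 0, 0, 0) (enum 'I_n) w =
  (\sum_k (Y k w).1, \sum_k (Y k w).2, \sum_k (Y k w).1 ^+ 2,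
   \sum_k (Y k w).1 * (Y k w).2, \sum_k (Y k w).2 ^+ 2).
Proof.
have enumE (f : 'I_n -> R) : \sum_k f k = \sum_(k <- enum 'I_n) f k by rewrite big_enum.
rewrite !enumE; elim: (enum 'I_n) => [|i s ih]; first by rewrite !big_nil.
by rewrite /= ih /moment_step/= !big_cons; congr (_, _, _, _, _); rewrite addrC.
Qed.

Lemma indic_preimageE {R : realType} {T T' : Type} (f : T -> T') (A : set T') x :
  \1_(f @^-1` A) x = \1_A (f x) :> R.
Proof. by rewrite !indicE; congr (nat_of_bool _)%:R; apply/idP/idP => /set_mem/mem_set. Qed.

Section moment_law_chi2.
Context {R : realType}.
Local Notation N := (@normal_prob R 0 1).
Local Notation M := (@sumsq_law R).

(** For statistics free of the means, [a] and [b] integrate to one. The remaining sums of squares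
    have [n - 1] and [n - 2] degrees of freedom for [n = k.+3], and are almost surely positive, so
    agreement at positive [c], [e] suffices. *)
Lemma moment_law_chi2 (k : nat) (nu1 nu2 : law R)
    (phi : mR5 R -> \bar R) (psi : mR R -> mR R -> mR R -> \bar R) :
  chi2_law nu1 k.+2%:R -> chi2_law nu2 k.+1%:R ->
  measurable_fun setT phi -> (forall y, (0 <= phi y)%E) ->
  measurable_fun setT (fun z : mR R * mR R * mR R => psi z.1.1 z.1.2 z.2) ->
  (forall c w e, (0 <= psi c w e)%E) ->
  (forall a b c w e, 0 < c -> 0 < e -> phi (bartlett k.+3 a b c w e) = psi c w e) ->
  (\int[moment_law k.+3]_s phi s =
   \int[nu1]_c \int[N]_w \int[nu2]_e psi c w e)%E.
Proof.
move=> nu1E nu2E mphi phi0 mpsi psi0 phipsi.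
set I := (RHS); have I0 : (0 <= I)%E by do 3 (apply: integral_ge0 => ? _).
transitivity (\int[N]_a \int[N]_b cst I b)%E; last first.
  have NE (J : \bar R) : (\int[N]_a cst J a = J)%E.
    exact: integral_prob_cst.
  apply: etrans (NE _); apply: eq_integral => a _; exact: NE.
apply: etrans (moment_law_bartlett k.+1 mphi phi0) _.
apply: eq_integral => a _; apply: eq_integral => b _.
have mcomp d (T : measurableType d) (f g h : T -> mR R) : measurable_fun setT f ->
    measurable_fun setT g -> measurable_fun setT h ->
    measurable_fun setT (fun t => phi (bartlett k.+3 a b (f t) (g t) (h t))).
  by move=> mf mg mh; apply: (measurableT_comp mphi); rewrite /bartlett; mfun.
have mpsic d (T : measurableType d) (f g h : T -> mR R) : measurable_fun setT f ->
    measurable_fun setT g -> measurable_fun setT h ->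
    measurable_fun setT (fun t => psi (f t) (g t) (h t)).
  move=> mf mg mh; apply: (measurableT_comp mpsi (g := fun t => (f t, g t, h t))).
  by mfun.
pose H c w e := phi (bartlett k.+3 a b c w e).
have inner (f : mR R -> mR R -> mR R -> \bar R) (nu : law R) :
    measurable_fun setT (fun z : mR R * mR R * mR R => f z.1.1 z.1.2 z.2) ->
    (forall c w e, (0 <= f c w e)%E) ->
    measurable_fun setT (fun c => \int[N]_w \int[nu]_e f c w e)%E.
  move=> mf f0; apply: measurable_integral.
    exact: (measurable_integral nu (phi := fun z e => f z.1 z.2 e)).
  by move=> c w; apply: integral_ge0.
have inner0 (f : mR R -> mR R -> mR R -> \bar R) (nu : law R) c :
    (forall c w e, (0 <= f c w e)%E) -> (0 <= \int[N]_w \int[nu]_e f c w e)%E.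
  by move=> f0; do 2 (apply: integral_ge0 => ? _).
have mH : measurable_fun setT (fun z : mR R * mR R * mR R => H z.1.1 z.1.2 z.2).
  by apply: mcomp; mfun.
have H0 c w e : (0 <= H c w e)%E by exact: phi0.
apply: etrans (sumsq_law_chi2 nu1E (inner H (M k.+1) mH H0) (fun c => inner0 H (M k.+1) c H0)) _.
apply: (eq_integral_chi2 nu1E) => [|c||c|c c0].
- exact: inner.
- exact: inner0.
- exact: inner.
- exact: inner0.
apply: eq_integral => w _.
have mHe : measurable_fun setT (H c w) by apply: mcomp; mfun.
apply: etrans (sumsq_law_chi2 nu2E mHe (fun=> H0 _ _ _)) _.
apply: (eq_integral_chi2 nu2E) => // [|e e0]; first by apply: mpsic; mfun.
exact: phipsi.
Qed.

End moment_law_chi2.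

(** * Coverage of the posterior quantile and of the starred quantile *)

Section posterior_coverage.
Context {R : realType}.
Local Notation N := (@normal_prob R 0 1).
Local Notation pos := (`]0%R, +oo[%classic : set (mR R)).
Local Notation unit_itv := (`](-1)%R, 1%R[%classic : set (mR R)).
Variables (n : nat) (a b : R) (d : measure_display) (Omega : measurableType d).
Variables (X : 'I_n -> Omega -> mR R * mR R).
Hypotheses (n0 : (0 < n)%N) (mX : forall k, measurable_fun setT (X k)).
Local Notation data w := (fun k => X k w).

Let measurable_ss : [/\ measurable_fun setT (fun w => ss11 (data w)),
  measurable_fun setT (fun w => ss12 (data w)) &
  measurable_fun setT (fun w => ss22 (data w))].
Proof.
have m1 k : measurable_fun setT (fun w => (X k w).1).
  exact: (measurableT_comp measurable_fst).
have m2 k : measurable_fun setT (fun w => (X k w).2).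
  exact: (measurableT_comp measurable_snd).
have mm1 : measurable_fun setT (fun w => mean1 (data w)).
  by apply: measurable_mul => //; apply: measurable_bigsum.
have mm2 : measurable_fun setT (fun w => mean2 (data w)).
  by apply: measurable_mul => //; apply: measurable_bigsum.
have d1 k : measurable_fun setT (fun w => (X k w).1 - mean1 (data w)).
  exact: (measurable_add (m1 k) (measurable_opp mm1)).
have d2 k : measurable_fun setT (fun w => (X k w).2 - mean2 (data w)).
  exact: (measurable_add (m2 k) (measurable_opp mm2)).
split; apply: measurable_bigsum => k.
- exact: measurable_funX.
- exact: measurable_mul.
- exact: measurable_funX.
Qed.

(** In the form of [posterior_mass_coordinates], valid for degenerate samples too, the data enter
    only through three measurable sums. *)
Lemma measurable_posterior_mass B : measurable B ->
  measurable_fun setT (fun w => posterior_mass a b (data w) (@eta3 R @^-1` B)).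
Proof.
move=> mB; have [m11 m12 m22] := measurable_ss.
pose F (w : Omega) (rho s2 s1 : mR R) : \bar R :=
  (polar_density n a b (ss11 (data w)) (ss12 (data w)) (ss22 (data w)) B s1^-1%R
     (s2 * Num.sqrt (1 - rho ^+ 2))^-1%R (- (rho / (s1 * Num.sqrt (1 - rho ^+ 2))))%R *
   (Num.sqrt (1 - rho ^+ 2) ^- 2)%:E)%E.
rewrite (_ : (fun w => _) = fun w => (\int[leb]_(rho in unit_itv)
    \int[leb]_(s2 in pos) \int[leb]_(s1 in pos) F w rho s2 s1)%E); last first.
  by apply/funext => w; exact: posterior_mass_coordinates.
have P0 : 0 <= normal_peak 1 :> R by rewrite ltW// normal_peak_gt0 ?oner_eq0.
have C0 : 0 <= polar_const R n.
  by rewrite mulr_ge0 ?invr_ge0 ?mulr_ge0 ?exprn_ge0 ?ler0n.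
have F0 w rho s2 s1 : (0 <= F w rho s2 s1)%E.
  apply: mule_ge0; rewrite lee_fin; last by rewrite invr_ge0 sqr_ge0.
  apply: mulr_ge0 => //; apply: mulr_ge0; last by rewrite mulr_ge0 ?expR_ge0.
  by apply: mulr_ge0; [apply: mulr_ge0|]; rewrite ?powR_ge0.
have mpos : measurable pos by exact: measurable_itv.
have munit : measurable unit_itv by exact: measurable_itv.
have mF : measurable_fun setT (fun z : Omega * mR R * mR R * mR R =>
    F z.1.1.1 z.1.1.2 z.1.2 z.2).
  have mw : measurable_fun setT (fun z : Omega * mR R * mR R * mR R => z.1.1.1) by mfun.
  have m11' := measurableT_comp m11 mw; have m12' := measurableT_comp m12 mw.
  have m22' := measurableT_comp m22 mw.
  apply: emeasurable_funM; last by mfun.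
  apply: measurable_EFin; apply: measurable_mul; first by apply: measurable_indic_comp => //; mfun.
  by rewrite /comp in m11' m12' m22'; mfun.
apply: (measurable_integral_dom munit leb (phi := fun w rho =>
  (\int[leb]_(s2 in pos) \int[leb]_(s1 in pos) F w rho s2 s1)%E)); last first.
  by move=> w rho; do 2 (apply: integral_ge0 => ? _).
apply: (measurable_integral_dom mpos leb (phi := fun z s2 =>
  (\int[leb]_(s1 in pos) F z.1 z.2 s2 s1)%E)); last first.
  by move=> z s2; apply: integral_ge0.
exact: (measurable_integral_dom mpos leb (phi := fun z s1 => F z.1.1 z.1.2 z.2 s1)).
Qed.

(** Where the total mass is 0 or infinite the quantile is the constant 0; elsewhere the event
    compares two measurable masses. *)
Lemma measurable_covered_event (t0 p : R) : 0 < p < 1 ->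
  measurable [set w | t0 < eta3_posterior_quantile a b (data w) p].
Proof.
move=> p01.
pose m w := posterior_mass a b (data w) (@eta3 R @^-1` `]-oo, t0]%classic).
pose T w := posterior_mass a b (data w) setT.
have mm : measurable_fun setT m by apply: measurable_posterior_mass; exact: measurable_itv.
have mT : measurable_fun setT T by exact: (measurable_posterior_mass measurableT).
pose degenerate := T @^-1` [set 0%E] `|` T @^-1` [set +oo%E].
have mdeg : measurable degenerate.
  by apply: measurableU; rewrite -[X in measurable X]setTI; apply: mT => //; exact: emeasurable_set1.
have -> : [set w | t0 < eta3_posterior_quantile a b (data w) p] =
    (degenerate `&` [set _ | t0 < 0]) `|`
    (~` degenerate `&` [set w | (m w < p%:E * T w)%E]).
  apply/seteqP; split => w /=.
    have [Tw|Tw] := pselect (degenerate w).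
      by rewrite (eta3_posterior_quantile0 p01 Tw); left.
    move/not_orP : (Tw) => [/eqP T0 /eqP Too].
    by rewrite lt_eta3_posterior_quantile//; right.
  move=> [[Tw t00]|[Tw mw]]; first by rewrite (eta3_posterior_quantile0 p01 Tw).
  move/not_orP : (Tw) => [/eqP T0 /eqP Too].
  by rewrite lt_eta3_posterior_quantile.
apply: measurableU; apply: measurableI => //.
- by case: (t0 < 0); [rewrite (_ : [set _ | _] = setT)|rewrite (_ : [set _ | _] = set0)];
    rewrite //; apply/seteqP; split.
- exact: measurableC.
rewrite -[X in measurable X]setTI; apply: (measurable_fun_lte mm _) => //.
by apply: emeasurable_funM => //; exact: measurable_cst.
Qed.

Lemma eq_probability_ae (P : probability Omega R) (E F G : set Omega) :
  measurable E -> measurable F -> measurable G -> P (~` G) = 0%E ->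
  (forall w, G w -> E w <-> F w) -> P E = P F.
Proof.
move=> mE mF mG G0 EF; have mGc := measurableC mG.
have le (A B : set Omega) : measurable A -> measurable B ->
    (forall w, G w -> A w -> B w) -> (P A <= P B)%E.
  move=> mA mB AB; apply: (@le_trans _ _ (P (B `|` ~` G))).
    apply: le_measure; rewrite ?inE//; first exact: measurableU.
    by move=> w Aw; have [/AB Gw|] := pselect (G w); [left; exact: Gw|right].
  by apply: le_trans (measureU2 _ mB mGc) _; rewrite [X in (_ + X)%E]G0 adde0.
apply/eqP; rewrite eq_le; apply/andP; split; apply: le => // w Gw.
- by case: (EF w Gw).
- by case: (EF w Gw).
Qed.

Lemma posterior_coverage (P : probability Omega R) (k : nat)
    (nu nu1 nu2 : law R) (mu1 mu2 s1 s2 rho p : R) :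
  n = k.+3 -> a < n%:R -> 0 < p < 1 -> 0 < s1 -> 0 < s2 -> -1 < rho < 1 ->
  mutually_independent P X ->
  (forall i, has_density P (lebesgue_measure \x lebesgue_measure)%E (X i)
     (binormal_pdf (mu1, mu2, s1, s2, rho))) ->
  chi2_law nu (n%:R - b) -> chi2_law nu1 k.+2%:R ->
  chi2_law nu2 k.+1%:R ->
  P [set w | eta3 (mu1, mu2, s1, s2, rho) < eta3_posterior_quantile a b (data w) p] =
  coverage nu nu1 nu2 (rho_ratio rho) p.
Proof.
move=> nk an p01 s10 s20 rho1 Xindep Xlaw nuE nu1E nu2E.
set th := (mu1, mu2, s1, s2, rho); set E := [set w | _].
have r0 : 0 < Num.sqrt (1 - rho ^+ 2) by rewrite sqrtr_gt0 onem_sqr_gt0.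
set r := Num.sqrt _ in r0.
pose Y i w : mR R * mR R := stdize th (X i w).
have mst := measurable_stdize th.
have mY i : measurable_fun setT (Y i) by exact: (measurableT_comp mst (mX i)).
have Yindep : mutually_independent P Y.
  move=> J A mA; apply: (Xindep J (fun i => stdize th @^-1` A i)) => i.
  by rewrite -[X in measurable X]setTI; exact: mst.
have Ylaw i A : measurable A -> P (Y i @^-1` A) = (N \x N)%E A.
  by move=> mA; apply: (stdize_normal _ (Xlaw i)).
pose st w : mR5 R := iid_state Y (@moment_step R) (0, 0, 0, 0, 0) (enum 'I_n) w.
have stP (F : set (mR5 R)) : measurable F ->
    P (st @^-1` F) = (\int[moment_law n]_s (\1_F s)%:E)%E.
  move=> mF; have m1F : measurable_fun setT (fun s : mR5 R => (\1_F s : R)%:E).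
    exact: measurable_eindic1.
  have := ge0_integral_iid_state mY Yindep Ylaw ((0, 0, 0, 0, 0) : mR5 R)
    (@measurable_moment_step R) (enum_uniq 'I_n) m1F (fun=> ler0n _ _).
  rewrite size_enum_ord => <-; rewrite -/st measure_integral_indic//.
  by rewrite -[X in measurable X]setTI; exact: (measurable_iid_state mY _ (@measurable_moment_step R)).
pose c (s : mR5 R) : R := centred11 n s.
pose t (s : mR5 R) : R := centred12 n s.
pose D (s : mR5 R) : R := c s * centred22 n s - t s ^+ 2.
(* The statistic [V] of the sample written in standardized sums; the scales [s1] and [s2] cancel. *)
pose W (s : mR5 R) : R := (rho * c s + r * t s) / (r * Num.sqrt (D s)).
have mc : measurable_fun setT c by rewrite /c /centred11; mfun.
have mt : measurable_fun setT t by rewrite /t /centred12; mfun.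
have mD : measurable_fun setT D.
  by rewrite /D; apply: measurable_add; [apply: measurable_mul => //; rewrite /centred22; mfun|mfun].
have mW : measurable_fun setT W by rewrite /W; mfun.
(* Almost sure, since [c] and [D = c e] are positive in Bartlett's coordinates; on it
   [lt_eta3_posterior_quantile_pivot] applies. *)
pose good : set (mR5 R) := [set s | 0 < c s] `&` [set s | 0 < D s].
have mgood : measurable good.
  by apply: measurableI; apply: measurable_set_lt => //; exact: measurable_cst.
pose cov : set (mR5 R) := (fun s => (c s, W s)) @^-1` covered nu (rho_ratio rho) p.
have mcov : measurable cov.
  rewrite -[X in measurable X]setTI; apply: (measurable_tuple2 mc mW) => //.
  exact: measurable_covered.
have mst' : measurable_fun setT st.
  exact: (measurable_iid_state mY _ (@measurable_moment_step R)).
have mpre F : measurable F -> measurable (st @^-1` F).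
  by move=> mF; rewrite -[X in measurable X]setTI; exact: mst'.
have bartlettE x y c0 w e : 0 < c0 -> 0 < e -> let z := bartlett n x y c0 w e in
    [/\ c z = c0, t z = Num.sqrt c0 * w & D z = c0 * e].
  move=> c00 e0 z; have [zc zt zq] := centred_bartlett n0 x y w e (ltW c00).
  split; rewrite /D /c /t// zc zt zq exprMn sqr_sqrtr ?ltW//; ring.
have good0 : P (~` (st @^-1` good)) = 0%E.
  have mgoodC : measurable (~` good) by exact: measurableC.
  transitivity (P (st @^-1` (~` good))); first by [].
  rewrite stP// nk.
  transitivity (\int[nu1]_c \int[N]_w \int[nu2]_e (cst 0%E : mR R -> \bar R) e)%E.
    apply: (moment_law_chi2 (psi := fun _ _ _ => 0%E) nu1E nu2E) => //.
      exact: measurable_eindic1.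
    move=> x y c0 w e c00 e0; rewrite -nk; have [zc zt zD] := bartlettE x y c0 w e c00 e0.
    by rewrite indicE memNset//= => -[]; rewrite /good/= zc zD; split => //; exact: mulr_gt0.
  by do 3 (apply: integral0_eq => ? _).
transitivity (P (st @^-1` cov)).
  apply: (eq_probability_ae _ _ (mpre _ mgood) good0).
  - exact: measurable_covered_event.
  - exact: mpre.
  move=> w [c0 D0]; pose u i := Y i w.
  have stE : st w = (\sum_i (u i).1, \sum_i (u i).2, \sum_i (u i).1 ^+ 2,
      \sum_i (u i).1 * (u i).2, \sum_i (u i).2 ^+ 2) by exact: iid_state_moments.
  have cE : ss11 u = c (st w) by rewrite stE; exact: ss11_raw.
  have tE : ss12 u = t (st w) by rewrite stE; exact: ss12_raw.
  have qE : ss22 u = centred22 n (st w) by rewrite stE; exact: ss22_raw.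
  have x11 : ss11 (data w) = s1 ^+ 2 * c (st w) by rewrite -cE; exact: ss11_stdize.
  have x12 : ss12 (data w) = s1 * s2 * (rho * c (st w) + r * t (st w)).
    by rewrite -cE -tE; exact: ss12_stdize.
  have xD : ss11 (data w) * ss22 (data w) - ss12 (data w) ^+ 2 = (s1 * s2 * r) ^+ 2 * D (st w).
    by rewrite /D -cE -tE -qE; exact: ss_det_stdize.
  have k0 : 0 < s1 * s2 * r by rewrite !mulr_gt0.
  have xD0 : 0 < ss11 (data w) * ss22 (data w) - ss12 (data w) ^+ 2.
    by rewrite xD mulr_gt0// exprn_gt0.
  have VE : ss12 (data w) / Num.sqrt (ss11 (data w) * ss22 (data w) - ss12 (data w) ^+ 2) =
      W (st w).
    rewrite xD sqrtrM ?sqr_ge0// sqrtr_sqr gtr0_norm// x12 /W.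
    by field; rewrite !gt_eqF// sqrtr_gt0.
  have H := @lt_eta3_posterior_quantile_pivot R n a b (data w) nu mu1 mu2 s1 s2 rho
    (c (st w)) p n0 an nuE p01 s10 rho1 c0 x11 xD0.
  by rewrite VE in H; apply: iff_trans (iff_sym (rwP idP)); rewrite -H.
rewrite stP// nk /coverage.
pose psi (c0 z e : mR R) : \bar R := (\1_(covered nu (rho_ratio rho) p)
  (c0, (z + rho_ratio rho * Num.sqrt c0) / Num.sqrt e))%:E.
pose phi (z : mR5 R) : \bar R := (\1_cov z)%:E.
have mphi : measurable_fun setT phi.
  exact: measurable_eindic1.
have phi0 z : (0 <= phi z)%E by rewrite lee_fin.
have psi0 c0 w e : (0 <= psi c0 w e)%E by rewrite lee_fin.
have mpsi : measurable_fun setT (fun z : mR R * mR R * mR R => psi z.1.1 z.1.2 z.2).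
  apply: measurable_eindic; first exact: measurable_covered.
  by mfun.
suff phipsi x y c0 w e : 0 < c0 -> 0 < e -> phi (bartlett k.+3 x y c0 w e) = psi c0 w e.
  exact: (moment_law_chi2 nu1E nu2E mphi phi0 mpsi psi0 phipsi).
move=> c00 e0; rewrite -nk; have [zc zt zD] := bartlettE x y c0 w e c00 e0.
have sc : 0 < Num.sqrt c0 by rewrite sqrtr_gt0.
have se : 0 < Num.sqrt e by rewrite sqrtr_gt0.
(* From [t = sqrt c w] and [D = c e], dividing by [r sqrt c] turns [W] into the unstarred pivot. *)
have WE : W (bartlett n x y c0 w e) = (w + rho_ratio rho * Num.sqrt c0) / Num.sqrt e.
  rewrite /W zc zt zD sqrtrM ?(ltW c00)// /rho_ratio -/r -{1}(sqr_sqrtr (ltW c00)).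
  by field; rewrite !gt_eqF.
transitivity ((\1_(covered nu (rho_ratio rho) p)
    (c (bartlett n x y c0 w e), W (bartlett n x y c0 w e)) : R)%:E).
  exact: (congr1 EFin (indic_preimageE _ _ _)).
by rewrite zc WE.
Qed.

End posterior_coverage.

Section starred_coverage.
Context {R : realType} d (Omega : measurableType d) (Q : probability Omega R).
Local Notation N := (@normal_prob R 0 1).
Variables (Z C1 C2 Zs Cs : Omega -> mR R).
Hypotheses (mZ : measurable_fun setT Z) (mC1 : measurable_fun setT C1)
  (mC2 : measurable_fun setT C2) (mZs : measurable_fun setT Zs)
  (mCs : measurable_fun setT Cs).
Variables (nu nu1 nu2 : law R).
Hypothesis starred_law : forall phi : mR R * mR R -> \bar R,
  measurable_fun setT phi -> (forall y, (0 <= phi y)%E) ->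
  (\int[Q]_w phi (Zs w, Cs w) = \int[nu]_y \int[N]_z phi (z, y))%E.
Hypothesis unstarred_law : forall phi : mR R * mR R * mR R -> \bar R,
  measurable_fun setT phi -> (forall y, (0 <= phi y)%E) ->
  (\int[Q]_w phi (Z w, C1 w, C2 w) = \int[nu1]_c \int[N]_z \int[nu2]_e phi (z, c, e))%E.

Lemma starred_coverage (rho p : R) : 0 < p < 1 ->
  Q [set w | pivot rho (Z w) (C1 w) (C2 w) < starred_quantile Q Zs Cs rho (C1 w) p] =
  coverage nu nu1 nu2 (rho_ratio rho) p.
Proof.
move=> p01; pose g := rho_ratio rho.
pose f (z : mR R * mR R * mR R) : mR R * mR R :=
  (z.1.2, (z.1.1 + g * Num.sqrt z.1.2) / Num.sqrt z.2).
have mf : measurable_fun setT f by rewrite /f; mfun.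
pose phi (z : mR R * mR R * mR R) : \bar R := (\1_(covered nu g p) (f z))%:E.
have mphi : measurable_fun setT phi.
  apply: measurable_eindic => //; exact: measurable_covered.
have phi0 z : (0 <= phi z)%E by rewrite lee_fin.
rewrite /coverage -[RHS](unstarred_law mphi phi0).
pose X w := (Z w, C1 w, C2 w).
have mX : measurable_fun setT X by rewrite /X; mfun.
have mE : measurable ((f \o X) @^-1` covered nu g p).
  rewrite -[X in measurable X]setTI; apply: (measurableT_comp mf mX) => //.
  exact: measurable_covered.
transitivity (Q ((f \o X) @^-1` covered nu g p)).
  have H w := @lt_starred_quantile _ _ _ Q Zs Cs nu rho (C1 w) p
    (pivot rho (Z w) (C1 w) (C2 w)) mZs mCs p01 starred_law.
  by congr (Q _); apply/seteqP; split => w /=; rewrite H.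
by rewrite measure_integral_indic//; apply: eq_integral => w _.
Qed.

End starred_coverage.

(** * Continuity of the pivot and its conditional quantile *)

Section normal_cdf.
Context {R : realType}.
Local Notation N := (@normal_prob R 0 1).
Local Notation neg := (`]-oo, 0%R]%classic : set (mR R)).
Local Notation oneg := (`]-oo, 0%R[%classic : set (mR R)).

Definition normal_cdf (x : mR R) : \bar R := (\int[N]_z (\1_neg (z - x))%:E)%E.

Lemma measurable_normal_cdf : measurable_fun setT normal_cdf.
Proof.
apply: measurable_integral; last by move=> x z; rewrite lee_fin.
by apply: measurable_eindic; [exact: measurable_itv|mfun].
Qed.

Lemma normal_cdf_ge0 x : (0 <= normal_cdf x)%E.
Proof. by apply: integral_ge0 => z _; rewrite lee_fin. Qed.

Lemma normal_cdf_le1 x : (normal_cdf x <= 1)%E.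
Proof.
rewrite -(integral_prob1 N); apply: ge0_le_integral => //.
- by apply: measurable_eindic; [exact: measurable_itv|mfun].
- by move=> z _; rewrite /= lee_fin indicE; case: (_ \in _).
Qed.

Lemma normal_cdf_fin x : normal_cdf x \is a fin_num.
Proof. by rewrite ge0_fin_numE ?normal_cdf_ge0//; apply: le_lt_trans (normal_cdf_le1 x) (ltry _). Qed.

Let normal_indic (D : set (mR R)) : measurable D ->
  (\int[N]_z (\1_D z)%:E = \int[leb]_(z in D) (normal_pdf 0 1 z)%:E)%E.
Proof.
move=> mD; have mID : measurable_fun setT (fun z : mR R => (\1_D z)%:E : \bar R).
  exact: measurable_eindic1.
apply: etrans (ge0_integral_normal mID (fun=> ler0n _ _)) _.
by rewrite [RHS]integral_indicE; apply: eq_integral => z _; rewrite muleC.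
Qed.

Lemma normal_cdf_lt x y : x < y -> (normal_cdf x < normal_cdf y)%E.
Proof.
move=> xy; pose D : set (mR R) := `]x, y]%classic.
have mD : measurable D by exact: measurable_itv.
have mI u : measurable_fun setT (fun z : mR R => (\1_neg (z - u))%:E : \bar R).
  by apply: measurable_eindic; [exact: measurable_itv|mfun].
have mID : measurable_fun setT (fun z : mR R => (\1_D z)%:E : \bar R).
  exact: measurable_eindic1.
have -> : normal_cdf y = (normal_cdf x + \int[N]_z (\1_D z)%:E)%E.
  rewrite /normal_cdf -ge0_integralD//.
  apply: eq_integral => z _; rewrite -EFinD !indicE !mem_setE !in_itv/= !subr_le0.
  have [zx|xz] := leP z x; first by rewrite (le_trans zx (ltW xy))/= addr0.
  by rewrite add0r.
rewrite lteDl ?normal_cdf_fin// normal_indic//; apply: integral_gt0 => //.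
- by apply: measurable_funTS; apply: measurable_EFin; exact: measurable_normal_pdf.
- by move=> z _; rewrite lte_fin normal_pdf01 mulr_gt0 ?expR_gt0 ?normal_peak_gt0 ?oner_eq0.
by rewrite -[X in X != _]/(leb D) lebesgue_measure_itv/= lte_fin xy -EFinD gt_eqF// lte_fin subr_gt0.
Qed.

(** The normal law has no atoms; hence neither has the pivot, by integration over its denominator in
    [pivot_cdf_open]. *)
Lemma normal_cdf_open x : (\int[N]_z (\1_oneg (z - x))%:E = normal_cdf x)%E.
Proof.
have mI : measurable_fun setT (fun z : mR R => (\1_oneg (z - x))%:E : \bar R).
  by apply: measurable_eindic; [exact: measurable_itv|mfun].
have mx : measurable ([set x] : set (mR R)) by exact: measurable_set1.
have mIx : measurable_fun setT (fun z : mR R => (\1_[set x] z)%:E : \bar R).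
  exact: measurable_eindic1.
have Nx : (\int[N]_z (\1_[set x] z)%:E = 0)%E.
  by rewrite normal_indic// integral_set1.
rewrite -[LHS]adde0 -Nx -ge0_integralD//.
apply: eq_integral => z _; rewrite -EFinD !indicE !mem_setE !in_itv/= subr_le0 subr_lt0.
rewrite in_set1 le_eqVlt; have [->|zx] := eqVneq z x; first by rewrite ltxx add0r.
by rewrite addr0.
Qed.

End normal_cdf.

Section pivot_quantile.
Context {R : realType}.
Local Notation N := (@normal_prob R 0 1).
Local Notation neg := (`]-oo, 0%R]%classic : set (mR R)).
Local Notation oneg := (`]-oo, 0%R[%classic : set (mR R)).
Implicit Types nu : law R.

Let measurable_pivot_indic (A : set (mR R)) (g c v : R) : measurable A ->
  measurable_fun setT (fun z : mR R * mR R =>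
    (\1_A ((z.2 + g * Num.sqrt c) / Num.sqrt z.1 - v))%:E : \bar R).
Proof. by move=> mA; apply: measurable_eindic => //; mfun. Qed.

Let measurable_inner_pivot (A : set (mR R)) (g c v : R) : measurable A ->
  measurable_fun setT (fun y : mR R =>
    \int[N]_z (\1_A ((z + g * Num.sqrt c) / Num.sqrt y - v))%:E)%E.
Proof.
move=> mA; apply: measurable_integral; last by move=> y z; rewrite lee_fin.
exact: measurable_pivot_indic.
Qed.

Let measurable_normal_cdf_line (g c v : R) :
  measurable_fun setT (fun y : mR R => normal_cdf (v * Num.sqrt y - g * Num.sqrt c)%R).
Proof. by apply: (measurableT_comp measurable_normal_cdf); mfun. Qed.

Lemma pivot_cdfE nu k (g c v : R) : chi2_law nu k ->
  pivot_cdf nu g c v = (\int[nu]_y normal_cdf (v * Num.sqrt y - g * Num.sqrt c)%R)%E.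
Proof.
move=> nuE; apply: (eq_integral_chi2 nuE) => [|y||y|y y0].
- by apply: measurable_inner_pivot; exact: measurable_itv.
- by apply: integral_ge0 => z _; rewrite lee_fin.
- exact: measurable_normal_cdf_line.
- exact: normal_cdf_ge0.
apply: eq_integral => z _; rewrite !indicE !mem_setE !in_itv/= !subr_le0.
by rewrite ler_pdivrMr ?sqrtr_gt0// lerBrDr.
Qed.

Lemma pivot_cdf_open nu k (g c v : R) : chi2_law nu k ->
  (\int[nu]_y \int[N]_z (\1_oneg ((z + g * Num.sqrt c) / Num.sqrt y - v))%:E)%E =
  pivot_cdf nu g c v.
Proof.
move=> nuE; rewrite (pivot_cdfE _ _ _ nuE); apply: (eq_integral_chi2 nuE) => [|y||y|y y0].
- by apply: measurable_inner_pivot; exact: measurable_itv.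
- by apply: integral_ge0 => z _; rewrite lee_fin.
- exact: measurable_normal_cdf_line.
- exact: normal_cdf_ge0.
rewrite -normal_cdf_open; apply: eq_integral => z _.
rewrite !indicE !mem_setE !in_itv/= !subr_lt0.
by rewrite ltr_pdivrMr ?sqrtr_gt0// ltrBrDr.
Qed.

(** The quantile attains its level exactly: [F q >= p] by definition, and without atoms [F q] is the
    limit of values below [p] taken to the left of [q]. *)
Lemma pivot_quantile nu k (g c p : R) : chi2_law nu k -> 0 < p < 1 ->
  exists2 q : R, pivot_cdf nu g c q = p%:E &
    forall v, (pivot_cdf nu g c v < p%:E)%E = (v < q).
Proof.
move=> nuE p01.
pose f (z : mR R * mR R) : R := (z.2 + g * Num.sqrt c) / Num.sqrt z.1.
have mf : measurable_fun setT f by rewrite /f; mfun.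
pose P : probability (mR R * mR R)%type R := (nu \x N)%E.
have PE (A : set (mR R)) v : measurable A ->
    P [set z | A (f z - v)] =
    (\int[nu]_y \int[N]_z (\1_A ((z + g * Num.sqrt c) / Num.sqrt y - v))%:E)%E.
  move=> mA; pose h z := f z - v.
  have mh : measurable_fun setT h by rewrite /h /f; mfun.
  have mhA : measurable (h @^-1` A) by rewrite -[X in measurable X]setTI; exact: mh.
  rewrite (_ : [set z | _] = h @^-1` A)// measure_integral_indic//.
  have mI : measurable_fun setT (fun z => (\1_(h @^-1` A) z : R)%:E).
    exact: measurable_eindic1.
  apply: etrans (fubini_tonelli1 (m1 := nu) (m2 := N) _ mI (fun=> ler0n _ _)) _.
  by apply: eq_integral => y _; apply: eq_integral => z _; rewrite indic_preimageE.
have in_neg x : neg x <-> x <= 0 by rewrite /= in_itv.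
have in_oneg x : oneg x <-> x < 0 by rewrite /= in_itv.
have cdfE v : P [set z | (f z <= v)%R] = pivot_cdf nu g c v.
  transitivity (P [set z | neg (f z - v)]); last first.
    by apply: PE; exact: measurable_itv.
  congr (P _); apply/seteqP; split => z; first by move=> H; apply/in_neg; rewrite subr_le0.
  by move/in_neg; rewrite subr_le0.
pose q := quantile (pushforward P f) p.
have qE v : (v < q) = (pivot_cdf nu g c v < p%:E)%E.
  rewrite -cdfE; apply: (lt_quantile _ mf) => // t; by rewrite /pushforward; congr (P _).
exists q => [|v]; last by rewrite qE.
apply/eqP; rewrite eq_le; apply/andP; split; last by rewrite leNgt -qE ltxx.
have moneg : measurable oneg by exact: measurable_itv.
rewrite -(pivot_cdf_open _ _ _ nuE) -(PE _ _ moneg).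
(* These events increase to [f z < q], and each has probability below [p]. *)
pose F (i : nat) := [set z : mR R * mR R | (f z <= q - i.+1%:R^-1)%R].
have mF i : measurable (F i) by apply: measurable_indicle => //; exact: measurable_cst.
have UF : [set z | oneg (f z - q)] = \bigcup_i F i.
  apply/seteqP; split => z.
    move/in_oneg; rewrite subr_lt0 => /ltr_add_invr[i fi].
    by exists i => //; rewrite /F/= lerBrDr ltW.
  move=> [i _]; rewrite /F/= => fi; apply/in_oneg; rewrite subr_lt0.
  by apply: le_lt_trans fi _; rewrite ltrBlDr ltrDl invr_gt0.
have mUF : measurable (\bigcup_i F i) by exact: bigcup_measurable.
have ndF : nondecreasing_seq F.
  move=> i j ij; apply/subsetPset => z /= /le_trans; apply.
  by rewrite lerB// lef_pV2 ?posrE// ler_nat.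
have cvgF := nondecreasing_cvg_mu mF mUF ndF (mu := P).
rewrite UF -(cvg_lim _ cvgF)//; apply: lime_le; first by apply/cvg_ex; eexists; exact: cvgF.
apply: nearW => i /=; rewrite cdfE ltW// -qE.
by rewrite ltrBlDr ltrDl invr_gt0.
Qed.

(** At fixed [c] the covered set is the open half-line below [q], and the open and closed half-lines
    have equal probability. *)
Lemma conditional_coverage nu nu2 k2 (g c p q : R) : chi2_law nu2 k2 ->
  (forall v, (pivot_cdf nu g c v < p%:E)%E = (v < q)) ->
  (\int[N]_z \int[nu2]_e
    (\1_(covered nu g p) (c, ((z + g * Num.sqrt c) / Num.sqrt e)%R))%:E)%E =
  pivot_cdf nu2 g c q.
Proof.
move=> nu2E qE; rewrite -(pivot_cdf_open _ _ _ nu2E).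
have moneg : measurable oneg by exact: measurable_itv.
have covE x : \1_(covered nu g p) (c, x) = \1_oneg (x - q) :> R.
  have cov_iff : covered nu g p (c, x) <-> oneg (x - q).
    by rewrite /covered /mkset qE -subr_lt0 /= in_itv.
  rewrite !indicE; congr (nat_of_bool _)%:R.
  by apply/idP/idP => /set_mem/cov_iff/mem_set.
transitivity (\int[N]_z \int[nu2]_e (\1_oneg ((z + g * Num.sqrt c) / Num.sqrt e - q))%:E)%E.
  by apply: eq_integral => z _; apply: eq_integral => e _; rewrite covE.
apply: tonelli; last by move=> x y; rewrite lee_fin.
by apply: measurable_eindic => //; mfun.
Qed.

End pivot_quantile.

(** * Strict comparison of chi-squared laws *)

Section chi2_order.
Context {R : realType}.
Local Notation pos := (`]0%R, +oo[%classic : set (mR R)).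
Implicit Types nu : law R.

Lemma chi2_pos nu k : chi2_law nu k -> nu pos = 1%E.
Proof.
move=> nuE; have mpos : measurable pos by exact: measurable_itv.
rewrite measure_integral_indic// -(integral_prob1 nu).
apply: (eq_integral_chi2 nuE) => // [|y y0].
  exact: measurable_eindic1.
by rewrite indicE mem_set//= in_itv/= y0.
Qed.

Lemma lt_integral_chi2 nu k (f g : mR R -> R) : chi2_law nu k ->
  measurable_fun setT f -> measurable_fun setT g ->
  (forall y, 0 <= f y <= 1) -> (forall y, 0 <= g y) -> (forall y, 0 < y -> f y < g y) ->
  (\int[nu]_y (f y)%:E < \int[nu]_y (g y)%:E)%E.
Proof.
move=> nuE mf mg f01 g0 fg.
have mpos : measurable pos by exact: measurable_itv.
pose h y := `|g y - f y|.
have mh : measurable_fun setT (fun y : mR R => (h y)%:E).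
  apply: measurable_EFin; apply: (measurableT_comp (@normr_measurable R setT)).
  exact: (measurable_add mg (measurable_opp mf)).
have mf' : measurable_fun setT (fun y : mR R => (f y)%:E) by exact: measurable_EFin.
have mg' : measurable_fun setT (fun y : mR R => (g y)%:E) by exact: measurable_EFin.
have f0 y : (0 <= (f y)%:E)%E by rewrite lee_fin; case/andP: (f01 y).
have h0 y : (0 <= (h y)%:E)%E by rewrite lee_fin normr_ge0.
have -> : (\int[nu]_y (g y)%:E = \int[nu]_y (f y)%:E + \int[nu]_y (h y)%:E)%E.
  rewrite -ge0_integralD//; apply: (eq_integral_chi2 nuE) => //.
  - exact: emeasurable_funD.
  - by move=> y; exact: adde_ge0.
  - by move=> y y0; rewrite -EFinD /h gtr0_norm ?subr_gt0 ?fg// subrKC.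
have fle : (\int[nu]_y (f y)%:E <= 1)%E.
  rewrite -(integral_prob1 nu); apply: ge0_le_integral => //.
  by move=> y _; rewrite lee_fin; case/andP: (f01 y).
rewrite lteDl; last first.
  by rewrite ge0_fin_numE ?integral_ge0//; apply: le_lt_trans fle (ltry _).
apply: (@lt_le_trans _ _ (\int[nu]_(y in pos) (h y)%:E)%E).
  apply: integral_gt0 => //; first exact: measurable_funTS.
    by move=> y /=; rewrite in_itv/= andbT => y0; rewrite lte_fin normr_gt0 subr_eq0 gt_eqF ?fg.
  by rewrite [X in X != _](chi2_pos nuE) gt_eqF ?lte01.
by apply: ge0_subset_integral => //; exact: measurable_funTS.
Qed.

(* The ratio of two chi-squared densities is a power of [x], hence crosses [1]
   exactly once, at some [x0]; integrate [(h - h x0) (f' - f) > 0]. *)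
Lemma chi2_strict_order nu m nu' m' (h : mR R -> R) :
  chi2_law nu m -> chi2_law nu' m' ->
  measurable_fun setT h -> (forall y, 0 <= h y <= 1) ->
  (forall x y, 0 < x -> x < y -> 0 < (m' - m) * (h y - h x)) ->
  (\int[nu]_y (h y)%:E < \int[nu']_y (h y)%:E)%E.
Proof.
move=> /chi2_density_ex[K K0 KE] /chi2_density_ex[K' K'0 K'E] mh h01 hmon.
have mpos : measurable pos by exact: measurable_itv.
have mm' : m' - m != 0.
  apply: contraTneq (hmon 1 2 ltr01 (ltr1n _ 2)) => ->.
  by rewrite mul0r ltxx.
pose r := (m' - m) / 2.
have r0 : r != 0 by rewrite mulf_neq0// invr_eq0.
(* The crossing point: the ratio of the densities is [K' / K * x^r]. *)
pose x0 := (K / K') `^ r^-1.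
have x00 : 0 < x0 by rewrite powR_gt0// divr_gt0.
have x0r : x0 `^ r = K / K' by rewrite /x0 -powRrM mulVf// powRr1// divr_ge0 ?ltW.
pose w (x : mR R) : R := x `^ (m / 2 - 1) * expR (- (x / 2)).
pose f x : R := K * w x.
pose f' (x : mR R) : R := K' * (x `^ (m' / 2 - 1) * expR (- (x / 2))).
have f'E x : 0 < x -> f' x = K' * (x `^ r * w x).
  move=> x_gt0; rewrite /f' /w (_ : m' / 2 - 1 = r + (m / 2 - 1)); last by rewrite /r; field.
  by rewrite powRD ?mulrA//; apply/implyP => _; rewrite gt_eqF.
have w0 x : 0 < x -> 0 < w x by move=> x_gt0; rewrite mulr_gt0 ?powR_gt0 ?expR_gt0.
pose del x := (h x - h x0) * (f' x - f x).
have delE x : 0 < x -> del x = K' * w x * ((h x - h x0) * (x `^ r - x0 `^ r)).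
  by move=> x_gt0; rewrite /del f'E// /f x0r; field; rewrite gt_eqF.
have key x y : 0 < x -> x < y -> 0 < (h y - h x) * (y `^ r - x `^ r).
  move=> x_gt0 xy; have y_gt0 := lt_trans x_gt0 xy; have hxy := hmon x y x_gt0 xy.
  have powE z : 0 < z -> z `^ r = expR (r * ln z) by move=> z_gt0; rewrite /powR gt_eqF.
  have lnxy : ln x < ln y by rewrite ltr_ln.
  rewrite !powE//; have [rneg|rpos|r00] := ltgtP r 0; last by rewrite r00 eqxx in r0.
  - have mneg : m' - m < 0 by move: rneg; rewrite /r pmulr_llt0// invr_gt0.
    rewrite nmulr_rgt0 in hxy => //.
    by rewrite nmulr_rgt0// subr_lt0 ltr_expR ltr_nM2l.
  - have mpos' : 0 < m' - m by move: rpos; rewrite /r pmulr_lgt0// invr_gt0.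
    rewrite pmulr_rgt0 in hxy => //.
    by rewrite pmulr_rgt0// subr_gt0 ltr_expR ltr_pM2l.
have del_gt0 x : 0 < x -> x != x0 -> 0 < del x.
  move=> x_gt0 xx0; rewrite delE//; apply: mulr_gt0; first exact: mulr_gt0 K'0 (w0 _ x_gt0).
  move: xx0; rewrite neq_lt => /orP[xx0|]; last exact: key.
  by rewrite -mulrNN !opprB key.
have del_ge0 x : 0 < x -> 0 <= del x.
  move=> x_gt0; have [->|/(del_gt0 _ x_gt0)/ltW//] := eqVneq x x0.
  by rewrite /del subrr mul0r.
have mf : measurable_fun setT (f : mR R -> R) by rewrite /f /w; mfun.
have mf' : measurable_fun setT (f' : mR R -> R) by rewrite /f'; mfun.
have mdel : measurable_fun setT (del : mR R -> R).
  by rewrite /del; apply: measurable_mul; [mfun|exact: (measurable_add mf' (measurable_opp mf))].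
have f_ge0 x : 0 < x -> 0 <= f x by move=> x_gt0; rewrite mulr_ge0 ?(ltW (w0 _ _))// ltW.
have f'_ge0 x : 0 < x -> 0 <= f' x.
  by move=> x_gt0; rewrite !mulr_ge0 ?powR_ge0 ?expR_ge0// ltW.
have h_ge0 x : 0 <= h x by case/andP: (h01 x).
pose J (u : mR R -> R) := (\int[leb]_(x in pos) (u x)%:E)%E.
have JD (u v : mR R -> R) : measurable_fun setT u -> measurable_fun setT v ->
    (forall x : R, 0 < x -> 0 <= u x) -> (forall x : R, 0 < x -> 0 <= v x) ->
    J (fun x => u x + v x) = (J u + J v)%E.
  move=> mu mv u0 v0; rewrite /J -ge0_integralD//.
  - by move=> x /=; rewrite in_itv/= andbT lee_fin => /u0.
  - by apply: measurable_funTS; exact: measurable_EFin.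
  - by move=> x /=; rewrite in_itv/= andbT lee_fin => /v0.
  - by apply: measurable_funTS; exact: measurable_EFin.
have nuJ (u : mR R -> R) : measurable_fun setT u -> (forall x : mR R, 0 <= u x) ->
    (\int[nu]_x (u x)%:E)%E = J (fun x => u x * f x).
  move=> mu u0; apply: etrans (KE (fun x => (u x)%:E) (measurable_EFin mu) _) _.
    by move=> x; rewrite lee_fin.
  by apply: eq_integral => x _; rewrite -EFinM.
have nu'J (u : mR R -> R) : measurable_fun setT u -> (forall x : mR R, 0 <= u x) ->
    (\int[nu']_x (u x)%:E)%E = J (fun x => u x * f' x).
  move=> mu u0; apply: etrans (K'E (fun x => (u x)%:E) (measurable_EFin mu) _) _.
    by move=> x; rewrite lee_fin.
  by apply: eq_integral => x _; rewrite -EFinM.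
have cstE (P : law R) : (\int[P]_x (h x0)%:E = (h x0)%:E)%E.
  exact: integral_prob_cst.
have mhf : measurable_fun setT (fun x => h x * f x) by exact: measurable_mul.
have mhf' : measurable_fun setT (fun x => h x * f' x) by exact: measurable_mul.
have mh0f : measurable_fun setT (fun x => h x0 * f x) by apply: measurable_mul => //; mfun.
have mh0f' : measurable_fun setT (fun x => h x0 * f' x) by apply: measurable_mul => //; mfun.
have hf_ge0 x : 0 < x -> 0 <= h x * f x by move=> x_gt0; rewrite mulr_ge0// f_ge0.
have hf'_ge0 x : 0 < x -> 0 <= h x * f' x by move=> x_gt0; rewrite mulr_ge0// f'_ge0.
have h0f_ge0 x : 0 < x -> 0 <= h x0 * f x by move=> x_gt0; rewrite mulr_ge0// f_ge0.
have h0f'_ge0 x : 0 < x -> 0 <= h x0 * f' x by move=> x_gt0; rewrite mulr_ge0// f'_ge0.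
(* The expansion of the integral of [del], with negative terms moved across to avoid differences of
   extended reals. Mass one turns both integrals of the constant [h x0] into [h x0]. *)
have E : (\int[nu']_x (h x)%:E + (h x0)%:E =
    \int[nu]_x (h x)%:E + (h x0)%:E + J del)%E.
  have cE : (h x0)%:E = J (fun x => h x0 * f x).
    by rewrite -(cstE nu); exact: (nuJ (cst (h x0)) (measurable_cst _) (fun=> h_ge0 x0)).
  have c'E : (h x0)%:E = J (fun x => h x0 * f' x).
    by rewrite -(cstE nu'); exact: (nu'J (cst (h x0)) (measurable_cst _) (fun=> h_ge0 x0)).
  rewrite (nuJ h)// (nu'J h)// {1}cE c'E.
  rewrite -!JD//; last 2 first.
  - exact: measurable_add.
  - by move=> x x_gt0; rewrite addr_ge0 ?hf_ge0 ?h0f'_ge0.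
  by apply: eq_integral => x _; congr _%:E; rewrite /del; ring.
have J_gt0 : (0 < J del)%E.
  pose D : set (mR R) := `]x0, +oo[%classic.
  have mD : measurable D by exact: measurable_itv.
  apply: (@lt_le_trans _ _ (\int[leb]_(x in D) (del x)%:E)%E).
    apply: integral_gt0 => //; first by apply: measurable_funTS; exact: measurable_EFin.
      move=> x; rewrite /D/= in_itv/= andbT => xx0; rewrite lte_fin del_gt0 ?gt_eqF//.
      exact: lt_trans xx0.
    by rewrite -[X in X != _]/(leb D) /D lebesgue_measure_itv/= ltry.
  apply: ge0_subset_integral => //.
  - by apply: measurable_funTS; exact: measurable_EFin.
  - by move=> x /=; rewrite in_itv/= andbT lee_fin => /del_ge0.
  - by move=> x; rewrite /D/= !in_itv/= !andbT; exact: lt_trans.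
have hle : (\int[nu]_y (h y)%:E <= 1)%E.
  rewrite -(integral_prob1 nu); apply: ge0_le_integral => //.
  - by move=> y _; rewrite lee_fin.
  - exact: measurable_EFin.
  - by move=> y _; rewrite lee_fin; case/andP: (h01 y).
have hfin : (\int[nu]_y (h y)%:E)%E \is a fin_num.
  rewrite ge0_fin_numE; first exact: le_lt_trans hle (ltry _).
  by apply: integral_ge0 => y _; rewrite lee_fin.
have -> : (\int[nu']_y (h y)%:E = \int[nu]_y (h y)%:E + J del)%E.
  rewrite -[LHS](@addeK _ (h x0)%:E)// E -addeA [((h x0)%:E + _)%E]addeC addeA.
  by rewrite addeK.
by rewrite lteDl.
Qed.

End chi2_order.

(** * When the coverage equals the nominal level *)

Section coverage_level.
Context {R : realType}.
Local Notation N := (@normal_prob R 0 1).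
Variables (nu nu1 nu2 : law R) (k k1 k2 p : R).
Hypotheses (nuE : chi2_law nu k) (nu1E : chi2_law nu1 k1)
  (nu2E : chi2_law nu2 k2) (p01 : 0 < p < 1).

Let cond (g c : R) : \bar R := (\int[N]_z \int[nu2]_e
  (\1_(covered nu g p) (c, ((z + g * Num.sqrt c) / Num.sqrt e)%R))%:E)%E.

(** With equal degrees of freedom the two pivots have the same law given [c], so the level is
    already exact conditionally. *)
Lemma coverage_exact (g : R) : k2 = k -> coverage nu nu1 nu2 g p = p%:E.
Proof.
move=> k2k; transitivity (\int[nu1]_c cst p%:E c)%E; last first.
  exact: integral_prob_cst.
apply: eq_integral => c _; have [q qp qE] := pivot_quantile g c nuE p01.
rewrite (conditional_coverage nu2E qE) -qp.
apply: eq_measure_integral => A mA _; rewrite nu2E// k2k.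
exact/esym/nuE.
Qed.

Let cond_le1 g c : (cond g c <= 1)%E.
Proof.
have [q _ qE] := pivot_quantile g c nuE p01.
rewrite /cond (conditional_coverage nu2E qE) (pivot_cdfE _ _ _ nu2E).
rewrite -(integral_prob1 nu2); apply: ge0_le_integral => //.
- by move=> y _; exact: normal_cdf_ge0.
- by apply: (measurableT_comp measurable_normal_cdf); mfun.
- by move=> y _; exact: normal_cdf_le1.
Qed.

Let cond_ge0 g c : (0 <= cond g c)%E.
Proof. by do 2 (apply: integral_ge0 => ? _); rewrite lee_fin. Qed.

Let cond_fin g c : cond g c \is a fin_num.
Proof. by rewrite ge0_fin_numE//; exact: le_lt_trans (cond_le1 g c) (ltry _). Qed.

Let measurable_fine_fun (H : mR R -> \bar R) : (forall c, H c \is a fin_num) ->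
  measurable_fun setT H -> measurable_fun setT (fun c => fine (H c)).
Proof.
move=> Hfin mH; apply/measurable_EFinP; rewrite (_ : _ \o _ = H)//.
by apply/funext => c /=; rewrite fineK.
Qed.

Let mul_gt0_trans (x y z : R) : 0 < x * y -> 0 < y * z -> 0 < x * z.
Proof.
move=> xy yz; have y0 : y != 0 by apply: contraTneq yz => ->; rewrite mul0r ltxx.
have y2 : 0 < y ^+ 2 by rewrite exprn_even_gt0.
rewrite -(pmulr_lgt0 _ y2) (_ : x * z * y ^+ 2 = x * y * (y * z)); last by ring.
exact: mulr_gt0.
Qed.

Let measurable_cond g : measurable_fun setT (fun c : mR R => fine (cond g c)).
Proof.
apply: measurable_fine_fun => //; apply: measurable_integral; last first.
  by move=> c z; apply: integral_ge0 => e _; rewrite lee_fin.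
apply: (measurable_integral nu2 (phi := fun (x : mR R * mR R) (e : mR R) =>
  (\1_(covered nu g p) (x.1, ((x.2 + g * Num.sqrt x.1) / Num.sqrt e)%R))%:E)); last first.
  by move=> x y; rewrite lee_fin.
apply: measurable_eindic; first exact: measurable_covered.
by mfun.
Qed.

(** Given the denominator [y], the pivot is below [q] with probability [Phi (q sqrt y - g sqrt c)],
    strictly monotone in [y] in the direction of the sign of [q]; [chi2_strict_order] compares its
    means under the two laws. *)
Let cond_strict (g c q : R) : pivot_cdf nu g c q = p%:E ->
  (forall v, (pivot_cdf nu g c v < p%:E)%E = (v < q)) ->
  (0 < (k2 - k) * q -> (p%:E < cond g c)%E) /\
  (0 < (k - k2) * q -> (cond g c < p%:E)%E).
Proof.
move=> qp qE; rewrite /cond (conditional_coverage nu2E qE) -qp.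
pose h (y : mR R) : R := fine (normal_cdf (q * Num.sqrt y - g * Num.sqrt c)).
have mh : measurable_fun setT h.
  apply: measurable_fine_fun => [y|]; first exact: normal_cdf_fin.
  by apply: (measurableT_comp measurable_normal_cdf); mfun.
have h01 y : 0 <= h y <= 1.
  rewrite /h fine_ge0 ?normal_cdf_ge0//=.
  by rewrite -lee_fin fineK ?normal_cdf_fin// normal_cdf_le1.
have hE (nu' : law R) k' : chi2_law nu' k' ->
    pivot_cdf nu' g c q = (\int[nu']_y (h y)%:E)%E.
  move=> nu'E; rewrite (pivot_cdfE _ _ _ nu'E); apply: eq_integral => y _.
  by rewrite /h fineK// normal_cdf_fin.
have hmon x y : 0 < x -> x < y -> q != 0 -> 0 < q * (h y - h x).
  move=> x0 xy q0; have sxy : Num.sqrt x < Num.sqrt y.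
    by rewrite ltr_sqrt// (lt_trans x0 xy).
  have lt_h u v : u < v -> fine (normal_cdf u) < fine (normal_cdf v).
    by move=> uv; rewrite fine_lt ?normal_cdf_fin// normal_cdf_lt.
  have [qneg|qpos|q00] := ltgtP q 0; last by rewrite q00 eqxx in q0.
  - by rewrite nmulr_rgt0// subr_lt0 lt_h// ltrD2r ltr_nM2l.
  - by rewrite pmulr_rgt0// subr_gt0 lt_h// ltrD2r ltr_pM2l.
have q_neq0 x : 0 < x * q -> q != 0 by apply: contraTneq => ->; rewrite mulr0 ltxx.
rewrite (hE _ _ nuE) (hE _ _ nu2E); split => kq.
  apply: (chi2_strict_order nuE nu2E) => // x y x0 xy.
  by apply: (mul_gt0_trans kq); apply: hmon => //; exact: q_neq0 kq.
apply: (chi2_strict_order nu2E nuE) => // x y x0 xy.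
by apply: (mul_gt0_trans kq); apply: hmon => //; exact: q_neq0 kq.
Qed.

(* The sign of the quantile is the same for all [c], hence so is that of the
   coverage error given [c]. *)
Lemma coverage_inexact (g : R) : k2 != k ->
  (normal_cdf 0%R <= p%:E)%E && (0 < g) || (p%:E < normal_cdf 0%R)%E && (g < 0) ->
  coverage nu nu1 nu2 g p != p%:E.
Proof.
move=> k2k g_sgn.
have cdf0 c : pivot_cdf nu g c 0 = normal_cdf (- (g * Num.sqrt c)).
  rewrite (pivot_cdfE _ _ _ nuE).
  transitivity (\int[nu]_y cst (normal_cdf (- (g * Num.sqrt c))%R) y)%E.
    by apply: eq_integral => y _; rewrite mul0r sub0r.
  exact: integral_prob_cst.
have d0 : k2 - k != 0 by rewrite subr_eq0.
(* The value [F c 0] does not depend on the denominator. If [p >= Phi 0] and [g > 0] it lies below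
   [p], so [q > 0]; if [p < Phi 0] and [g < 0] it lies above, so [q < 0]. Either way [q] has the
   sign of [g]. *)
have sgn c : 0 < c -> exists2 q, pivot_cdf nu g c q = p%:E &
    (forall v, (pivot_cdf nu g c v < p%:E)%E = (v < q)) /\ 0 < g * q.
  move=> c0; have [q qp qE] := pivot_quantile g c nuE p01; exists q => //; split=> //.
  have sc : 0 < Num.sqrt c by rewrite sqrtr_gt0.
  case/orP: g_sgn => /andP[Phi0 g0].
    rewrite pmulr_rgt0// -qE cdf0; apply: lt_le_trans Phi0; apply: normal_cdf_lt.
    by rewrite oppr_lt0 mulr_gt0.
  have F0 : (p%:E < pivot_cdf nu g c 0%R)%E.
    by rewrite cdf0; apply: lt_trans Phi0 _; apply: normal_cdf_lt; rewrite oppr_gt0 nmulr_rlt0.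
  (* [F c 0 > p] gives only [q <= 0]; equality is excluded because [F c q = p]. *)
  rewrite nmulr_rgt0// lt_neqAle leNgt -qE -leNgt (ltW F0) andbT.
  by apply: contraTneq F0 => <-; rewrite qp ltxx.
have coverE : coverage nu nu1 nu2 g p = (\int[nu1]_c (fine (cond g c))%:E)%E.
  by apply: eq_integral => c _; rewrite fineK.
have pE : p%:E = (\int[nu1]_c (cst p c)%:E)%E.
  exact/esym/(integral_prob_cst nu1 p%:E).
have [p0 p1] := andP p01.
have c01 c : 0 <= fine (cond g c) <= 1.
  by rewrite fine_ge0//= -lee_fin fineK.
have [dg|dg] : 0 < (k2 - k) * g \/ 0 < (k - k2) * g.
  have g0 : g != 0 by case/orP: g_sgn => /andP[_]; [move/gt_eqF->|move/lt_eqF->].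
  have : (k2 - k) * g != 0 by rewrite mulf_neq0.
  by rewrite neq_lt => /orP[lt0|]; [right; rewrite -opprB mulNr oppr_gt0|left].
- rewrite gt_eqF// coverE pE; apply: (lt_integral_chi2 nu1E) => // [c|c|c c0].
  + by rewrite /= !ltW.
  + by case/andP: (c01 c).
  have [q qp [qE gq]] := sgn c c0; have [H _] := cond_strict qp qE.
  by rewrite -lte_fin fineK// H// (mul_gt0_trans dg).
- rewrite lt_eqF// coverE pE; apply: (lt_integral_chi2 nu1E) => // [c|c c0].
  + by rewrite /= ltW.
  have [q qp [qE gq]] := sgn c c0; have [_ H] := cond_strict qp qE.
  by rewrite -lte_fin fineK// H// (mul_gt0_trans dg).
Qed.

End coverage_level.

Theorem theorem3 (R : realType) (n : nat) (a b alpha : R)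
    (n_ge3 : (3 <= n)%N) (a_lt_n : a < n%:R) (b_lt_n : b < n%:R)
    (alpha01 : 0 < alpha < 1)
    (* sampling model: P th is the law of the experiment under parameter th *)
    (d : measure_display) (Omega : measurableType d)
    (P : param R -> probability Omega R)
    (X : 'I_n -> {mfun Omega >-> (R * R)%type})
    (X_iid : forall th : param R, param_space th ->
       iid_binormal (P th) (fun k => X k) th)
    (* auxiliary variables Z_3, chi2_{n-1}, chi2_{n-2}, Z_3^*, chi2^*_{n-b} *)
    (d' : measure_display) (Omega' : measurableType d')
    (Q : probability Omega' R) (Z C1 C2 Zs Cs : {RV Q >-> R})
    (indep : mutually_independent Q
       (tnth [tuple (Z : Omega' -> R); (C1 : Omega' -> R); (C2 : Omega' -> R);
                    (Zs : Omega' -> R); (Cs : Omega' -> R)]))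
    (Z_normal : has_density Q lebesgue_measure Z (normal_pdf 0 1))
    (C1_chi2 : has_density Q lebesgue_measure C1 (chi2_pdf (n%:R - 1)))
    (C2_chi2 : has_density Q lebesgue_measure C2 (chi2_pdf (n%:R - 2)))
    (Zs_normal : has_density Q lebesgue_measure Zs (normal_pdf 0 1))
    (Cs_chi2 : has_density Q lebesgue_measure Cs (chi2_pdf (n%:R - b))) :
  (forall mu1 mu2 s1 s2 rho : R, 0 < s1 -> 0 < s2 -> -1 < rho < 1 ->
     P (mu1, mu2, s1, s2, rho)
       [set w | eta3 (mu1, mu2, s1, s2, rho) <
                eta3_posterior_quantile a b (fun k => X k w) (1 - alpha)] =
     Q [set w | pivot rho (Z w) (C1 w) (C2 w) <
                starred_quantile Q Zs Cs rho (C1 w) (1 - alpha)])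
  /\
  ((forall rho : R, -1 < rho < 1 ->
      Q [set w | pivot rho (Z w) (C1 w) (C2 w) <
                 starred_quantile Q Zs Cs rho (C1 w) (1 - alpha)] =
      (1 - alpha)%:E)
   <-> b = 2).
Proof.
set p := 1 - alpha.
have p01 : 0 < p < 1 by move: alpha01 => /andP[? ?]; rewrite /p subr_gt0 gtrBl; apply/andP.
have [k nk] : exists k, n = k.+3 by exists (n - 3)%N; rewrite -addn3 subnK.
have n0 : (0 < n)%N by rewrite nk.
have mX i : measurable_fun setT (X i : Omega -> mR R * mR R) by exact: (@measurable_funPT _ _ _ _ (X i)).
have mZ : measurable_fun setT (Z : Omega' -> mR R) by exact: (@measurable_funPT _ _ _ _ Z).
have mC1 : measurable_fun setT (C1 : Omega' -> mR R) by exact: (@measurable_funPT _ _ _ _ C1).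
have mC2 : measurable_fun setT (C2 : Omega' -> mR R) by exact: (@measurable_funPT _ _ _ _ C2).
have mZs : measurable_fun setT (Zs : Omega' -> mR R) by exact: (@measurable_funPT _ _ _ _ Zs).
have mCs : measurable_fun setT (Cs : Omega' -> mR R) by exact: (@measurable_funPT _ _ _ _ Cs).
pose nu : law R := image_prob Q mCs.
pose nu1 : law R := image_prob Q mC1.
pose nu2 : law R := image_prob Q mC2.
have nuE : chi2_law nu (n%:R - b) by exact: Cs_chi2.
have nu1E : chi2_law nu1 (n%:R - 1) by exact: C1_chi2.
have nu2E : chi2_law nu2 (n%:R - 2) by exact: C2_chi2.
pose N : law R := @normal_prob R 0 1.
pose V : 'I_5 -> Omega' -> mR R := tnth [tuple (Z : Omega' -> R); (C1 : Omega' -> R);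
  (C2 : Omega' -> R); (Zs : Omega' -> R); (Cs : Omega' -> R)].
pose L : 'I_5 -> law R := tnth [tuple N; nu1; nu2; N; nu].
have mV i : measurable_fun setT (V i).
  by case: i => -[|[|[|[|[|?]]]]] i5.
have VL i A : measurable A -> Q (V i @^-1` A) = L i A.
  move=> mA; case: i => -[|[|[|[|[|?]]]]] i5 //.
  - exact: Z_normal.
  - exact: Zs_normal.
pose o (i : nat) (i5 : (i < 5)%N) : 'I_5 := Ordinal i5.
(* The quantile is a deterministic function of [C1 w], so the starred pair enters through its joint
   law and the unstarred triple through its own. *)
have starred (phi : mR R * mR R -> \bar R) : measurable_fun setT phi ->
    (forall y, (0 <= phi y)%E) ->
    (\int[Q]_w phi (Zs w, Cs w) = \int[nu]_y \int[N]_z phi (z, y))%E.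
  exact: (ge0_integral_independent2 mV indep VL (i := o 3 isT) (j := o 4 isT)).
have unstarred (phi : mR R * mR R * mR R -> \bar R) : measurable_fun setT phi ->
    (forall y, (0 <= phi y)%E) ->
    (\int[Q]_w phi (Z w, C1 w, C2 w) = \int[nu1]_c \int[N]_z \int[nu2]_e phi (z, c, e))%E.
  exact: (ge0_integral_independent3 mV indep VL (i := o 0 isT) (j := o 1 isT) (k := o 2 isT)).
have QE rho : Q [set w | pivot rho (Z w) (C1 w) (C2 w) <
    starred_quantile Q Zs Cs rho (C1 w) p] = coverage nu nu1 nu2 (rho_ratio rho) p.
  exact: starred_coverage.
split.
  move=> mu1 mu2 s1 s2 rho s10 s20 rho1; rewrite QE.
  have [indepX lawX] := X_iid (mu1, mu2, s1, s2, rho) (And3 s10 s20 rho1).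
  have kR1 : n%:R - 1 = k.+2%:R :> R by rewrite nk -(addn1 k.+2) natrD addrK.
  have kR2 : n%:R - 2 = k.+1%:R :> R by rewrite nk -(addn2 k.+1) natrD addrK.
  rewrite kR1 in nu1E; rewrite kR2 in nu2E.
  exact: (posterior_coverage n0 mX nk a_lt_n p01 s10 s20 rho1 indepX lawX nuE nu1E nu2E).
split=> [cover|b2 rho rho1]; last first.
  by rewrite QE; apply: (coverage_exact nu1 nuE nu2E) => //; rewrite b2.
apply/eqP; apply: contraT => b2.
have n2b : n%:R - 2 != n%:R - b by apply: contraNneq b2 => /addrI/oppr_inj ->.
have ratio_gt0 (x : R) : 0 < x -> x < 1 -> 0 < rho_ratio x.
  move=> x0 x1; rewrite divr_gt0// sqrtr_gt0 onem_sqr_gt0// x1 andbT.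
  exact: lt_trans x0.
have h0 : 0 < 2^-1 :> R by rewrite invr_gt0.
have h1 : 2^-1 < 1 :> R by rewrite invf_lt1// ltr1n.
have gpos := ratio_gt0 _ h0 h1.
have gneg : rho_ratio (- 2^-1) < 0 :> R.
  by rewrite /rho_ratio sqrrN mulNr oppr_lt0.
(* The sign of [rho] is dictated by the position of [p] relative to [Phi 0]; any correlation of that
   sign would serve. *)
have [Phi0|Phi0] := leP (normal_cdf (0 : mR R)) p%:E.
  have := coverage_inexact nuE nu1E nu2E p01 n2b (g := rho_ratio 2^-1).
  rewrite -QE cover ?eqxx; last by apply/andP; split => //; lra.
  by rewrite Phi0 gpos => /(_ isT).
have := coverage_inexact nuE nu1E nu2E p01 n2b (g := rho_ratio (- 2^-1)).
rewrite -QE cover ?eqxx; last by apply/andP; split; lra.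
by rewrite Phi0 gneg orbT => /(_ isT).
Qed.
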